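(* In the model described in the context, let $l\in\{1,2\}$. For each fixed $h\in\mathbb{R}$, $$\lim_{\alpha\to\alpha_0}\kappa_l(\alpha)\,\zeta_\alpha(\lambda_l^h(\alpha))=2\,\frac{\|a_{ll}\phi_l\|^2}{h^2+\|a_{ll}\phi_l\|^4}.$$
   Context: Inner products are linear in the first argument. On $\mathbb{R}^3$, $\widehat f(\xi)=(2\pi)^{-3/2}\int f(x)e^{-i\xi\cdot x}\,dx$. $H_0$ is the self-adjoint realization of $-\Delta$ on $L^2(\mathbb{R}^3)$. For $v\in L^2(\mathbb{R}^3)$, $\lambda\ge 0$, let $v_\lambda\in L^2(S^2)$, $v_\lambda(\omega)=2^{-1/2}\lambda^{1/4}\widehat v(\sqrt\lambda\,\omega)$; $v\mapsto(v_\lambda)_\lambda$ is unitary onto $L^2([0,\infty);L^2(S^2))$ and $(H_0v)_\lambda=\lambda v_\lambda$. $\mathcal{E}$ is the set of $v\in L^2(\mathbb{R}^3)$ such that $\lambda\mapsto v_\lambda$ is strongly smooth on $[0,\infty)$ and decays rapidly as $\lambda\to0$ and $\lambda\to\infty$ (for all $k,N\ge0$ the $k$-th strong derivative $v^{(k)}_\lambda$ satisfies $\lambda^{-N}\|v^{(k)}_\lambda\|\to0$ as $\lambda\to0$ and $\lambda^{N}\|v^{(k)}_\lambda\|\to0$ as $\lambda\to\infty$). For $v,w\in\mathcal{E}$, $\eta_{v,w}(\lambda)=\langle v_\lambda,w_\lambda\rangle$ for $\lambda\ge0$ and $0$ for $\lambda<0$. For $f\in\mathcal{S}(\mathbb{R})$,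 $\gamma(f,\lambda)=\lim_{\epsilon\to0^+}\int_{\mathbb{R}\setminus(\lambda-\epsilon,\lambda+\epsilon)}\frac{f(x)}{x-\lambda}\,dx$. For $v\in\mathcal{E}$ with $v_a=0$ ($a\ge0$), $\Phi_{v,a}\in L^2(\mathbb{R}^3)$ is given by $(\Phi_{v,a})_\lambda=v_\lambda/(\lambda-a)$ for $\lambda\ne a$ and $(\Phi_{v,a})_a=v'_a$. Perturbation: $u_1,u_2\in\mathcal{E}$, $u_1\perp u_2$, $V=\sum_{j=1}^2\langle\cdot,u_j\rangle u_j$, $H_\alpha=H_0+\alpha V$ ($\alpha\in\mathbb{R}$). Write $u_{j,\lambda}=(u_j)_\lambda$, $\eta_{jk}=\eta_{u_j,u_k}$. For real $\alpha,\lambda$, $B(\alpha,\lambda+i0)=C(\alpha,\lambda)+iD(\alpha,\lambda)$ is the $2\times2$ matrix with $c_{jk}(\alpha,\lambda)=\delta_{jk}+\alpha\gamma(\eta_{kj},\lambda)$, $d_{jk}(\alpha,\lambda)=\alpha\pi\eta_{kj}(\lambda)$; $\tilde c_{jk}(\alpha,\lambda)$ and $\tilde b_{jk}(\alpha,\lambda+i0)$ are the $(j,k)$ cofactors of $C(\alpha,\lambda)$ and $B(\alpha,\lambda+i0)$; $F=\det B(\alpha,\lambda+i0)=F_1+iF_2$ with $F_1,F_2$ real. Model: $\alpha_0\in\mathbb{R}$ and $\lambda_0>0$ are fixed, and (b) $u_{1,\lambda_0}=u_{2,\lambda_0}=0$ and $\delta_{jk}+\alpha_0\gamma(\eta_{jk},\lambda_0)=0$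 for $j,k\in\{1,2\}$ (equivalently $B(\alpha_0,\lambda_0+i0)=0$); put $\phi_j=\Phi_{u_j,\lambda_0}$; (c) $\langle\phi_1,\phi_2\rangle\ne0$ or $\|\phi_1\|\ne\|\phi_2\|$; the labelling is such that $\|\phi_1\|\le\|\phi_2\|$. Put $d=\sqrt{(\|\phi_1\|^2-\|\phi_2\|^2)^2+4|\langle\phi_1,\phi_2\rangle|^2}$. Paths: $I\ni\alpha_0$ and $J\ni\lambda_0$ are bounded open intervals with $\overline J\subset(0,\infty)$, and $\lambda_1,\lambda_2:I\to J$ are distinct smooth functions with $\lambda_j(\alpha_0)=\lambda_0$, $F_1(\alpha,\lambda_j(\alpha))=0$ for $\alpha\in I$, and $\lambda_j'(\alpha_0)=\frac{\|\phi_1\|^2+\|\phi_2\|^2+(-1)^{j+1}d}{2\alpha_0^2(\|\phi_1\|^2\|\phi_2\|^2-|\langle\phi_1,\phi_2\rangle|^2)}$; $I,J$ are small enough that for each $\alpha\in I$ the zeros of $F_1(\alpha,\cdot)$ in $\overline J$ are exactly $\lambda_1(\alpha),\lambda_2(\alpha)$. (d) $F_2(\alpha,\lambda_j(\alpha))\ne0$ for all $\alpha\in I\setminus\{\alpha_0\}$, $j=1,2$. Coefficients: with $q(z)=z/|z|$ for $z\ne0$ and $q(0)=1$, $a_{11}=\sqrt{(-1+\alpha_0^2\|\phi_2\|^2\lambda_1'(\alpha_0))/d}$ and $a_{22}=q(\langle\phi_1,\phi_2\rangle)\sqrt{(1-\alpha_0^2\|\phi_1\|^2\lambda_2'(\alpha_0))/d}$.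 For $\alpha\ne\alpha_0$ in $I$ close to $\alpha_0$ (so that the denominator is nonzero), $\kappa_l(\alpha)=\frac{F_2(\alpha,\lambda_l(\alpha))}{\alpha\,\tilde c_{ll}(\alpha,\lambda_l(\alpha))\|\phi_l\|^2}$, and $\lambda_l^h(\alpha)=\lambda_l(\alpha)+h\kappa_l(\alpha)$. Time delay: the scattering operator of the pair $(H_0,H_\alpha)$ is $S^{(\alpha)}=\Omega_+^{(\alpha)*}\Omega_-^{(\alpha)}$, $\Omega^{(\alpha)}_\pm=\mathrm{s\text{-}lim}_{t\to\pm\infty}e^{itH_\alpha}e^{-itH_0}$, and $(S^{(\alpha)}v)_\lambda=S^{(\alpha)}_\lambda v_\lambda$. For $\alpha\in I\setminus\{\alpha_0\}$, $\lambda\in J$ the scattering matrix on $L^2(S^2)$ is $S^{(\alpha)}_\lambda=I-\frac{2\pi i\alpha}{F(\alpha,\lambda)}\sum_{j,k=1}^2\tilde b_{jk}(\alpha,\lambda+i0)\langle\cdot,u_{j,\lambda}\rangle u_{k,\lambda}$. The average time delay is $\zeta_\alpha(\lambda)=\frac{d}{d\lambda}\arg(\det S^{(\alpha)}_\lambda)$ (locally smooth branch of $\arg$). It satisfies $\zeta_\alpha(\lambda)=-2\pi\xi_\alpha'(\lambda)$, where $\xi_\alpha(\lambda)=\frac1\pi\arg F(\alpha,\lambda)$ is Krein's spectral shift function. *)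

(* Defs.v *)
From HB Require Import structures.
From mathcomp Require Import all_boot all_order all_algebra.
From mathcomp Require Import complex lra.
From mathcomp Require Import all_classical all_reals all_analysis measurable_realfun.
Set Implicit Arguments.
Unset Strict Implicit.
Unset Printing Implicit Defensive.
Import Order.TTheory GRing.Theory Num.Theory.
Import numFieldNormedType.Exports.
Import Normc.
Local Open Scope classical_set_scope.
Local Open Scope ring_scope.
Local Open Scope complex_scope.
Notation space3 R := (measurableTypeR R * measurableTypeR R * measurableTypeR R)%type.

Section Sphere.
Variable R : realType.
Local Notation R3 := (space3 R).
Local Notation mR := (measurableTypeR R).
Definition lebesgue2 : {measure set _ -> \bar R} :=
  (@lebesgue_measure R \x @lebesgue_measure R)%E.
Definition lebesgue3 : {measure set _ -> \bar R} :=
  (lebesgue2 \x @lebesgue_measure R)%E.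

Definition dot3 (x y : R3) : R := x.1.1 * y.1.1 + x.1.2 * y.1.2 + x.2 * y.2.
Definition norm3 (x : R3) : R := Num.sqrt (dot3 x x).
Definition scale3 (r : R) (x : R3) : R3 := (r * x.1.1, r * x.1.2, r * x.2).
Definition dir3 (x : R3) : R3 := scale3 (norm3 x)^-1 x.

Lemma measurable_coord3 :
  [/\ measurable_fun [set: R3] (fun x : R3 => x.1.1 : R),
      measurable_fun [set: R3] (fun x : R3 => x.1.2 : R) &
      measurable_fun [set: R3] (fun x : R3 => x.2 : R)].
Proof.
split; last exact: measurable_snd.
- exact: (measurableT_comp measurable_fst measurable_fst).
- exact: (measurableT_comp measurable_snd measurable_fst).
Qed.

Lemma measurable_dot3 : measurable_fun [set: R3] (fun x => dot3 x x).
Proof.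
have [m1 m2 m3] := measurable_coord3.
by rewrite /dot3; apply: measurable_funD; [apply: measurable_funD|];
  apply: measurable_funM.
Qed.

Lemma measurable_norm3 : measurable_fun [set: R3] norm3.
Proof.
apply: (@measurableT_comp _ _ _ _ _ _ (@Num.sqrt R)); last exact: measurable_dot3.
apply: continuous_measurable_fun; exact: sqrt_continuous.
Qed.

Lemma measurable_dir3 : measurable_fun [set: R3] dir3.
Proof.
have mi : measurable_fun [set: R3] (fun x => (norm3 x)^-1).
  rewrite (_ : (fun x => _) = (fun x => norm3 x `^ (-1))); last first.
    by apply/funext => x; rewrite powR_inv1// sqrtr_ge0.
  by apply: (@measurableT_comp _ _ _ _ _ _ (fun r => r `^ (-1)));
    [exact: measurable_powR|exact: measurable_norm3].
have [m1 m2 m3] := measurable_coord3.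
by apply: measurable_fun_pair; [apply: measurable_fun_pair|];
  apply: measurable_funM.
Qed.

Definition ball3 : set R3 := [set x | norm3 x <= 1].
Lemma measurable_ball3 : measurable ball3.
Proof.
rewrite (_ : ball3 = norm3 @^-1` `]-oo, 1]).
  by rewrite -[X in measurable X]setTI; apply: measurable_norm3 => //.
by apply/seteqP; split => x /=; rewrite in_itv.
Qed.

Lemma lebesgue3_ball3_fin : (lebesgue3 ball3 < +oo)%E.
Proof.
pose I : set R := `[-1, 1]%classic.
have mI : measurable (I : set mR) by exact: measurable_itv.
have sub : ball3 `<=` (I `*` I) `*` I.
  move=> x; rewrite /ball3 /norm3 /dot3 /= -(@ler_sqr _ _ 1) ?nnegrE ?sqrtr_ge0//.
  rewrite expr1n sqr_sqrtr; last by rewrite !addr_ge0// -expr2 sqr_ge0.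
  rewrite -!expr2 => h; rewrite /I /= !in_itv /= -!ler_norml.
  rewrite -!(@ler_sqr _ `|_| 1) ?nnegrE// !real_normK ?num_real// expr1n.
  have := sqr_ge0 x.1.1; have := sqr_ge0 x.1.2; have := sqr_ge0 x.2.
  by move=> *; split; [split|]; lra.
have E2 : lebesgue2 (I `*` I) = (lebesgue_measure I * lebesgue_measure I)%E.
  exact: product_measure1E.
have E3 : lebesgue3 ((I `*` I) `*` I) =
    (lebesgue2 (I `*` I) * lebesgue_measure I)%E.
  by apply: product_measure1E => //; exact: measurableX.
apply: (@le_lt_trans _ _ (lebesgue3 ((I `*` I) `*` I))).
  apply: le_measure => //; rewrite inE; first exact: measurable_ball3.
  by apply: measurableX => //; exact: measurableX.
rewrite E3 E2 /I lebesgue_measure_itv/= lte_fin.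
by case: ifP => _; rewrite ?mule0// -!EFinD -!EFinM ltry.
Qed.

(* Surface measure of S^2 as a measure on R^3 that charges only S^2: the area
   of A is three times the volume of the cone {r w | 0 <= r <= 1, w in A}.
   Elements of L^2(S^2) are functions on R^3 up to [sphere_measure]-null sets. *)
Definition sphere_measure (A : set R3) : \bar R :=
  (3%:E * lebesgue3 (dir3 @^-1` A `&` ball3))%E.

Let sphere_scaleE : sphere_measure =
  mscale (NngNum (ler0n R 3))
    (measure_function_pushforward__canonical__measure_function_Measure
      (mrestr lebesgue3 measurable_ball3) measurable_dir3).
Proof. by []. Qed.

Let sphere0 : sphere_measure set0 = 0%E.
Proof. by rewrite sphere_scaleE measure0. Qed.

Let sphere_ge0 A : (0 <= sphere_measure A)%E.
Proof. by rewrite sphere_scaleE measure_ge0. Qed.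

Let sphere_sigma_additive : semi_sigma_additive sphere_measure.
Proof. by rewrite sphere_scaleE; exact: measure_semi_sigma_additive. Qed.

HB.instance Definition _ := isMeasure.Build _ _ _ sphere_measure
  sphere0 sphere_ge0 sphere_sigma_additive.

Let sphere_fin : fin_num_fun sphere_measure.
Proof.
move=> A mA; rewrite ge0_fin_numE ?sphere_ge0//.
rewrite /sphere_measure lte_mul_pinfty//.
apply: le_lt_trans lebesgue3_ball3_fin.
apply: le_measure => //; rewrite inE; last exact: measurable_ball3.
apply: measurableI; last exact: measurable_ball3.
by rewrite -[X in measurable X]setTI; apply: measurable_dir3.
Qed.

HB.instance Definition _ := Measure_isFinite.Build _ _ _ sphere_measure sphere_fin.
End Sphere.
Arguments lebesgue3 R : clear implicits.
Arguments sphere_measure R A : clear implicits.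

Section L2.
Context d (T : measurableType d) (R : realType).
Variable mu : {measure set T -> \bar R}.
Implicit Types f g : T -> R[i].

Definition measurable_complex f :=
  measurable_fun setT (fun x => complex.Re (f x)) /\
  measurable_fun setT (fun x => complex.Im (f x)).

Definition L1 f := measurable_complex f /\
  mu.-integrable setT (fun x => (normc (f x))%:E).

Definition L2 f := measurable_complex f /\
  mu.-integrable setT (fun x => (normc (f x) ^+ 2)%:E).

Definition cintegral (D : set T) f : R[i] :=
  (\int[mu]_(x in D) complex.Re (f x)) +i* (\int[mu]_(x in D) complex.Im (f x)).

Definition inner f g : R[i] := cintegral setT (fun x => f x * (g x)^*).

Definition L2norm f : R := Num.sqrt (\int[mu]_x (normc (f x) ^+ 2)).

(* [e] is linearly independent in L^2, where null functions are zero. *)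
Definition L2_free n (e : 'I_n -> T -> R[i]) := forall c : 'I_n -> R[i],
  (\forall x \ae mu, \sum_(i < n) c i * e i x = 0) -> forall i, c i = 0.

(* Determinant of an operator [K] on L^2 with [K - 1] of finite rank: the
   determinant of the matrix of [K] on a finite-dimensional subspace that
   contains the range of [K - 1]. *)
Definition is_determinant (K : (T -> R[i]) -> T -> R[i]) (z : R[i]) :=
  exists n (e : 'I_n -> T -> R[i]) (M : 'M[R[i]]_n),
    [/\ (forall i, L2 (e i)) /\ L2_free e,
        forall f, L2 f -> exists c : 'I_n -> R[i],
          \forall x \ae mu, K f x - f x = \sum_(i < n) c i * e i x,
        forall j, \forall x \ae mu, K (e j) x = \sum_(i < n) M i j * e i x &
        z = \det M].

Definition determinant K : R[i] := xget 0 [set z | is_determinant K z].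

(* [U t] is e^{itA}: the strongly continuous one-parameter unitary group with
   generator iA; [A v w] means that v is in the domain of A and Av = w. *)
Definition unitary_group_of (A : (T -> R[i]) -> (T -> R[i]) -> Prop)
    (U : R -> (T -> R[i]) -> T -> R[i]) :=
  [/\ forall t v, L2 v -> L2 (U t v) /\ L2norm (U t v) = L2norm v,
      forall t (a : R[i]) v w, L2 v -> L2 w ->
        \forall x \ae mu, U t (fun y => a * v y + w y) x = a * U t v x + U t w x,
      forall v, L2 v -> (\forall x \ae mu, U 0 v x = v x) /\
        forall s t, \forall x \ae mu, U (s + t) v x = U s (U t v) x,
      forall v, L2 v ->
        L2norm (fun x => U t v x - v x) @[t --> (0 : R)] --> (0 : R) &
      forall v w, A v w ->
        L2norm (fun x => (U t v x - v x) / t%:C - 'i%C * w x) @[t --> (0 : R)^']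
          --> (0 : R)].

Definition wave_operator (U0 U : R -> (T -> R[i]) -> T -> R[i])
    (time : set_system R) (W : (T -> R[i]) -> T -> R[i]) :=
  forall v, L2 v -> L2 (W v) /\
    L2norm (fun x => U t (U0 (- t) v) x - W v x) @[t --> time] --> (0 : R).

End L2.

Section Spectral.
Variable R : realType.
Local Notation R3 := (space3 R).
Local Notation fn := (space3 R -> R[i]).
Local Notation leb3 := (lebesgue3 R).
Local Notation sph := (sphere_measure R).

Definition half_line : {measure set _ -> \bar R} :=
  mrestr (@lebesgue_measure R) (measurable_itv `[0, +oo[).

(* L^2([0,oo); L^2(S^2)) is identified with L^2([0,oo) x S^2). *)
Definition spectral_measure : {measure set _ -> \bar R} :=
  (half_line \x sphere_measure R)%E.

Definition fourier (v : fn) (xi : R3) : R[i] :=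
  ((2 * pi) `^ (- (3 / 2)))%:C *
  cintegral leb3 setT (fun x => v x * (cos (dot3 xi x) -i* sin (dot3 xi x))).

(* [T v (lam, w)] is v_lam(w). The Fourier-Plancherel transform is determined
   by the integral formula on L^1 /\ L^2 and by unitarity. *)
Definition spectral_representation (T : fn -> measurableTypeR R * R3 -> R[i]) :=
  [/\ forall v, L2 leb3 v -> L2 spectral_measure (T v),
      forall (a : R[i]) v w, L2 leb3 v -> L2 leb3 w ->
        \forall p \ae spectral_measure,
          T (fun x => a * v x + w x) p = a * T v p + T w p,
      forall v w, L2 leb3 v -> L2 leb3 w ->
        inner spectral_measure (T v) (T w) = inner leb3 v w,
      forall g, L2 spectral_measure g -> exists2 v, L2 leb3 v &
        \forall p \ae spectral_measure, T v p = g p &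
      forall v, L1 leb3 v -> L2 leb3 v ->
        \forall p \ae spectral_measure,
          T v p = ((Num.sqrt 2)^-1 * p.1 `^ (1 / 4))%:C *
                  fourier v (scale3 (Num.sqrt p.1) p.2)].

Section FixedT.
Variable T : fn -> measurableTypeR R * R3 -> R[i].

(* [c k lam] is the k-th strong derivative of lam |-> v_lam on [0,oo) (one-sided
   at 0), so that [c 0%N] is the smooth representative of (v_lam). *)
Definition smooth_fibres (c : nat -> R -> fn) := forall k : nat,
  [/\ forall lam, 0 <= lam -> L2 sph (c k lam),
      forall lam, 0 <= lam ->
        L2norm sph (fun w => (c k (lam + t) w - c k lam w) / t%:C - c k.+1 lam w)
          @[t --> within [set t | 0 <= lam + t] (0 : R)^'] --> (0 : R),
      forall N : nat, lam ^- N * L2norm sph (c k lam) @[lam --> (0 : R)^'+]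
        --> (0 : R) &
      forall N : nat, lam ^+ N * L2norm sph (c k lam) @[lam --> +oo]
        --> (0 : R)].

(* v belongs to the space E, with fibres v_lam = [c 0%N lam]. *)
Definition in_E (v : fn) (c : nat -> R -> fn) :=
  [/\ L2 leb3 v, smooth_fibres c &
      \forall lam \ae half_line, \forall w \ae sph, T v (lam, w) = c 0%N lam w].

(* p is Phi_{v,a}, for v in E with fibres [c] and v_a = 0. *)
Definition is_Phi (c : nat -> R -> fn) (a : R) (p : fn) :=
  L2 leb3 p /\
  \forall lam \ae half_line, \forall w \ae sph,
    T p (lam, w) = if lam == a then c 1%N a w else c 0%N lam w / (lam - a)%:C.

(* Graph of H_0: H_0 v = w. *)
Definition H_0 (v w : fn) := [/\ L2 leb3 v, L2 leb3 w &
  \forall p \ae spectral_measure, T w p = p.1%:C * T v p].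

Definition V_pert (u : 'I_2 -> fn) (v : fn) : fn :=
  fun x => \sum_j inner leb3 v (u j) * u j x.

(* Graph of H_alpha = H_0 + alpha V. *)
Definition H_alpha (u : 'I_2 -> fn) (alpha : R) (v w : fn) :=
  H_0 v (fun x => w x - alpha%:C * V_pert u v x).

(* [S lam] are the fibres of the scattering operator of the pair (H_0, H_alpha). *)
Definition scattering_matrix (u : 'I_2 -> fn) (alpha : R) (S : R -> fn -> fn) :=
  exists (U0 U : R -> fn -> fn) (Wplus Wminus Sop : fn -> fn),
    [/\ unitary_group_of leb3 H_0 U0 /\ unitary_group_of leb3 (H_alpha u alpha) U,
        wave_operator leb3 U0 U +oo Wplus,
        wave_operator leb3 U0 U -oo Wminus,
        forall v, L2 leb3 v -> L2 leb3 (Sop v) /\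
          forall w, L2 leb3 w ->
            inner leb3 (Sop v) w = inner leb3 (Wminus v) (Wplus w) &
        forall v, L2 leb3 v ->
          \forall lam \ae half_line, \forall w \ae sph,
            T (Sop v) (lam, w) = S lam (fun w' => T v (lam, w')) w].

End FixedT.

(* z is the derivative at [lam] of a branch of arg g near [lam]. Two such branches
   differ by a constant near [lam], so z does not depend on the branch, and it is
   the derivative of the smooth branch when g is smooth. *)
Definition is_arg_derivative (g : R -> R[i]) (lam z : R) :=
  exists theta : R -> R,
    [/\ \forall mu \near lam, g mu != 0,
        \forall mu \near lam, derivable theta mu 1,
        \forall mu \near lam, g mu =
          (normc (g mu))%:C * (cos (theta mu) +i* sin (theta mu)) &
        derive1 theta lam = z].

Definition time_delay (S : R -> fn -> fn) (lam : R) : R :=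
  xget 0 [set z | is_arg_derivative (fun mu => determinant sph (S mu)) lam z].

Definition spectral_density (v w : R -> fn) (lam : R) : R[i] :=
  if 0 <= lam then inner sph (v lam) (w lam) else 0.

Definition principal_value (f : R -> R) (lam : R) : R :=
  lim (\int[@lebesgue_measure R]_(x in ~` `]lam - e, lam + e[) (f x / (x - lam))
    @[e --> (0 : R)^'+]).

Definition pv_transform (f : R -> R[i]) (lam : R) : R[i] :=
  principal_value (fun x => complex.Re (f x)) lam +i*
  principal_value (fun x => complex.Im (f x)) lam.

Section Matrices.
(* [u j lam] is u_{j,lam}. *)
Variable u : 'I_2 -> R -> fn.

Definition C_matrix (alpha lam : R) : 'M[R[i]]_2 :=
  \matrix_(j, k) ((j == k)%:R + alpha%:C * pv_transform (spectral_density (u k) (u j)) lam).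

Definition D_matrix (alpha lam : R) : 'M[R[i]]_2 :=
  \matrix_(j, k) ((alpha * pi)%:C * spectral_density (u k) (u j) lam).

Definition B_matrix (alpha lam : R) : 'M[R[i]]_2 :=
  C_matrix alpha lam + 'i%C *: D_matrix alpha lam.

Definition detB (alpha lam : R) : R[i] := \det (B_matrix alpha lam).
Definition F1 (alpha lam : R) : R := complex.Re (detB alpha lam).
Definition F2 (alpha lam : R) : R := complex.Im (detB alpha lam).

Definition stationary_smatrix (alpha lam : R) (f : fn) : fn := fun w =>
  f w - (2 * pi * alpha)%:C * 'i%C / detB alpha lam *
    \sum_j \sum_k cofactor (B_matrix alpha lam) j k *
      inner sph f (u j lam) * u k lam w.

(* C is Hermitian, so its diagonal cofactors are real. *)
Definition kappa (lambda : 'I_2 -> R -> R) (phi : 'I_2 -> fn)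
    (l : 'I_2) (alpha : R) : R :=
  F2 alpha (lambda l alpha) /
  (alpha * complex.Re (cofactor (C_matrix alpha (lambda l alpha)) l l) *
   L2norm leb3 (phi l) ^+ 2).

End Matrices.

(* The indices 1, 2 are [ord0], [ord_max] of ['I_2], so that the sign
   (-1)^(j+1) becomes (-1)^j. *)
Definition discriminant (phi : 'I_2 -> fn) : R :=
  Num.sqrt ((L2norm leb3 (phi ord0) ^+ 2 - L2norm leb3 (phi ord_max) ^+ 2) ^+ 2 +
    4 * normc (inner leb3 (phi ord0) (phi ord_max)) ^+ 2).

Definition phase (z : R[i]) : R[i] := if z == 0 then 1 else z / (normc z)%:C.

Definition diag_coef (alpha0 : R) (lambda : 'I_2 -> R -> R) (phi : 'I_2 -> fn)
    (l : 'I_2) : R[i] :=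
  if l == ord0 then
    (Num.sqrt ((- 1 + alpha0 ^+ 2 * L2norm leb3 (phi ord_max) ^+ 2 *
        derive1 (lambda ord0) alpha0) / discriminant phi))%:C
  else
    phase (inner leb3 (phi ord0) (phi ord_max)) *
    (Num.sqrt ((1 - alpha0 ^+ 2 * L2norm leb3 (phi ord0) ^+ 2 *
        derive1 (lambda ord_max) alpha0) / discriminant phi))%:C.

End Spectral.

(* Main.v *)
Require Import Defs.
From HB Require Import structures.
From mathcomp Require Import all_boot all_order all_algebra.
From mathcomp Require Import complex ring lra.
From mathcomp Require Import all_classical all_reals all_analysis measurable_realfun.
Set Implicit Arguments.
Unset Strict Implicit.
Unset Printing Implicit Defensive.
Import Order.TTheory GRing.Theory Num.Theory.
Import numFieldNormedType.Exports.
Import Normc.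
Local Open Scope classical_set_scope.
Local Open Scope ring_scope.
Local Open Scope complex_scope.

(** The scattering matrix is the identity minus an operator of rank at most two,
    so its determinant is that of a two by two matrix. With [B = C + i D] and
    [F = \det B], it equals [\det (B - 2 i D) / F = \det (C - i D) / F], which is
    [conj F / F] because [C] and [D] are Hermitian ([determinant_smatrix]). Hence
    the time delay is [-2 (F1 F2' - F2 F1') / (F1 ^ 2 + F2 ^ 2)], the prime being
    the derivative in the spectral parameter ([arg_derivative_conj_div],
    [time_delayE]).

    The densities [eta_jk] are smooth and decay, vanishing with their first
    derivatives at [lambda0] because both fibres vanish there. At such a double
    zero integration by parts gives the derivative of the principal value
    transform as the absolutely convergent integral of
    [eta_jk x / (x - lambda0) ^ 2] ([hilbert_derivative_double_zero]), and
    unitarity of the spectral representation identifies it with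
    [<phi_j, phi_k>] ([gram_formula]).

    Let [e = alpha - alpha0] and follow a path [mu alpha] that leaves
    [(alpha0, lambda0)] with slope [s]. Along it the entries of [C] are of
    order [e], with limits of the quotients by [e] read off from the Gram matrix
    of the [phi_j], while those of [D] are [o(e)] and their derivatives in the
    spectral parameter are [o(1)]. So [F1'] is [tau e + o(e)], [F2'] is
    [o(e)] and [F2] is [o(e ^ 2)], whereas the cofactor [c] in the
    denominator of [kappa] is [gam e + o(e)]. Consequently [kappa] is [o(e)]
    and the evaluation point [lambda_l + h kappa] still has slope [s]. By the
    mean value theorem [F1] is there close to [tau e h kappa], and [F2] is close
    to its value at [lambda_l], which is [alpha c n kappa] with
    [n = |phi_l| ^ 2] by the definition of [kappa]. Inserting this in the
    formula for the delay gives the limit [2 r / (h ^ 2 + r ^ 2)] with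
    [r = alpha0 gam n / tau] ([peak_limit]).

    It remains to evaluate [r]. The slopes of the two paths make [tau] equal to
    [d] and [- d], and [alpha0 gam / tau] equal to the radicand of the
    coefficient [a_ll] ([rate_first], [rate_second]). That these quantities are
    well defined and positive rests on the strict positivity of the Gram
    determinant: if a combination of the [phi_j] vanishes, so does the same
    combination of the fibres at every spectral parameter, which contradicts
    [alpha0 gamma(eta_jk, lambda0) = - delta_jk] ([gram_definite]). *)

(** * Complex scalars and square-integrable functions *)

Section ComplexScalars.
Local Open Scope ring_scope.
Variable R : realType.
Implicit Types a b : R[i].
Local Notation Re := complex.Re.
Local Notation Im := complex.Im.

Lemma ReD a b : Re (a + b) = Re a + Re b. Proof. by case: a; case: b. Qed.
Lemma ImD a b : Im (a + b) = Im a + Im b. Proof. by case: a; case: b. Qed.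
Lemma ReM a b : Re (a * b) = Re a * Re b - Im a * Im b.
Proof. by case: a; case: b. Qed.
Lemma ImM a b : Im (a * b) = Re a * Im b + Im a * Re b.
Proof. by case: a => ? ?; case: b => ? ? /=; ring. Qed.
Lemma ReN a : Re (- a) = - Re a. Proof. by case: a. Qed.
Lemma ImN a : Im (- a) = - Im a. Proof. by case: a. Qed.
Lemma ReJ a : Re (a^*) = Re a. Proof. by case: a. Qed.
Lemma ImJ a : Im (a^*) = - Im a. Proof. by case: a. Qed.
Lemma ReZ (r : R) a : Re (r%:C * a) = r * Re a.
Proof. by rewrite ReM /= mul0r subr0. Qed.
Lemma ImZ (r : R) a : Im (r%:C * a) = r * Im a.
Proof. by rewrite ImM /= mul0r addr0. Qed.
(** Expands the components of a complex expression into real polynomials, for [ring]. *)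
Definition ReImE := (ReD, ImD, ReM, ImM, ReN, ImN, ReJ, ImJ).

Lemma complex_ext a b : Re a = Re b -> Im a = Im b -> a = b.
Proof. by case: a => ? ?; case: b => ? ? /= -> ->. Qed.

Lemma conjcN a : (- a)^* = - a^*. Proof. exact: rmorphN. Qed.
Lemma conjcB a b : (a - b)^* = a^* - b^*. Proof. exact: rmorphB. Qed.
Lemma conjcM a b : (a * b)^* = a^* * b^*. Proof. exact: rmorphM. Qed.

Lemma conjcJ a : (a^*)^* = a. Proof. exact: conjCK. Qed.

Lemma normc_sqrE a : normc a ^+ 2 = Re a ^+ 2 + Im a ^+ 2.
Proof. by case: a => x y /=; rewrite sqr_sqrtr// addr_ge0 ?sqr_ge0. Qed.

Lemma normc_sqrJ a : (normc a ^+ 2)%:C = a * a^*.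
Proof.
by rewrite normc_sqrE; apply: complex_ext; rewrite !ReImE /=; ring.
Qed.

Lemma normc_ge0 a : 0 <= normc a.
Proof. by case: a => x y /=; exact: sqrtr_ge0. Qed.

Lemma normcJ' a : normc (a^*) = normc a.
Proof. by case: a => x y /=; rewrite sqrrN. Qed.

Lemma normcR (r : R) : normc r%:C = `|r|.
Proof. by rewrite /= expr0n addr0 sqrtr_sqr. Qed.

Lemma Re_le_normc a : `|Re a| <= normc a.
Proof. by case: a => x y /=; rewrite -sqrtr_sqr ler_wsqrtr// lerDl sqr_ge0. Qed.

Lemma Im_le_normc a : `|Im a| <= normc a.
Proof. by case: a => x y /=; rewrite -sqrtr_sqr ler_wsqrtr// lerDr sqr_ge0. Qed.

Lemma normc_zero : normc (0 : R[i]) = 0.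
Proof. by rewrite /= expr0n addr0 sqrtr0. Qed.

End ComplexScalars.

Section L2Theory.
Local Open Scope ring_scope.
Context d (T : measurableType d) (R : realType).
Variable mu : {measure set T -> \bar R}.
Implicit Types f g h : T -> R[i].
Local Notation Re := complex.Re.
Local Notation Im := complex.Im.

Lemma measurable_complexD f g : measurable_complex f -> measurable_complex g ->
  measurable_complex (fun x => f x + g x).
Proof.
move=> [f1 f2] [g1 g2]; split.
  by under eq_fun do rewrite ReD; exact: measurable_funD.
by under eq_fun do rewrite ImD; exact: measurable_funD.
Qed.

Lemma measurable_complexM f g : measurable_complex f -> measurable_complex g ->
  measurable_complex (fun x => f x * g x).
Proof.
move=> [f1 f2] [g1 g2]; split.
  under eq_fun do rewrite ReM.
  by apply: measurable_funB; exact: measurable_funM.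
under eq_fun do rewrite ImM.
by apply: measurable_funD; exact: measurable_funM.
Qed.

Lemma measurable_complexJ f : measurable_complex f ->
  measurable_complex (fun x => (f x)^*).
Proof.
move=> [f1 f2]; split; first by under eq_fun do rewrite ReJ.
by under eq_fun do rewrite ImJ; exact: measurable_funN.
Qed.

Lemma measurable_complex_cst (a : R[i]) : measurable_complex (fun _ : T => a).
Proof. by split; exact: measurable_cst. Qed.

Lemma measurable_normc_sqr f : measurable_complex f ->
  measurable_fun setT (fun x => normc (f x) ^+ 2).
Proof.
move=> [f1 f2]; under eq_fun do rewrite normc_sqrE.
by apply: measurable_funD; apply: measurable_funX.
Qed.

(** The condition under which [cintegral] is linear. *)
Definition cintegrable f :=
  mu.-integrable setT (EFin \o (fun x => Re (f x))) /\
  mu.-integrable setT (EFin \o (fun x => Im (f x))).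

Lemma integrable_lincomb (a b : R) (f g : T -> R) :
  mu.-integrable setT (EFin \o f) -> mu.-integrable setT (EFin \o g) ->
  mu.-integrable setT (EFin \o (fun x => a * f x + b * g x)).
Proof.
move=> mf mg; rewrite (_ : _ \o _ =
  ((fun x => a%:E * (EFin \o f) x) \+ (fun x => b%:E * (EFin \o g) x))%E)//.
by apply: integrableD => //; exact: integrableZl.
Qed.

Lemma Rintegral_lincomb (a b : R) (f g : T -> R) :
  mu.-integrable setT (EFin \o f) -> mu.-integrable setT (EFin \o g) ->
  \int[mu]_x (a * f x + b * g x) = a * \int[mu]_x f x + b * \int[mu]_x g x.
Proof.
move=> mf mg; rewrite RintegralD ?RintegralZl//.
  exact: (@integrableZl _ _ _ mu setT measurableT a (EFin \o f)).
exact: (@integrableZl _ _ _ mu setT measurableT b (EFin \o g)).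
Qed.

Lemma cintegralE_lincomb (a : R[i]) f g : cintegrable f -> cintegrable g ->
  cintegral mu setT (fun x => a * f x + g x) =
  a * cintegral mu setT f + cintegral mu setT g.
Proof.
move=> [f1 f2] [g1 g2].
have i1 := integrable_lincomb (Re a) (- Im a) f1 f2.
have i2 := integrable_lincomb (Re a) (Im a) f2 f1.
apply: complex_ext; rewrite /cintegral !ReImE /=.
  under eq_Rintegral do rewrite ReD ReM -mulNr -[Re (g _)]mul1r -[X in X + _]mul1r.
  by rewrite Rintegral_lincomb// !mul1r Rintegral_lincomb// mulNr.
under eq_Rintegral do rewrite ImD ImM -[Im (g _)]mul1r -[X in X + _]mul1r.
by rewrite Rintegral_lincomb// !mul1r Rintegral_lincomb.
Qed.

Lemma cintegralJ f : cintegrable f ->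
  cintegral mu setT (fun x => (f x)^*) = (cintegral mu setT f)^*.
Proof.
move=> [f1 f2]; rewrite /cintegral; apply: complex_ext => /=.
  by apply: eq_Rintegral => x _; rewrite ReJ.
under eq_Rintegral do rewrite ImJ -mulN1r.
by rewrite RintegralZl// mulN1r.
Qed.

Lemma L2_cintegrable f g : L2 mu f -> L2 mu g ->
  cintegrable (fun x => f x * (g x)^*).
Proof.
move=> [mf lf] [mg lg].
have [m1 m2] := measurable_complexM mf (measurable_complexJ mg).
have ilg := integrable_lincomb (1/2) (1/2) lf lg.
have bnd x : normc (f x * (g x)^*) <=
    1/2 * normc (f x) ^+ 2 + 1/2 * normc (g x) ^+ 2.
  rewrite normcM normcJ'.
  have := sqr_ge0 (normc (f x) - normc (g x)).
  by nra.
split; (apply: (le_integrable _ _ _ ilg) => //; first exact/measurable_EFinP);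
  move=> x _ /=; rewrite lee_fin; apply: (le_trans _ (ler_norm _));
  apply: (le_trans _ (bnd x)); [exact: Re_le_normc|exact: Im_le_normc].
Qed.

Lemma L2_lincomb (a : R[i]) f g : L2 mu f -> L2 mu g ->
  L2 mu (fun x => a * f x + g x).
Proof.
move=> [mf lf] [mg lg]; have mh : measurable_complex (fun x => a * f x + g x).
  apply: measurable_complexD => //.
  by apply: measurable_complexM => //; exact: measurable_complex_cst.
split=> //.
have ilg := integrable_lincomb (2 * normc a ^+ 2) 2 lf lg.
apply: (le_integrable _ _ _ ilg) => //.
  by apply/measurable_EFinP; exact: measurable_normc_sqr.
move=> x _ /=; rewrite lee_fin ger0_norm ?sqr_ge0//.
apply: (le_trans _ (ler_norm _)).
have := le_normcD (a * f x) (g x); rewrite -/(normc _) normcM.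
have := normc_ge0 (a * f x + g x).
have := normc_ge0 a; have := normc_ge0 (f x); have := normc_ge0 (g x).
move: (normc (a * f x + g x)) (normc (f x)) (normc (g x)) (normc a) => u v w z.
move=> w0 v0 z0 u0 uv.
have u2 : u ^+ 2 <= (z * v + w) ^+ 2 by rewrite ler_sqr// nnegrE addr_ge0 ?mulr_ge0.
by have := sqr_ge0 (z * v - w); nra.
Qed.

Lemma L2_0 : L2 mu (fun=> 0).
Proof.
split; first exact: measurable_complex_cst.
apply: (eq_integrable measurableT (cst 0)) => //; last exact: integrable0.
by move=> x _ /=; rewrite !expr0n /= addr0 sqrtr0 expr0n.
Qed.

Lemma L2_scale (a : R[i]) f : L2 mu f -> L2 mu (fun x => a * f x).
Proof.
move=> lf; have := L2_lincomb a lf L2_0.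
by under eq_fun do rewrite addr0.
Qed.

Lemma L2_sub f g : L2 mu f -> L2 mu g -> L2 mu (fun x => f x - g x).
Proof.
move=> lf lg; have := L2_lincomb (-1) lg lf.
by under eq_fun do rewrite mulN1r addrC.
Qed.

Lemma L2_sum n (c : 'I_n -> R[i]) (e : 'I_n -> T -> R[i]) :
  (forall i, L2 mu (e i)) -> L2 mu (fun x => \sum_i c i * e i x).
Proof.
elim: n c e => [|n IHn] c e le.
  by under eq_fun do rewrite big_ord0; exact: L2_0.
under eq_fun do rewrite big_ord_recl.
by apply: L2_lincomb => //; exact: IHn.
Qed.

Lemma inner_lincomb (a : R[i]) f g h : L2 mu f -> L2 mu g -> L2 mu h ->
  inner mu (fun x => a * f x + g x) h = a * inner mu f h + inner mu g h.
Proof.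
move=> lf lg lh; rewrite /inner -cintegralE_lincomb; try exact: L2_cintegrable.
by congr cintegral; apply/funext => x; rewrite mulrDl mulrA.
Qed.

Lemma innerJ f g : L2 mu f -> L2 mu g -> inner mu g f = (inner mu f g)^*.
Proof.
move=> lf lg; rewrite /inner -cintegralJ; last exact: L2_cintegrable.
congr cintegral; apply/funext => x.
by rewrite conjcM conjcJ mulrC.
Qed.

Lemma inner0l f : inner mu (fun=> 0) f = 0.
Proof.
rewrite /inner /cintegral; under eq_Rintegral do rewrite mul0r.
under [X in _ +i* X]eq_Rintegral do rewrite mul0r.
by rewrite /= /Rintegral integral0.
Qed.

Lemma inner_scale (a : R[i]) f h : L2 mu f -> L2 mu h ->
  inner mu (fun x => a * f x) h = a * inner mu f h.
Proof.
move=> lf lh; have := inner_lincomb a lf L2_0 lh.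
by under eq_fun do rewrite addr0; rewrite inner0l addr0.
Qed.

Lemma inner_sub f g h : L2 mu f -> L2 mu g -> L2 mu h ->
  inner mu (fun x => f x - g x) h = inner mu f h - inner mu g h.
Proof.
move=> lf lg lh; have := inner_lincomb (-1) lg lf lh.
by under eq_fun do rewrite mulN1r addrC; rewrite mulN1r addrC.
Qed.

Lemma inner_sum n (c : 'I_n -> R[i]) (e : 'I_n -> T -> R[i]) h :
  (forall i, L2 mu (e i)) -> L2 mu h ->
  inner mu (fun x => \sum_i c i * e i x) h = \sum_i c i * inner mu (e i) h.
Proof.
elim: n c e => [|n IHn] c e le lh.
  by under eq_fun do rewrite big_ord0; rewrite inner0l big_ord0.
under eq_fun do rewrite big_ord_recl.
rewrite inner_lincomb ?big_ord_recl ?IHn//.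
by apply: L2_sum.
Qed.

Lemma inner_scaler (a : R[i]) f h : L2 mu f -> L2 mu h ->
  inner mu h (fun x => a * f x) = a^* * inner mu h f.
Proof.
move=> lf lh; rewrite (innerJ _ lh); last exact: L2_scale.
by rewrite inner_scale// conjcM -innerJ.
Qed.

Lemma inner_subr f g h : L2 mu f -> L2 mu g -> L2 mu h ->
  inner mu h (fun x => f x - g x) = inner mu h f - inner mu h g.
Proof.
move=> lf lg lh; rewrite (innerJ _ lh); last exact: L2_sub.
by rewrite inner_sub// conjcB -!innerJ.
Qed.

Lemma inner_sumr n (c : 'I_n -> R[i]) (e : 'I_n -> T -> R[i]) h :
  (forall i, L2 mu (e i)) -> L2 mu h ->
  inner mu h (fun x => \sum_i c i * e i x) =
  \sum_i (c i)^* * inner mu h (e i).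
Proof.
move=> le lh; rewrite (innerJ _ lh); last exact: L2_sum.
rewrite inner_sum// rmorph_sum; apply: eq_bigr => i _.
by rewrite [LHS]conjcM -innerJ.
Qed.

Lemma L2norm_ge0 f : 0 <= L2norm mu f. Proof. exact: sqrtr_ge0. Qed.

Lemma L2norm_sqr f : L2norm mu f ^+ 2 = \int[mu]_x (normc (f x) ^+ 2).
Proof. by rewrite sqr_sqrtr// Rintegral_ge0// => x _; exact: sqr_ge0. Qed.

Lemma inner_self f : inner mu f f = (L2norm mu f ^+ 2)%:C.
Proof.
rewrite L2norm_sqr /inner /cintegral.
under eq_Rintegral do rewrite -normc_sqrJ /=.
under [X in _ +i* X]eq_Rintegral do rewrite -normc_sqrJ /=.
by congr (_ +i* _); rewrite /Rintegral integral0.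
Qed.

Lemma L2norm_scale (a : R[i]) f : L2 mu f ->
  L2norm mu (fun x => a * f x) = normc a * L2norm mu f.
Proof.
move=> lf; rewrite /L2norm; under eq_Rintegral do rewrite normcM exprMn.
by rewrite RintegralZl//; [rewrite sqrtrM ?sqr_ge0// sqrtr_sqr
  ger0_norm ?normc_ge0|exact: (proj2 lf)].
Qed.

Lemma L2norm_sqr_sub f g (a : R[i]) : L2 mu f -> L2 mu g ->
  L2norm mu (fun x => f x - a * g x) ^+ 2 = L2norm mu f ^+ 2 -
   2 * Re (a^* * inner mu f g) + normc a ^+ 2 * L2norm mu g ^+ 2.
Proof.
move=> lf lg; apply: complexI; rewrite -inner_self.
have lag := L2_scale a lg.
rewrite inner_sub ?inner_subr ?inner_scaler ?inner_scale//; last exact: L2_sub.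
rewrite (innerJ lf lg) !inner_self.
have := normc_sqrE a.
move: (inner mu f g) (L2norm mu f) (L2norm mu g) (normc a) => [x y] u v z ->.
by apply: complex_ext; rewrite !ReImE /=; ring.
Qed.

(** The quadratic polynomial [t |-> |f - t <f, g> g| ^ 2] in the real variable [t]
    is nonnegative. *)
Lemma cauchy_schwarz f g : L2 mu f -> L2 mu g ->
  normc (inner mu f g) <= L2norm mu f * L2norm mu g.
Proof.
move=> lf lg; have f0 := L2norm_ge0 f; have g0 := L2norm_ge0 g.
rewrite -(@ler_pXn2r _ 2) ?nnegrE ?normc_ge0 ?mulr_ge0//.
have pos t : 0 <= L2norm mu f ^+ 2 - 2 * t * normc (inner mu f g) ^+ 2 +
    t ^+ 2 * normc (inner mu f g) ^+ 2 * L2norm mu g ^+ 2.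
  rewrite -[t ^+ 2]real_normK ?num_real// -exprMn -normcR -normcM.
  have -> : 2 * t * normc (inner mu f g) ^+ 2 =
     2 * Re ((t%:C * inner mu f g)^* * inner mu f g).
    by rewrite normc_sqrE; case: (inner mu f g) => x y; rewrite !ReImE /=; ring.
  by rewrite -L2norm_sqr_sub// sqr_ge0.
move: (normc _) (L2norm mu f) (L2norm mu g) f0 g0 pos => z u v u0 v0 pos.
rewrite exprMn; have [v00|v00] := eqVneq v 0.
  move: pos; rewrite v00 => pos; have := pos ((u ^+ 2 + 1) / z ^+ 2).
  have [->|z0] := eqVneq z 0; first by rewrite !expr0n /=; lra.
  by rewrite -!mulrA mulVf ?expf_neq0//; have := sqr_ge0 u; lra.
have v2 : 0 < v ^+ 2 by rewrite exprn_gt0// lt0r v00.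
have := pos (v ^+ 2)^-1; rewrite -(ler_pM2r v2) mul0r.
set w := _ ^-1; have vw : v ^+ 2 * w = 1 by rewrite mulfV ?gt_eqF.
have -> : (u ^+ 2 - 2 * w * z ^+ 2 + w ^+ 2 * z ^+ 2 * v ^+ 2) * v ^+ 2 =
   u ^+ 2 * v ^+ 2 - 2 * z ^+ 2 * (v ^+ 2 * w) + (v ^+ 2 * w) ^+ 2 * z ^+ 2.
  by ring.
by rewrite vw; lra.
Qed.

Lemma L2norm_triangle f g : L2 mu f -> L2 mu g ->
  L2norm mu (fun x => f x + g x) <= L2norm mu f + L2norm mu g.
Proof.
move=> lf lg; have f0 := L2norm_ge0 f; have g0 := L2norm_ge0 g.
rewrite -(@ler_pXn2r _ 2) ?nnegrE ?addr_ge0 ?L2norm_ge0//.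
have := L2norm_sqr_sub (-1) lf lg.
under eq_fun do rewrite mulN1r opprK.
move=> ->; have := cauchy_schwarz lf lg.
have := le_trans (ler_norm _) (Re_le_normc (inner mu f g)).
have -> : Re ((- 1)^* * inner mu f g) = - Re (inner mu f g).
  by rewrite conjcN rmorph1 mulN1r ReN.
rewrite (_ : normc (- 1) = 1); last by rewrite normcN normc1.
by rewrite sqrrD expr1n; lra.
Qed.

Lemma L2norm_sub_le f g : L2 mu f -> L2 mu g ->
  L2norm mu f <= L2norm mu (fun x => f x - g x) + L2norm mu g.
Proof.
move=> lf lg; have := L2norm_triangle (L2_sub lf lg) lg.
by under eq_fun do rewrite subrK.
Qed.

Lemma L2norm_subC f g :
  L2norm mu (fun x => f x - g x) = L2norm mu (fun x => g x - f x).
Proof.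
congr Num.sqrt; apply: eq_Rintegral => x _.
by rewrite -opprB normcN.
Qed.

Lemma L2norm_dist f g : L2 mu f -> L2 mu g ->
  `|L2norm mu f - L2norm mu g| <= L2norm mu (fun x => f x - g x).
Proof.
move=> lf lg; have := L2norm_sub_le lf lg; have := L2norm_sub_le lg lf.
by rewrite (L2norm_subC g f) ler_norml => ? ?; apply/andP; split; lra.
Qed.

Lemma ae_eq_Rintegral (f g : T -> R) : measurable_fun setT f ->
  measurable_fun setT g -> (\forall x \ae mu, f x = g x) ->
  \int[mu]_x f x = \int[mu]_x g x.
Proof.
move=> mf mg fg; rewrite /Rintegral; congr fine.
apply: ae_eq_integral => //; [exact/measurable_EFinP|exact/measurable_EFinP|].
by apply: filterS fg => x -> _.
Qed.

Lemma ae_eq_inner f f' g g' : L2 mu f -> L2 mu f' -> L2 mu g -> L2 mu g' ->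
  (\forall x \ae mu, f x = f' x) -> (\forall x \ae mu, g x = g' x) ->
  inner mu f g = inner mu f' g'.
Proof.
move=> [mf _] [mf' _] [mg _] [mg' _] ff' gg'.
have [m1 m2] := measurable_complexM mf (measurable_complexJ mg).
have [m3 m4] := measurable_complexM mf' (measurable_complexJ mg').
rewrite /inner /cintegral; congr (_ +i* _); apply: ae_eq_Rintegral => //;
  by apply: filterS2 ff' gg' => x -> ->.
Qed.

Lemma L2norm_eq0 f : L2 mu f -> L2norm mu f = 0 -> \forall x \ae mu, f x = 0.
Proof.
move=> [mf lf] f0; have : L2norm mu f ^+ 2 = 0 by rewrite f0 expr0n.
rewrite L2norm_sqr /Rintegral => n0; have := congr1 (@EFin R) n0.
rewrite fineK; last exact: integrable_fin_num.
have -> : (\int[mu]_x (normc (f x) ^+ 2)%:E = \int[mu]_x `|(normc (f x) ^+ 2)%:E|)%E.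
  by apply: eq_integral => x _; rewrite gee0_abs// lee_fin sqr_ge0.
have mn : measurable_fun setT (EFin \o (fun x => normc (f x) ^+ 2)).
  by apply/measurable_EFinP; exact: measurable_normc_sqr.
move=> e0; have := (ae_eq_integral_abs mu measurableT mn).1 e0.
apply: filterS => x /(_ I) /= [].
by move=> /eqP; rewrite expf_eq0/= => /eqP/eq0_normc.
Qed.

End L2Theory.

(** * Determinants of finite-rank perturbations of the identity *)

Section Sylvester.
Variable F : fieldType.

(** Both determinants are that of [block_mx 1 A B 1], eliminated from either
    corner. *)
Lemma sylvester_det n m (A : 'M[F]_(n, m)) (B : 'M[F]_(m, n)) :
  \det (1%:M - A *m B) = \det (1%:M - B *m A).
Proof.
have E1 : block_mx 1%:M A B 1%:M =
    block_mx 1%:M A 0 1%:M *m block_mx (1%:M - A *m B) 0 B 1%:M.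
  by rewrite mulmx_block !(mul1mx, mulmx1, mul0mx, mulmx0, add0r, addr0) subrK.
have E2 : block_mx 1%:M A B 1%:M =
    block_mx 1%:M 0 B 1%:M *m block_mx 1%:M A 0 (1%:M - B *m A).
  rewrite mulmx_block !(mul1mx, mulmx1, mul0mx, mulmx0, add0r, addr0).
  by rewrite [B *m A + _]addrC subrK.
have := congr1 determinant E1; rewrite E2 !det_mulmx !det_ublock !det_lblock.
by rewrite !det1 !mul1r !mulr1.
Qed.

(** A rank factorization [Y = A B] of a square-zero matrix satisfies [B A = 0],
    so that Sylvester's identity applies. *)
Lemma det_add1_sqr0 n (Y : 'M[F]_n) : Y *m Y = 0 -> \det (1%:M + Y) = 1.
Proof.
move=> YY; have YE := mulmx_base Y.
have BA0 : row_base Y *m col_base Y = 0.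
  apply: (row_free_inj (row_base_free Y)).
  rewrite mul0mx; apply: (row_full_inj (col_base_full Y)).
  by rewrite mulmx0 mulmxA [col_base Y *m (_ *m _)]mulmxA YE -mulmxA YE.
have -> : 1%:M + Y = 1%:M - (- col_base Y) *m row_base Y.
  by rewrite mulNmx opprK YE.
by rewrite sylvester_det mulmxN BA0 oppr0 subr0 det1.
Qed.

End Sylvester.

Section FiniteRankDeterminant.
Local Open Scope ring_scope.
Context d (T : measurableType d) (R : realType).
Variable mu : {measure set T -> \bar R}.
Implicit Type f : T -> R[i].

Definition in_span n (e : 'I_n -> T -> R[i]) f :=
  exists c : 'I_n -> R[i], \forall x \ae mu, f x = \sum_(i < n) c i * e i x.

(** Produces the finite-dimensional subspace on which the determinant is computed,
    by discarding the functions that depend linearly on the others. *)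
Lemma free_spanning_family m (w : 'I_m -> T -> R[i]) :
  (forall k, L2 mu (w k)) ->
  exists n (e : 'I_n -> T -> R[i]),
    [/\ forall i, L2 mu (e i), L2_free mu e & forall k, in_span e (w k)].
Proof.
elim: m w => [|m IHm] w lw.
  exists 0%N, (fun _ _ => 0); split; first by move=> [].
    by move=> c _ [].
  by move=> [].
have [n [e [le fe se]]] := IHm (fun k => w (lift ord0 k)) (fun k => lw _).
have [w0|w0] := pselect (in_span e (w ord0)).
  exists n, e; split=> // k.
  by case: (unliftP ord0 k) => [j ->|->].
pose e' (i : 'I_n.+1) := if unlift ord0 i is Some j then e j else w ord0.
have e'0 : e' ord0 = w ord0 by rewrite /e' unlift_none.
have e'l j : e' (lift ord0 j) = e j by rewrite /e' liftK.
have E' c x : \sum_(i < n.+1) c i * e' i x =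
    c ord0 * w ord0 x + \sum_(i < n) c (lift ord0 i) * e i x.
  by rewrite big_ord_recl e'0; under eq_bigr do rewrite e'l.
exists n.+1, e'; split.
- by move=> i; case: (unliftP ord0 i) => [j|] ->; rewrite ?e'l ?e'0.
- move=> c c0; have c00 : c ord0 = 0.
    apply/eqP/negPn/negP => cn0; apply: w0.
    exists (fun i => - (c ord0)^-1 * c (lift ord0 i)).
    apply: filterS c0 => x; rewrite E' => /eqP; rewrite addr_eq0 => /eqP H.
    rewrite -[LHS]mul1r -(mulVf cn0) -mulrA H mulrN mulr_sumr -sumrN.
    by apply: eq_bigr => i _; rewrite !mulNr mulrA.
  have fr : forall i, c (lift ord0 i) = 0.
    apply: fe; apply: filterS c0 => x.
    by rewrite E' c00 mul0r add0r.
  by move=> i; case: (unliftP ord0 i) => [j|] ->.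
- move=> k; case: (unliftP ord0 k) => [j|] ->.
    have [c cE] := se j.
    exists (fun i => if unlift ord0 i is Some j then c j else 0).
    apply: filterS cE => x ->; rewrite E' unlift_none mul0r add0r.
    by apply: eq_bigr => i _; rewrite liftK.
  exists (fun i => if unlift ord0 i is Some j then 0 else 1).
  apply: nearW => x; rewrite E' unlift_none mul1r big1 ?addr0// => i _.
  by rewrite liftK mul0r.
Qed.

Definition gram n (e : 'I_n -> T -> R[i]) : 'M[R[i]]_n :=
  \matrix_(i, j) inner mu (e i) (e j).

(** A vector in the kernel gives a combination orthogonal to every [e j], hence of
    norm zero. *)
Lemma gram_unit n (e : 'I_n -> T -> R[i]) :
  (forall i, L2 mu (e i)) -> L2_free mu e -> gram e \in unitmx.
Proof.
move=> le fe; rewrite unitmxE unitfE; apply/negP => /det0P[v v0 vG].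
have lf := L2_sum (fun i => v ord0 i) le.
have fj j : inner mu (fun x => \sum_i v ord0 i * e i x) (e j) = 0.
  rewrite inner_sum//; have := congr1 (fun A : 'rV_n => A ord0 j) vG.
  rewrite !mxE => v0j; rewrite -[RHS]v0j.
  by apply: eq_bigr => i _; rewrite !mxE.
have n0 : L2norm mu (fun x => \sum_i v ord0 i * e i x) = 0.
  apply/eqP; rewrite -sqrf_eq0; apply/eqP/complexI; rewrite -inner_self.
  by rewrite inner_sumr// big1// => i _; rewrite fj mulr0.
have := fe _ (L2norm_eq0 lf n0) => vi.
by case/eqP: v0; apply/rowP => i; rewrite vi mxE.
Qed.

Variables (m : nat) (u w : 'I_m -> T -> R[i]) (K : (T -> R[i]) -> T -> R[i]).
Hypothesis lu : forall k, L2 mu (u k).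
Hypothesis lw : forall k, L2 mu (w k).
Hypothesis KE : forall f, L2 mu f ->
  \forall x \ae mu, K f x = f x - \sum_k inner mu f (u k) * w k x.

(** The range of [K - 1] lies in the span of [e], but when [u] is linearly
    dependent the [w k] themselves need not. The components [v k] of the [w k]
    orthogonal to [e] satisfy [\sum_k <f, u k> v k = 0], so their matrix [Y]
    against [u] squares to zero and does not contribute to the determinant. *)
Lemma is_determinant_finite_rank z : is_determinant mu K z ->
  z = \det (1%:M - \matrix_(k, j) inner mu (w k) (u j)).
Proof.
move=> [n [e [M [[le fe] rangeK Ke ->]]]].
pose G := gram e; have uG : G \in unitmx := gram_unit le fe.
pose A : 'M[R[i]]_(n, m) := \matrix_(j, k) inner mu (e j) (u k).
pose B : 'M[R[i]]_(m, n) := \matrix_(k, l) inner mu (w k) (e l).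
pose X : 'M[R[i]]_m := \matrix_(k, j) inner mu (w k) (u j).
pose P := B *m invmx G.
pose v k x := w k x - \sum_i P k i * e i x.
have lP k : L2 mu (fun x => \sum_i P k i * e i x) by exact: L2_sum.
have lv k : L2 mu (v k) by exact: L2_sub.
have ve k j : inner mu (v k) (e j) = 0.
  rewrite /v inner_sub// inner_sum//.
  have := congr1 (fun C : 'M[R[i]]_(m, n) => C k j) (mulmxKV uG B).
  rewrite !mxE => <-; apply/eqP; rewrite subr_eq0; apply/eqP.
  by apply: eq_bigr => i _; rewrite /G !mxE.
pose Y : 'M[R[i]]_m := \matrix_(k, j) inner mu (v k) (u j).
have YE : Y = X - P *m A.
  apply/matrixP => k j; rewrite !mxE /v inner_sub// inner_sum//; congr (_ - _).
  by apply: eq_bigr => i _; rewrite !mxE.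
have fv f : L2 mu f -> forall j, \sum_k inner mu f (u k) * Y k j = 0.
  move=> lf j.
  have lg : L2 mu (fun x => \sum_k inner mu f (u k) * v k x) by exact: L2_sum.
  have ge i : inner mu (fun x => \sum_k inner mu f (u k) * v k x) (e i) = 0.
    by rewrite inner_sum// big1// => k _; rewrite ve mulr0.
  have [c cE] := rangeK _ lf.
  pose c' i := - c i - \sum_k inner mu f (u k) * P k i.
  have gE : \forall x \ae mu, \sum_k inner mu f (u k) * v k x =
      \sum_i c' i * e i x.
    apply: filterS2 cE (KE lf) => x cx Kx.
    have sw : \sum_k inner mu f (u k) * w k x = - \sum_i c i * e i x.
      by rewrite -cx Kx !opprB addrCA subrr addr0.
    under eq_bigr do rewrite /v mulrBr mulr_sumr.
    rewrite sumrB sw exchange_big -sumrN -sumrB; apply: eq_bigr => i _.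
    rewrite /c' mulrBl mulNr mulr_suml; congr (_ - _).
    by apply: eq_bigr => k _; rewrite mulrA.
  have n0 : L2norm mu (fun x => \sum_k inner mu f (u k) * v k x) = 0.
    apply/eqP; rewrite -sqrf_eq0; apply/eqP/complexI; rewrite -inner_self.
    rewrite (ae_eq_inner lg lg lg (L2_sum c' le) _ gE); last exact: nearW.
    by rewrite inner_sumr// big1// => i _; rewrite ge mulr0.
  transitivity (inner mu (fun x => \sum_k inner mu f (u k) * v k x) (u j)).
    by rewrite inner_sum//; apply: eq_bigr => k _; rewrite mxE.
  apply/eq0_normc/le_anti; rewrite normc_ge0 andbT.
  by rewrite (le_trans (cauchy_schwarz lg (lu j)))// n0 mul0r.
have XY : X *m Y = 0.
  apply/matrixP => k j; rewrite [LHS]mxE [RHS]mxE -[RHS](fv _ (lw k) j).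
  by apply: eq_bigr => i _; rewrite mxE.
have YY : Y *m Y = 0.
  apply/matrixP => k j; rewrite [LHS]mxE [RHS]mxE -[RHS](fv _ (lv k) j).
  by apply: eq_bigr => i _; rewrite [Y k i]mxE.
have ME : M^T = 1%:M - A *m P.
  apply: (can_inj (mulmxK uG)).
  rewrite mulmxBl mul1mx /P mulmxA mulmxKV//.
  apply/matrixP => j l; rewrite !mxE.
  have lKe : L2 mu (fun x => \sum_i M i j * e i x) by exact: L2_sum.
  have lKe' : L2 mu (fun x => e j x - \sum_k inner mu (e j) (u k) * w k x).
    by apply: L2_sub => //; exact: L2_sum.
  transitivity (inner mu (fun x => \sum_i M i j * e i x) (e l)).
    by rewrite inner_sum//; apply: eq_bigr => i _; rewrite !mxE.
  rewrite (ae_eq_inner lKe lKe' (le l) (le l)); last 2 first.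
  - by apply: filterS2 (Ke j) (KE (le j)) => x -> ->.
  - exact: nearW.
  rewrite inner_sub//; last exact: L2_sum.
  rewrite inner_sum//; congr (_ - _).
  by apply: eq_bigr => k _; rewrite !mxE.
rewrite -det_tr ME sylvester_det -[X in 1%:M - X]/(P *m A).
have -> : 1%:M - P *m A = (1%:M - X) *m (1%:M + Y).
  rewrite mulmxDr mulmx1 mulmxBl mul1mx XY subr0 YE addrA; congr (_ - _).
  by rewrite subrK.
by rewrite det_mulmx (det_add1_sqr0 YY) mulr1.
Qed.

Lemma exists_determinant_finite_rank : exists z, is_determinant mu K z.
Proof.
have [n [e [le fe se]]] := free_spanning_family lw.
have [W WE] := choice se.
pose M : 'M[R[i]]_n :=
  \matrix_(i, j) ((i == j)%:R - \sum_k inner mu (e j) (u k) * W k i).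
have sumW f x : (forall k, w k x = \sum_i W k i * e i x) ->
    \sum_k inner mu f (u k) * w k x =
    \sum_i (\sum_k inner mu f (u k) * W k i) * e i x.
  move=> wx; under eq_bigr do rewrite wx mulr_sumr.
  rewrite exchange_big; apply: eq_bigr => i _; rewrite mulr_suml.
  by apply: eq_bigr => k _; rewrite mulrA.
have wall : \forall x \ae mu, forall k, w k x = \sum_i W k i * e i x.
  exact: filter_forall.
exists (\det M), n, e, M; split=> //.
- move=> f lf; exists (fun i => - \sum_k inner mu f (u k) * W k i).
  apply: filterS2 wall (KE lf) => x wx ->.
  rewrite sumW// addrAC subrr sub0r -sumrN.
  by apply: eq_bigr => i _; rewrite mulNr.
- move=> j; apply: filterS2 wall (KE (le j)) => x wx ->.
  rewrite sumW//; under [RHS]eq_bigr do rewrite mxE mulrBl.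
  rewrite sumrB; congr (_ - _).
  rewrite (bigD1 j)//= eqxx mul1r big1 ?addr0// => i /negbTE ->.
  by rewrite mul0r.
Qed.

(** [determinant] picks some value of the determinant: one exists, and all of them
    agree with the right-hand side, whichever subspace they are computed on. *)
Lemma determinant_finite_rank : Defs.determinant mu K =
  \det (1%:M - \matrix_(k, j) inner mu (w k) (u j)).
Proof.
have [z dz] := exists_determinant_finite_rank.
apply: is_determinant_finite_rank.
by apply: (xgetPex 0); exists z.
Qed.

End FiniteRankDeterminant.

(** * The determinant of the scattering matrix *)

(** [C - i D] is the adjoint of [C + i D]. *)
Lemma det_hermitian_conj (R : realType) n (C D : 'M[R[i]]_n) :
  (forall j k, C j k = (C k j)^*%R) -> (forall j k, D j k = (D k j)^*%R) ->
  \det (C - 'i%C *: D) = ((\det (C + 'i%C *: D))^*)%R.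
Proof.
move=> hC hD; rewrite -det_tr -det_map_mx; congr (\det _); apply/matrixP => j k.
rewrite !mxE [C k j]hC [D k j]hD rmorphD rmorphM /=; congr (_ + _).
by apply: complex_ext; rewrite !ReImE /=; ring.
Qed.

Section ScatteringDeterminant.
Local Open Scope ring_scope.
Variable R : realType.
Local Notation fn := (space3 R -> R[i]).
Local Notation sph := (sphere_measure R).
Variables (u : 'I_2 -> R -> fn) (alpha lam : R).
Hypothesis lam_ge0 : 0 <= lam.
Hypothesis lu : forall j, L2 sph (u j lam).
Hypothesis C_hermitian : forall j k,
  C_matrix u alpha lam j k = (C_matrix u alpha lam k j)^*.

Lemma spectral_densityE v w : 0 <= lam ->
  spectral_density v w lam = inner sph (v lam) (w lam).
Proof. by rewrite /spectral_density => ->. Qed.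

Lemma D_hermitian j k : D_matrix u alpha lam j k = (D_matrix u alpha lam k j)^*.
Proof.
rewrite !mxE !spectral_densityE// conjcM -innerJ//; congr (_ * _).
by apply: complex_ext; rewrite !ReImE /= ?oppr0.
Qed.

Lemma det_B_adjoint : \det (C_matrix u alpha lam - 'i%C *: D_matrix u alpha lam) =
  (detB u alpha lam)^*.
Proof. exact: det_hermitian_conj C_hermitian D_hermitian. Qed.

Lemma stationary_smatrixE (f : fn) x : stationary_smatrix u alpha lam f x =
  f x - \sum_j inner sph f (u j lam) * \sum_k
   ((2 * pi * alpha)%:C * 'i%C / detB u alpha lam *
     cofactor (B_matrix u alpha lam) j k) * u k lam x.
Proof.
rewrite /stationary_smatrix; congr (_ - _); rewrite mulr_sumr.
apply: eq_bigr => j _; rewrite !mulr_sumr; apply: eq_bigr => k _; ring.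
Qed.

(** Up to transposition, the operator is represented by
    [1 - (2 i / F) D \adj B], and [F] times this is [(B - 2 i D) \adj B]. *)
Lemma determinant_smatrix (K : fn -> fn) : detB u alpha lam != 0 ->
  (forall f, L2 sph f -> \forall x \ae sph,
    K f x = stationary_smatrix u alpha lam f x) ->
  Defs.determinant sph K = (detB u alpha lam)^* / detB u alpha lam.
Proof.
move=> F0 KE; set F := detB _ _ _ in F0 *.
set B := B_matrix u alpha lam; set D := D_matrix u alpha lam.
pose w j x := \sum_k
   ((2 * pi * alpha)%:C * 'i%C / F * cofactor B j k) * u k lam x.
rewrite (@determinant_finite_rank _ _ _ sph 2 (u ^~ lam) w)//; first last.
- by move=> f /KE; apply: filterS => x ->; rewrite stationary_smatrixE.
- by move=> j; exact: L2_sum.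
have -> : \matrix_(k, j) inner sph (w k) (u j lam) =
    (2 * 'i%C / F) *: (D *m \adj B)^T.
  apply/matrixP => j m; rewrite !mxE inner_sum// mulr_sumr.
  apply: eq_bigr => k _; rewrite !mxE spectral_densityE// -/B.
  by rewrite !rmorphM /= rmorph_nat; ring.
have E : F *: (1%:M - (2 * 'i%C / F) *: (D *m \adj B)) =
    (C_matrix u alpha lam - 'i%C *: D) *m \adj B.
  rewrite scalerBr scalerA scalemx1 -[F%:M]mul_mx_adj -/B scalemxAl -mulmxBl.
  congr (_ *m _); rewrite /B /B_matrix -/D -addrA; congr (_ + _).
  have -> : F * (2 * 'i%C / F) = 2 * 'i%C by field.
  by rewrite -scalerBl -scaleNr; congr (_ *: _); ring.
have adjF : \det (\adj B) = F.
  apply: (mulfI F0); rewrite -[X in X * _ = _]/(\det B) -det_mulmx mul_mx_adj.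
  by rewrite det_scalar.
have H : F ^+ 2 * \det (1%:M - (2 * 'i%C / F) *: (D *m \adj B)) = F^* * F.
  by rewrite -detZ E det_mulmx; congr (_ * _); [exact: det_B_adjoint|exact: adjF].
rewrite -det_tr linearB /= linearZ /= trmxK trmx1.
by apply: (mulfI (expf_neq0 2 F0)); rewrite H expr2; field.
Qed.

End ScatteringDeterminant.

(** * Derivatives of real functions and of arguments *)

Section RealDerivatives.
Local Open Scope ring_scope.
Variable R : realType.
Implicit Types (f g : R -> R) (x a b c : R).

Lemma derivable_is_derive1 f x : derivable f x 1 -> is_derive x 1 f (derive1 f x).
Proof. by move=> df; rewrite derive1E; exact: derivableP. Qed.

Lemma is_derive1_unique f x a b : is_derive x 1 f a -> is_derive x 1 f b -> a = b.
Proof. by move=> [_ <-] [_ <-]. Qed.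

Lemma is_derive1_derivable f x a : is_derive x 1 f a -> derivable f x 1.
Proof. by case. Qed.

Lemma is_derive1E f x a : is_derive x 1 f a -> derive1 f x = a.
Proof. by move=> [_ <-]; rewrite derive1E. Qed.

Lemma is_derive1_cst c x : is_derive x 1 (fun=> c : R) (0 : R).
Proof. exact: is_derive_cst. Qed.

Lemma is_derive1_add f g x a b : is_derive x 1 f a -> is_derive x 1 g b ->
  is_derive x 1 (fun y => f y + g y) (a + b).
Proof. exact: is_deriveD. Qed.

Lemma is_derive1_sub f g x a b : is_derive x 1 f a -> is_derive x 1 g b ->
  is_derive x 1 (fun y => f y - g y) (a - b).
Proof. exact: is_deriveB. Qed.

Lemma is_derive1_mul f g x a b : is_derive x 1 f a -> is_derive x 1 g b ->
  is_derive x 1 (fun y => f y * g y) (a * g x + f x * b).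
Proof.
move=> df dg; have H := is_deriveM df dg; apply: (is_derive_eq H).
by rewrite -![_ *: _]/(_ * _) addrC mulrC.
Qed.

Lemma is_derive1_scale c f x a : is_derive x 1 f a ->
  is_derive x 1 (fun y => c * f y) (c * a).
Proof.
move=> df; have H := is_derive1_mul (is_derive1_cst c x) df.
apply: (is_derive_eq H); by rewrite mul0r add0r.
Qed.

Lemma is_derive1_div f g x a b : g x != 0 ->
  is_derive x 1 f a -> is_derive x 1 g b ->
  is_derive x 1 (fun y => f y / g y) ((a * g x - f x * b) / g x ^+ 2).
Proof.
move=> gx df dg; have H := is_derive1_mul df (is_deriveV gx dg).
apply: (is_derive_eq H).
by rewrite -![_ *: _]/(_ * _); field.
Qed.

Lemma is_derive1_ext f g x a : f =1 g -> is_derive x 1 f a -> is_derive x 1 g a.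
Proof. by move=> /funext ->. Qed.

Lemma is_derive1_cont f x a : is_derive x 1 f a -> {for x, continuous f}.
Proof. by move=> [/derivable1_diffP/differentiable_continuous]. Qed.

End RealDerivatives.

Section ArgumentDerivative.
Local Open Scope ring_scope.
Variable R : realType.
Implicit Types (x y t : R) (g : R -> R[i]).

Lemma unit_circle_angle x y : x ^+ 2 + y ^+ 2 = 1 ->
  exists t, x = cos t /\ y = sin t.
Proof.
move=> xy; have x1 : -1 <= x <= 1 by have y20 := sqr_ge0 y; apply/andP; split; nra.
have y2 : Num.sqrt (1 - x ^+ 2) = `|y| by rewrite -sqrtr_sqr; congr Num.sqrt; lra.
have [y0|y0] := leP 0 y.
  exists (acos x); rewrite acosK ?in_itv//; split=> //.
  by rewrite sin_acos// y2 ger0_norm.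
exists (- acos x); rewrite cosN sinN acosK ?in_itv//; split=> //.
by rewrite sin_acos// y2 ltr0_norm// opprK.
Qed.

Lemma cos_sqr_atan t : cos (atan t) ^+ 2 = (1 + t ^+ 2)^-1.
Proof.
by rewrite cos_atan exprVn sqr_sqrtr// addr_ge0// sqr_ge0.
Qed.

Lemma sin_atan_tan t : sin (atan t) = t * cos (atan t).
Proof.
have t1 : 0 < 1 + t ^+ 2 by have := sqr_ge0 t; lra.
have c0 : cos (atan t) != 0 by rewrite cos_atan invr_eq0 gt_eqF// sqrtr_gt0.
by have := atanK t; rewrite /tan => {2}<-; rewrite divfK.
Qed.

Lemma cos_double_atan t : cos (2 * atan t) = (1 - t ^+ 2) / (1 + t ^+ 2).
Proof.
rewrite mulr_natl mulr2n cosD sin_atan_tan mulrACA -!expr2 cos_sqr_atan; ring.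
Qed.

Lemma sin_double_atan t : sin (2 * atan t) = (2 * t) / (1 + t ^+ 2).
Proof.
rewrite mulr_natl mulr2n sinD sin_atan_tan -(cos_sqr_atan t); ring.
Qed.

(** For two branches, [sin (theta1 - theta2)] vanishes near the point, and its
    derivative there is the difference of the two derivatives. *)
Lemma is_arg_derivative_unique g x z1 z2 :
  is_arg_derivative g x z1 -> is_arg_derivative g x z2 -> z1 = z2.
Proof.
move=> [t1 [g0 d1 e1 <-]] [t2 [_ d2 e2 <-]].
have e : \forall m \near x, cos (t1 m) = cos (t2 m) /\ sin (t1 m) = sin (t2 m).
  near=> m; have gm : g m != 0 by near: m.
  have n0 : normc (g m) != 0 by apply: contra gm => /eqP/eq0_normc ->.
  have : (normc (g m))%:C * (cos (t1 m) +i* sin (t1 m)) =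
         (normc (g m))%:C * (cos (t2 m) +i* sin (t2 m)).
    rewrite -(near e1 m)//  -(near e2 m)//.
  have c0 : (normc (g m))%:C != 0 by rewrite eq_complex /= negb_and n0.
  by move=> /(mulfI c0) [-> ->].
have dt := is_derive1_sub (derivable_is_derive1 (nbhs_singleton d1))
  (derivable_is_derive1 (nbhs_singleton d2)).
have ds := @is_derive1_comp _ sin (fun y => t1 y - t2 y) x _ _ (is_derive_sin _) dt.
have d0 : is_derive x 1 (sin \o (fun y => t1 y - t2 y)) (0 : R).
  have [D0 E0] := is_derive1_cst 0 x.
  have E : \forall m \near x, 0 = (sin \o (fun y => t1 y - t2 y)) m.
    apply: filterS e => m [ce se] /=; rewrite sinB ce se; ring.
  by split; [exact: near_eq_derivable D0|rewrite -(near_eq_derive _ E)].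
have := is_derive1_unique ds d0.
have [ce se] := nbhs_singleton e.
rewrite cosB ce se -!expr2 cos2Dsin2 mul1r => /eqP.
by rewrite subr_eq0 => /eqP.
Unshelve. all: by end_near. Qed.

Variables (f1 f2 : R -> R) (x : R) (a b : R).
Hypothesis df1 : \forall m \near x, derivable f1 m 1.
Hypothesis df2 : \forall m \near x, derivable f2 m 1.
Hypothesis f1x : is_derive x 1 f1 a.
Hypothesis f2x : is_derive x 1 f2 b.
Hypothesis f0 : f1 x ^+ 2 + f2 x ^+ 2 != 0.

(** With [F = f1 + i f2], rotating by [conj (F x)] moves [F] into the right
    half-plane near [x], where [atan] of the slope is a branch of the argument. *)
Lemma arg_derivative_conj_div g :
  (\forall m \near x, g m = (f1 m +i* f2 m)^* / (f1 m +i* f2 m)) ->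
  is_arg_derivative g x (- 2 * (f1 x * b - f2 x * a) / (f1 x ^+ 2 + f2 x ^+ 2)).
Proof.
move=> gE; set p := f1 x; set q := f2 x.
have r0 : 0 < p ^+ 2 + q ^+ 2 by rewrite lt0r f0 addr_ge0 ?sqr_ge0.
pose A (m : R) := f1 m * p + f2 m * q.
pose B (m : R) := f2 m * p - f1 m * q.
have dA (m : R) d1 d2 : is_derive m 1 f1 d1 -> is_derive m 1 f2 d2 ->
    is_derive m 1 A (d1 * p + d2 * q).
  move=> h1 h2; have := is_derive1_add (is_derive1_scale p h1) (is_derive1_scale q h2).
  rewrite ![_ * d1]mulrC ![_ * d2]mulrC; apply: is_derive1_ext => y.
  by rewrite /A mulrC [q * _]mulrC.
have dB (m : R) d1 d2 : is_derive m 1 f1 d1 -> is_derive m 1 f2 d2 ->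
    is_derive m 1 B (d2 * p - d1 * q).
  move=> h1 h2; have := is_derive1_sub (is_derive1_scale p h2) (is_derive1_scale q h1).
  rewrite ![_ * d1]mulrC ![_ * d2]mulrC; apply: is_derive1_ext => y.
  by rewrite /B mulrC [q * _]mulrC.
have Ax : A x = p ^+ 2 + q ^+ 2 by [].
have Bx : B x = 0 by rewrite /B -/p -/q mulrC subrr.
have A0 : \forall m \near x, 0 < A m.
  have cA := is_derive1_cont (dA _ _ _ f1x f2x).
  by apply: (@cvgr_gt _ _ _ _ A (A x) cA); rewrite Ax.
have [t0 [c0 s0]] : exists t, (p ^+ 2 - q ^+ 2) / (p ^+ 2 + q ^+ 2) = cos t /\
   - (2 * p * q) / (p ^+ 2 + q ^+ 2) = sin t.
  by apply: unit_circle_angle; field; exact: lt0r_neq0.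
pose theta (m : R) := t0 - 2 * atan (B m / A m).
have dtheta (m : R) d1 d2 : A m != 0 -> is_derive m 1 f1 d1 -> is_derive m 1 f2 d2 ->
    is_derive m 1 theta (0 - 2 * ((1 + (B m / A m) ^+ 2)^-1 *
      (((d2 * p - d1 * q) * A m - B m * (d1 * p + d2 * q)) / A m ^+ 2))).
  move=> Am h1 h2.
  apply: (@is_derive1_sub _ (fun=> t0) (fun y => 2 * atan (B y / A y))).
  apply: (@is_derive1_scale _ 2 (fun y => atan (B y / A y))).
  apply: (@is_derive1_comp _ atan (fun y => B y / A y)).
  exact: is_derive1_div.
exists theta; split.
- near=> m.
  have Am : 0 < A m by near: m.
  have Fm : f1 m +i* f2 m != 0.
    apply/negP => /eqP [h1 h2]; move: Am.
    by rewrite /A h1 h2 !mul0r addr0 ltxx.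
  rewrite (near gE m)// mulf_neq0 ?invr_eq0//.
  by rewrite conjC_eq0.
- apply: filterS3 A0 df1 df2 => m Am h1 h2.
  exact: is_derive1_derivable (dtheta _ _ _ (lt0r_neq0 Am)
    (derivable_is_derive1 h1) (derivable_is_derive1 h2)).
- near=> m.
  have Am : 0 < A m by near: m.
  have Fm : f1 m +i* f2 m != 0.
    apply/negP => /eqP [h1 h2]; move: Am.
    by rewrite /A h1 h2 !mul0r addr0 ltxx.
  have nF : normc (f1 m +i* f2 m) != 0 by apply: contra Fm => /eqP/eq0_normc ->.
  rewrite (near gE m)// normcM normcV normcJ' mulfV// mul1r.
  apply: (mulIf Fm); rewrite divfK//.
  rewrite /theta cosB sinB -c0 -s0 cos_double_atan sin_double_atan.
  have AB : 0 < A m ^+ 2 + B m ^+ 2 by rewrite ltr_wpDr ?sqr_ge0// exprn_gt0.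
  have E1 : (1 - (B m / A m) ^+ 2) / (1 + (B m / A m) ^+ 2) =
      (A m ^+ 2 - B m ^+ 2) / (A m ^+ 2 + B m ^+ 2).
    by field; rewrite !lt0r_neq0.
  have E2 : 2 * (B m / A m) / (1 + (B m / A m) ^+ 2) =
      2 * A m * B m / (A m ^+ 2 + B m ^+ 2).
    by field; rewrite !lt0r_neq0.
  rewrite E1 E2; have AB0 := lt0r_neq0 AB; have r00 := lt0r_neq0 r0.
  rewrite /A /B in AB0 *.
  by apply: complex_ext; rewrite !ReImE /=; field; rewrite AB0 r00.
- rewrite (is_derive1E (dtheta _ _ _ _ f1x f2x)) ?Ax ?lt0r_neq0//.
  by rewrite Bx -/p -/q; field; exact: lt0r_neq0.
Unshelve. all: by end_near. Qed.

End ArgumentDerivative.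

(** * Asymptotics of the phase near a double zero of the determinant *)

Section LimitTools.
Local Open Scope ring_scope.
Variable R : realType.

Lemma eq_cvgl (F : set_system R) (FF : Filter F) (f g : R -> R) (l : R) :
  (\forall x \near F, f x = g x) -> g x @[x --> F] --> l -> f x @[x --> F] --> l.
Proof.
move=> fg gl; apply: cvg_trans gl; apply: near_eq_cvg.
by apply: filterS fg => x ->.
Qed.

(** Caratheodory's form of differentiability, which composes without dividing
    by an increment that may vanish. *)
Lemma is_derive_slope (g : R -> R) (x0 a : R) : is_derive x0 1 g a ->
  exists2 q : R -> R, q x @[x --> x0] --> a & forall x, g x - g x0 = q x * (x - x0).
Proof.
move=> dg; exists (fun x => if x == x0 then a else (g x - g x0) / (x - x0)).
  apply/cvgrPdist_lt => e e0.
  have [D E] := dg; have : (fun h => h^-1 *: (g (h *: 1 + x0) - g x0)) @ 0^' --> a.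
    by rewrite -E; exact: D.
  move=> /cvgrPdist_lt /(_ _ e0).
  rewrite /at_right /dnbhs /within /= !near_simpl => /nbhs_ballP [r /= r0 H].
  apply/nbhs_ballP; exists r => //= x xr; case: eqVneq => [_|xx0].
    by rewrite subrr normr0.
  have := H (x - x0); rewrite /ball /= sub0r normrN distrC => /(_ _ _).
  rewrite subr_eq0 xx0 -[_%:A]/((x - x0) * 1) mulr1 subrK -[_ *: _]/(_ * _) mulrC.
  by apply => //; move: xr; rewrite /ball /= distrC.
move=> x; case: eqVneq => [->|xx0]; first by rewrite !subrr mulr0.
by rewrite divfK// subr_eq0.
Qed.

Lemma MVT_unordered (f df : R -> R) (a b : R) :
  (forall x, `|x - a| <= `|b - a| -> is_derive x 1 f (df x)) ->
  exists2 c, `|c - a| <= `|b - a| & f b - f a = df c * (b - a).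
Proof.
move=> H; have [ab|ba] := leP a b.
  have h x : x \in `[a, b] -> `|x - a| <= `|b - a|.
    by rewrite in_itv /= => /andP[? ?]; rewrite !ger0_norm ?subr_ge0// lerB.
  have [|||c cab E] := @MVT_segment _ f df a b => //.
  - by move=> x /subset_itv_oo_cc /h /H.
  - apply: derivable_within_continuous => x /h /H [].
    by [].
  - by exists c => //; exact: h.
have h x : x \in `[b, a] -> `|x - a| <= `|b - a|.
  rewrite in_itv /= => /andP[? ?]; rewrite !ler0_norm ?subr_le0 ?(ltW ba)//.
  by rewrite lerN2 lerB.
have [|||c cab E] := @MVT_segment _ f df b a; first exact: ltW.
- by move=> x /subset_itv_oo_cc /h /H.
- by apply: derivable_within_continuous => x /h /H [].
- by exists c; [exact: h|rewrite -opprB E -mulrN opprB].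
Qed.

End LimitTools.

Section Asymptotics.
Local Open Scope ring_scope.
Variable R : realType.
Variables (al0 la0 : R).
Hypothesis al0_neq0 : al0 != 0.
Local Notation F := (al0^').

Lemma limM (f g : R -> R) (a b : R) : f al @[al --> F] --> a ->
  g al @[al --> F] --> b -> f al * g al @[al --> F] --> a * b.
Proof. exact: cvgM. Qed.

Lemma limD (f g : R -> R) (a b : R) : f al @[al --> F] --> a ->
  g al @[al --> F] --> b -> f al + g al @[al --> F] --> a + b.
Proof. exact: cvgD. Qed.

Lemma limB (f g : R -> R) (a b : R) : f al @[al --> F] --> a ->
  g al @[al --> F] --> b -> f al - g al @[al --> F] --> a - b.
Proof. exact: cvgB. Qed.

Lemma limV (f : R -> R) (a : R) : a != 0 -> f al @[al --> F] --> a ->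
  (f al)^-1 @[al --> F] --> a^-1.
Proof. by move=> a0; exact: cvgV. Qed.

Lemma lim_cst (a : R) : a @[al --> F] --> a.
Proof. exact: cvg_cst. Qed.

(** The derivative is required near [la0] because the mean value theorem is applied
    on intervals near [la0]. *)
Definition C1_at (g dg : R -> R) :=
  (\forall x \near la0, is_derive (x : R) 1 g (dg x)) /\ dg x @[x --> la0] --> dg la0.

(** A limit on the punctured neighbourhood, so that points chosen by the mean value
    theorem, which have no value at [al0], form such a path. *)
Definition slope_path (mu : R -> R) (s : R) :=
  (mu al - la0) / (al - al0) @[al --> F] --> s.

Lemma near_F_neq : \forall al \near F, al - al0 != 0.
Proof.
by near=> al; rewrite subr_eq0; near: al; exact: nbhs_dnbhs_neq.
Unshelve. all: by end_near. Qed.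

Lemma cvg_F_eps : al - al0 @[al --> F] --> (0 : R).
Proof.
rewrite -[X in _ --> X](subrr al0); apply: cvgB; last exact: cvg_cst.
exact: nbhs_dnbhs.
Qed.

Lemma cvg_F_id : al @[al --> F] --> al0.
Proof. exact: nbhs_dnbhs. Qed.

Lemma slope_path_cvg mu s : slope_path mu s -> mu al @[al --> F] --> la0.
Proof.
move=> ms; have : la0 + (mu al - la0) / (al - al0) * (al - al0) @[al --> F] -->
    la0 + s * 0.
  by apply: cvgD; [exact: cvg_cst|apply: cvgM => //; exact: cvg_F_eps].
rewrite mulr0 addr0; apply: eq_cvgl; near=> al.
have e0 : al - al0 != 0 by near: al; exact: near_F_neq.
by rewrite divfK// addrC subrK.
Unshelve. all: by end_near. Qed.

(** An entry that vanishes at [(al0, la0)] is of first order along a path, with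
    its total derivative as coefficient. The entries of [C] and of [D] all have this
    form, with [a] equal to 0 or 1. *)
Lemma affine_entry_lim (a : R) g dg mu s : C1_at g dg -> slope_path mu s ->
  a + al0 * g la0 = 0 ->
  (a + al * g (mu al)) / (al - al0) @[al --> F] --> g la0 + al0 * (dg la0 * s).
Proof.
move=> [dgn _] ms a0; have [q qc qE] := is_derive_slope (nbhs_singleton dgn).
have : g la0 + al * (q (mu al) * ((mu al - la0) / (al - al0))) @[al --> F] -->
    g la0 + al0 * (dg la0 * s).
  apply: cvgD; first exact: cvg_cst.
  apply: cvgM; first exact: cvg_F_id.
  apply: cvgM => //.
  by apply: (cvg_comp _ _ (slope_path_cvg ms)).
apply: eq_cvgl; near=> al.
have e0 : al - al0 != 0 by near: al; exact: near_F_neq.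
have -> : a + al * g (mu al) =
   (a + al0 * g la0) + (al - al0) * g la0 + al * (g (mu al) - g la0) by ring.
by rewrite a0 qE; field.
Unshelve. all: by end_near. Qed.

Lemma affine_entry_deriv_lim g dg mu s : C1_at g dg -> slope_path mu s ->
  al * dg (mu al) @[al --> F] --> al0 * dg la0.
Proof.
move=> [_ dgc] ms; apply: cvgM; first exact: cvg_F_id.
by apply: (cvg_comp _ _ (slope_path_cvg ms)).
Qed.

Variables (g1 g2 gr gi e1 e2 er ei : R -> R).
Variables (dg1 dg2 dgr dgi de1 de2 der dei : R -> R).
Hypothesis (hg1 : C1_at g1 dg1) (hg2 : C1_at g2 dg2).
Hypothesis (hgr : C1_at gr dgr) (hgi : C1_at gi dgi).
Hypothesis (he1 : C1_at e1 de1) (he2 : C1_at e2 de2).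
Hypothesis (her : C1_at er der) (hei : C1_at ei dei).
Hypothesis (g10 : 1 + al0 * g1 la0 = 0) (g20 : 1 + al0 * g2 la0 = 0).
Hypothesis (gr0 : gr la0 = 0) (gi0 : gi la0 = 0).
Hypothesis (e10 : e1 la0 = 0) (e20 : e2 la0 = 0) (er0 : er la0 = 0) (ei0 : ei la0 = 0).
Hypothesis (de10 : de1 la0 = 0) (de20 : de2 la0 = 0).
Hypothesis (der0 : der la0 = 0) (dei0 : dei la0 = 0).

Local Notation c1 al la := (1 + al * g1 la).
Local Notation c2 al la := (1 + al * g2 la).
Local Notation cr al la := (0 + al * gr la).
Local Notation ci al la := (0 + al * gi la).
Local Notation d1 al la := (0 + al * e1 la).
Local Notation d2 al la := (0 + al * e2 la).
Local Notation dr al la := (0 + al * er la).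
Local Notation di al la := (0 + al * ei la).

(** [reF] and [imF] are the components of the determinant of the Hermitian pencil
    [C + i D], and [dreF], [dimF] their derivatives in the second variable. Entries
    with [a = 0] keep the summand [0], to match [affine_entry_lim]. *)
Definition reF (al la : R) := c1 al la * c2 al la
  - (cr al la * cr al la + ci al la * ci al la)
  - (d1 al la * d2 al la - (dr al la * dr al la + di al la * di al la)).

Definition imF (al la : R) := c1 al la * d2 al la + c2 al la * d1 al la
  - 2 * (cr al la * dr al la + ci al la * di al la).

Definition dreF (al la : R) := al * dg1 la * c2 al la + c1 al la * (al * dg2 la)
  - 2 * (al * dgr la * cr al la + al * dgi la * ci al la)
  - (al * de1 la * d2 al la + d1 al la * (al * de2 la)
     - 2 * (al * der la * dr al la + al * dei la * di al la)).

Definition dimF (al la : R) := al * dg1 la * d2 al la + c1 al la * (al * de2 la)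
  + (al * dg2 la * d1 al la + c2 al la * (al * de1 la))
  - 2 * (al * dgr la * dr al la + cr al la * (al * der la)
       + (al * dgi la * di al la + ci al la * (al * dei la))).

Let is_derive_affine (a al la dgx : R) (g : R -> R) : is_derive la 1 g dgx ->
  is_derive la 1 (fun x => a + al * g x) (al * dgx).
Proof.
move=> dg; rewrite -[_ * dgx]add0r.
apply: is_derive1_add (is_derive1_scale al dg).
Qed.

Lemma is_derive_F : \forall la \near la0, forall al,
  is_derive (la : R) 1 (reF al) (dreF al la) /\ is_derive la 1 (imF al) (dimF al la).
Proof.
case: hg1 => h1 _; case: hg2 => h2 _; case: hgr => h3 _; case: hgi => h4 _.
case: he1 => h5 _; case: he2 => h6 _; case: her => h7 _; case: hei => h8 _.
near=> la => al.
have H1 : is_derive la 1 (fun x => c1 al x) (al * dg1 la).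
  by apply: is_derive_affine; near: la.
have H2 : is_derive la 1 (fun x => c2 al x) (al * dg2 la).
  by apply: is_derive_affine; near: la.
have H3 : is_derive la 1 (fun x => cr al x) (al * dgr la).
  by apply: is_derive_affine; near: la.
have H4 : is_derive la 1 (fun x => ci al x) (al * dgi la).
  by apply: is_derive_affine; near: la.
have H5 : is_derive la 1 (fun x => d1 al x) (al * de1 la).
  by apply: is_derive_affine; near: la.
have H6 : is_derive la 1 (fun x => d2 al x) (al * de2 la).
  by apply: is_derive_affine; near: la.
have H7 : is_derive la 1 (fun x => dr al x) (al * der la).
  by apply: is_derive_affine; near: la.
have H8 : is_derive la 1 (fun x => di al x) (al * dei la).
  by apply: is_derive_affine; near: la.
split.
  have := is_derive1_sub (is_derive1_sub (is_derive1_mul H1 H2)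
     (is_derive1_add (is_derive1_mul H3 H3) (is_derive1_mul H4 H4)))
   (is_derive1_sub (is_derive1_mul H5 H6)
     (is_derive1_add (is_derive1_mul H7 H7) (is_derive1_mul H8 H8))).
  by move=> H; apply: (is_derive_eq H); rewrite /dreF; ring.
have := is_derive1_sub (is_derive1_add (is_derive1_mul H1 H6) (is_derive1_mul H2 H5))
   (is_derive1_scale 2 (is_derive1_add (is_derive1_mul H3 H7) (is_derive1_mul H4 H8))).
by move=> H; apply: (is_derive_eq H); rewrite /dimF; ring.
Unshelve. all: by end_near. Qed.

Section AlongPath.
Variables (mu : R -> R) (s : R).
Hypothesis ms : slope_path mu s.

Let L1 := affine_entry_lim hg1 ms g10.
Let L2 := affine_entry_lim hg2 ms g20.
Let zero_entry g : g la0 = 0 -> 0 + al0 * g la0 = 0 :> R.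
Proof. by move=> ->; rewrite mulr0 addr0. Qed.
Let Lr := affine_entry_lim hgr ms (zero_entry gr0).
Let Li := affine_entry_lim hgi ms (zero_entry gi0).
Let M1 := affine_entry_lim he1 ms (zero_entry e10).
Let M2 := affine_entry_lim he2 ms (zero_entry e20).
Let Mr := affine_entry_lim her ms (zero_entry er0).
Let Mi := affine_entry_lim hei ms (zero_entry ei0).

(** Only the products of an entry of [C] with the derivative of another survive:
    the functions [e] vanish to second order at [la0]. *)
Lemma dreF_lim : dreF al (mu al) / (al - al0) @[al --> F] -->
  al0 * dg1 la0 * (g2 la0 + al0 * (dg2 la0 * s)) +
  (g1 la0 + al0 * (dg1 la0 * s)) * (al0 * dg2 la0) -
  2 * al0 ^+ 2 * s * (dgr la0 ^+ 2 + dgi la0 ^+ 2).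
Proof.
have P1 := affine_entry_deriv_lim hg1 ms.
have P2 := affine_entry_deriv_lim hg2 ms.
have Pr := affine_entry_deriv_lim hgr ms.
have Pi := affine_entry_deriv_lim hgi ms.
have Q1 := affine_entry_deriv_lim he1 ms.
have Q2 := affine_entry_deriv_lim he2 ms.
have Qr := affine_entry_deriv_lim her ms.
have Qi := affine_entry_deriv_lim hei ms.
have A := limD (limM P1 L2) (limM L1 P2).
have B := limM (@lim_cst 2) (limD (limM Pr Lr) (limM Pi Li)).
have C := limD (limM Q1 M2) (limM M1 Q2).
have D := limM (@lim_cst 2) (limD (limM Qr Mr) (limM Qi Mi)).
have := limB (limB A B) (limB C D).
rewrite gr0 gi0 e10 e20 er0 ei0 de10 de20 der0 dei0.
rewrite [X in _ --> X -> _](_ : _ = al0 * dg1 la0 * (g2 la0 + al0 * (dg2 la0 * s)) +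
  (g1 la0 + al0 * (dg1 la0 * s)) * (al0 * dg2 la0) -
  2 * al0 ^+ 2 * s * (dgr la0 ^+ 2 + dgi la0 ^+ 2)); last by ring.
apply: eq_cvgl; near=> al.
have e0 : al - al0 != 0 by near: al; exact: near_F_neq.
by rewrite /dreF; field.
Unshelve. all: by end_near. Qed.

Lemma dimF_lim : dimF al (mu al) / (al - al0) @[al --> F] --> (0 : R).
Proof.
have P1 := affine_entry_deriv_lim hg1 ms.
have P2 := affine_entry_deriv_lim hg2 ms.
have Pr := affine_entry_deriv_lim hgr ms.
have Pi := affine_entry_deriv_lim hgi ms.
have Q1 := affine_entry_deriv_lim he1 ms.
have Q2 := affine_entry_deriv_lim he2 ms.
have Qr := affine_entry_deriv_lim her ms.
have Qi := affine_entry_deriv_lim hei ms.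
have A := limD (limM P1 M2) (limM L1 Q2).
have B := limD (limM P2 M1) (limM L2 Q1).
have C := limD (limM Pr Mr) (limM Lr Qr).
have D := limD (limM Pi Mi) (limM Li Qi).
have := limB (limD A B) (limM (@lim_cst 2) (limD C D)).
rewrite gr0 gi0 e10 e20 er0 ei0 de10 de20 der0 dei0.
rewrite [X in _ --> X -> _](_ : _ = 0); last by ring.
apply: eq_cvgl; near=> al.
have e0 : al - al0 != 0 by near: al; exact: near_F_neq.
by rewrite /dimF; field.
Unshelve. all: by end_near. Qed.

(** Every term of [imF] is a product of an entry of [C], of first order, and an
    entry of [D], which is negligible with respect to the first order. *)
Lemma imF_lim : imF al (mu al) / (al - al0) ^+ 2 @[al --> F] --> (0 : R).
Proof.
have A := limD (limM L1 M2) (limM L2 M1).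
have B := limM (@lim_cst 2) (limD (limM Lr Mr) (limM Li Mi)).
have := limB A B.
rewrite gr0 gi0 e10 e20 er0 ei0 de10 de20 der0 dei0.
rewrite [X in _ --> X -> _](_ : _ = 0); last by ring.
apply: eq_cvgl; near=> al.
have e0 : al - al0 != 0 by near: al; exact: near_F_neq.
by rewrite /imF; field.
Unshelve. all: by end_near. Qed.

End AlongPath.

Variables (lam : R -> R) (s tau h : R) (cl : R -> R) (gam n : R).
Hypothesis lam0 : lam al0 = la0.
Hypothesis dlam : is_derive al0 1 lam s.
Hypothesis lam_zero : \forall al \near F, reF al (lam al) = 0.
Hypothesis imF_neq0 : \forall al \near F, imF al (lam al) != 0.
Hypothesis cl_lim : cl al / (al - al0) @[al --> F] --> gam.
Hypothesis gam_neq0 : gam != 0.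
Hypothesis n_neq0 : n != 0.
Hypothesis tauE : tau =
  al0 * dg1 la0 * (g2 la0 + al0 * (dg2 la0 * s)) +
  (g1 la0 + al0 * (dg1 la0 * s)) * (al0 * dg2 la0) -
  2 * al0 ^+ 2 * s * (dgr la0 ^+ 2 + dgi la0 ^+ 2).
Hypothesis tau_neq0 : tau != 0.

(** This is [kappa] for the path [lam], the cofactor [cl] and [n = |phi| ^ 2]. *)
Definition width al := imF al (lam al) / (al * cl al * n).

(** The derivative of the argument of [conj F / F] in the spectral parameter. *)
Definition phase_speed al la := -2 * (reF al la * dimF al la - imF al la * dreF al la)
  / (reF al la ^+ 2 + imF al la ^+ 2).

Lemma lam_slope : slope_path lam s.
Proof.
have [q qc qE] := is_derive_slope dlam.
have : q al @[al --> F] --> s by apply: (cvg_trans _ qc); exact: cvg_app (@nbhs_dnbhs _ _).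
apply: eq_cvgl; near=> al.
have e0 : al - al0 != 0 by near: al; exact: near_F_neq.
by rewrite -lam0 qE mulfK.
Unshelve. all: by end_near. Qed.

Lemma width_ratio_lim :
  width al * (al - al0) / imF al (lam al) @[al --> F] --> (al0 * gam * n)^-1.
Proof.
have : (al * (cl al / (al - al0)) * n)^-1 @[al --> F] --> (al0 * gam * n)^-1.
  apply: cvgV; first by rewrite !mulf_neq0.
  by apply: cvgM; [apply: cvgM => //; exact: cvg_F_id|exact: cvg_cst].
apply: eq_cvgl; near=> al.
have e0 : al - al0 != 0 by near: al; exact: near_F_neq.
have f0 : imF al (lam al) != 0 by near: al.
rewrite /width !invfM invrK.
by set a := al^-1; set b := (cl al)^-1; set c := n^-1; field.
Unshelve. all: by end_near. Qed.

(** The numerator of [width] is negligible with respect to [(al - al0) ^ 2], and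
    its denominator is exactly of first order. *)
Lemma width_small : width al / (al - al0) @[al --> F] --> (0 : R).
Proof.
have := limM width_ratio_lim (imF_lim lam_slope); rewrite mulr0.
apply: eq_cvgl; near=> al.
have e0 : al - al0 != 0 by near: al; exact: near_F_neq.
have f0 : imF al (lam al) != 0 by near: al.
by field; rewrite e0 f0.
Unshelve. all: by end_near. Qed.

(** Since [width] is negligible with respect to [al - al0], points at a distance
    at most [h * width] from the path share its slope. This covers the evaluation
    point and the intermediate points of the mean value theorem. *)
Lemma slope_near_path (xi : R -> R) :
  (\forall al \near F, `|xi al - lam al| <= `|h * width al|) -> slope_path xi s.
Proof.
move=> xiE.
have k0 : (xi al - lam al) / (al - al0) @[al --> F] --> (0 : R).
  apply: norm_cvg0.
  apply: (@squeeze_cvgr _ _ _ _ (cst 0) (fun al => `|h * (width al / (al - al0))|)).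
  - near=> al; rewrite normr_ge0 /= mulrA [leLHS]normrM [leRHS]normrM.
    apply: ler_wpM2r => //; near: al.
    exact: xiE.
  - exact: cvg_cst.
  - have := limM (@lim_cst h) width_small; rewrite mulr0 => /cvg_norm.
    by rewrite normr0.
have := limD k0 lam_slope; rewrite add0r; apply: eq_cvgl; near=> al.
by rewrite -mulrDl; congr (_ / _); ring.
Unshelve. all: by end_near. Qed.

Lemma width_target_cvg : lam al + h * width al @[al --> F] --> la0.
Proof.
apply: (@slope_path_cvg _ s); apply: slope_near_path; near=> al.
by rewrite addrAC subrr add0r.
Unshelve. all: by end_near. Qed.

(** Divide numerator and denominator of the phase speed by [imF ^ 2]. The
    quotient [reF / imF] at the evaluation point tends to [h tau / (al0 gam n)],
    and [imF] there is equivalent to its value on the path. *)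
Lemma peak_limit :
  width al * phase_speed al (lam al + h * width al) @[al --> F] -->
  2 * ((al0 * gam * n / tau) / (h ^+ 2 + (al0 * gam * n / tau) ^+ 2)).
Proof.
pose P al := width al * (al - al0) / imF al (lam al).
pose lh al := lam al + h * width al.
have lhs : slope_path lh s.
  apply: slope_near_path; near=> al.
  by rewrite /lh addrAC subrr add0r.
have [r r0 rF] : exists2 r : R, 0 < r & forall la, `|la - la0| < r -> forall al,
    is_derive la 1 (reF al) (dreF al la) /\ is_derive la 1 (imF al) (dimF al la).
  have /nbhs_ballP [r /= r0 H] := is_derive_F.
  exists r; first exact: r0.
  by move=> la; rewrite distrC; exact: H.
have small : \forall al \near F, `|lam al - la0| + `|h * width al| < r.
  have c1 := slope_path_cvg lam_slope.
  have c2 := slope_path_cvg lhs.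
  have r2 : 0 < r / 3 by rewrite divr_gt0.
  move/cvgrPdist_lt : c1 => /(_ _ r2) c1; move/cvgrPdist_lt : c2 => /(_ _ r2) c2.
  near=> al.
  have a1 : `|la0 - lam al| < r / 3 by near: al; exact: c1.
  have a2 : `|la0 - lh al| < r / 3 by near: al; exact: c2.
  have : `|h * width al| <= `|la0 - lam al| + `|la0 - lh al|.
    rewrite (_ : h * width al = (la0 - lam al) - (la0 - lh al)) ?ler_normB//.
    by rewrite /lh; ring.
  by rewrite (distrC (lam al)); lra.
have mvt : forall al, exists xi : R * R, `|lam al - la0| + `|h * width al| < r ->
    [/\ `|xi.1 - lam al| <= `|h * width al|, `|xi.2 - lam al| <= `|h * width al|,
      reF al (lh al) - reF al (lam al) = dreF al xi.1 * (h * width al) &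
      imF al (lh al) - imF al (lam al) = dimF al xi.2 * (h * width al)].
  move=> al; have [sm|] := pselect (`|lam al - la0| + `|h * width al| < r); last first.
    by exists (0, 0).
  have lhE : lh al - lam al = h * width al by rewrite /lh addrAC subrr add0r.
  have din x : `|x - lam al| <= `|lh al - lam al| -> `|x - la0| < r.
    rewrite lhE => xl; rewrite (_ : x - la0 = (x - lam al) + (lam al - la0)).
      by rewrite (le_lt_trans (ler_normD _ _))//; lra.
    by ring.
  have [x1 x1l E1] := MVT_unordered (fun x xl => (rF x (din x xl) al).1).
  have [x2 x2l E2] := MVT_unordered (fun x xl => (rF x (din x xl) al).2).
  by exists (x1, x2) => _; rewrite -lhE.
have [xi xiE] := choice mvt.
have x1s : slope_path (fun al => (xi al).1) s.
  apply: slope_near_path; near=> al.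
  have sm : `|lam al - la0| + `|h * width al| < r by near: al; exact: small.
  by have [] := xiE al sm.
have x2s : slope_path (fun al => (xi al).2) s.
  apply: slope_near_path; near=> al.
  have sm : `|lam al - la0| + `|h * width al| < r by near: al; exact: small.
  by have [] := xiE al sm.
have LP := width_ratio_lim; rewrite -/P in LP.
set k := (al0 * gam * n)^-1 in LP.
have X1 := dreF_lim x1s; rewrite -tauE in X1.
have X2 := dimF_lim x2s.
have X3 := dreF_lim lhs; rewrite -tauE in X3.
have X4 := dimF_lim lhs.
have Y1 := limM (@lim_cst h) (limM LP X1).
have Y2 := limD (@lim_cst 1) (limM (@lim_cst h) (limM LP X2)).
rewrite !mulr0 addr0 in Y2.
have N := limM (limM (@lim_cst (-2)) LP) (limB (limM Y1 X4) (limM Y2 X3)).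
have Dn := limD (limM Y1 Y1) (limM Y2 Y2).
have k0 : k != 0 by rewrite invr_eq0 !mulf_neq0.
have D0 : h * (k * tau) * (h * (k * tau)) + 1 * 1 != 0.
  by rewrite mulr1 -expr2 gt_eqF// ltr_wpDl ?sqr_ge0.
have := limM N (limV D0 Dn).
rewrite [X in _ --> X -> _](_ : _ = 2 * ((al0 * gam * n / tau) / (h ^+ 2 +
    (al0 * gam * n / tau) ^+ 2))); last first.
  have -> : al0 * gam * n = k^-1 by rewrite invrK.
  have H : 1 + (h * k * tau) ^+ 2 != 0 by rewrite gt_eqF// ltr_wpDr ?sqr_ge0.
  have H' : h ^+ 2 + (k^-1 / tau) ^+ 2 != 0.
    rewrite gt_eqF// ltr_wpDl ?sqr_ge0// exprn_even_gt0//=.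
    exact: mulf_neq0 (invr_neq0 k0) (invr_neq0 tau_neq0).
  move: D0; rewrite !mulr0 sub0r !mul1r => D0; apply/eqP.
  rewrite [eqbRHS]mulrA eqr_div//; apply/eqP; field.
  by rewrite k0 tau_neq0.
apply: eq_cvgl; near=> al.
have e0 : al - al0 != 0 by near: al; exact: near_F_neq.
have f0 : imF al (lam al) != 0 by near: al.
have z0 : reF al (lam al) = 0 by near: al.
have sm : `|lam al - la0| + `|h * width al| < r by near: al; exact: small.
have [_ _ E1 E2] := xiE al sm.
rewrite z0 subr0 in E1; move/eqP: E2; rewrite subr_eq => /eqP E2.
rewrite /phase_speed -/(lh al) /P E1 E2.
set f := imF al (lam al) in f0 *; set w := width al.
set e := al - al0 in e0 *.
move: (dreF al (xi al).1) (dimF al (xi al).2) (dreF al (lh al)) (dimF al (lh al)).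
move=> y1 y2 y3 y4.
have -> : h * (w * e / f * (y1 / e)) * (h * (w * e / f * (y1 / e))) +
    (1 + h * (w * e / f * (y2 / e))) * (1 + h * (w * e / f * (y2 / e))) =
    ((y1 * (h * w)) ^+ 2 + (y2 * (h * w) + f) ^+ 2) / f ^+ 2.
  by field; rewrite e0 f0.
rewrite invfM invrK.
by set q := (_ ^+ 2 + _ ^+ 2)^-1; field; rewrite e0 f0.
Unshelve. all: by end_near. Qed.

End Asymptotics.

(** * Change of variables on the line *)

Section LebesgueLine.
Local Open Scope ring_scope.
Variable R : realType.
Local Notation leb := (@lebesgue_measure R).
Implicit Types f g : R -> R.

Local Notation mR := (measurableTypeR R).

(** Stated on the intervals that determine Lebesgue measure; used for translations
    and reflections. *)
Definition preserves_lebesgue (phi : mR -> mR) := measurable_fun setT phi /\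
  forall b c, leb (phi @^-1` `]b, c]) = leb `]b, c].

Lemma preserves_lebesgueE phi : preserves_lebesgue phi -> forall A : set mR,
  measurable A -> pushforward leb phi A = leb A.
Proof.
move=> [mphi phiE] A mA.
apply/esym.
apply: (@lebesgue_measure_unique R
  (measure_function_pushforward__canonical__measure_function_Measure leb mphi) _ A mA).
by move=> X [[b c] _ <-] /=; rewrite /pushforward phiE.
Qed.

Lemma preserves_lebesgue_integral (phi : mR -> mR) (f : mR -> R) : preserves_lebesgue phi ->
  measurable_fun setT f -> leb.-integrable setT (EFin \o (f \o phi)) ->
  leb.-integrable setT (EFin \o f) /\ \int[leb]_x f (phi x) = \int[leb]_x f x.
Proof.
move=> phiP mf If; have [mphi _] := phiP.
have mf' : measurable_fun setT (EFin \o f) by exact/measurable_EFinP.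
have eqm (A : set mR) : measurable A -> pushforward leb phi A = leb A.
  exact: preserves_lebesgueE.
have I1 := @integrable_pushforward _ _ _ _ _ phi mphi leb setT _ mf' If measurableT.
have E1 := @integral_pushforward _ _ _ _ _ phi mphi leb setT _ mf' If measurableT.
have eqI (g : mR -> \bar R) : (\int[pushforward leb phi]_x g x = \int[leb]_x g x)%E.
  apply: (eq_measure_integral leb).
  by move=> A mA _; exact: eqm.
split.
  apply/integrableP; split=> //.
  by have /integrableP[_] := I1; rewrite eqI.
by rewrite /Rintegral -[in RHS]eqI E1.
Qed.

Lemma preserves_lebesgue_shift (a : R) : preserves_lebesgue (fun x => a + x).
Proof.
split; first by apply: measurable_funD; [exact: measurable_cst|exact: measurable_id].
move=> b c; have -> : (fun x => a + x) @^-1` `]b, c] = `]b - a, c - a]%classic.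
  by apply/seteqP; split=> x /=; rewrite !in_itv /= ltrBlDl lerBrDl.
by rewrite !lebesgue_measure_itv /= !lte_fin ltrD2r -!EFinB; congr (if _ then _%:E else _); ring.
Qed.

Lemma preserves_lebesgue_reflect (a : R) : preserves_lebesgue (fun x => a - x).
Proof.
split; first by apply: measurable_funB; [exact: measurable_cst|exact: measurable_id].
move=> b c; have -> : (fun x => a - x) @^-1` `]b, c] = `[a - c, a - b[%classic.
  apply/seteqP; split=> x /=; rewrite !in_itv /= => /andP[? ?];
  by apply/andP; split; lra.
rewrite !lebesgue_measure_itv /= !lte_fin ltrD2l ltrN2 -!EFinB.
by congr (if _ then _%:E else _); ring.
Qed.

Lemma measurable_inv : measurable_fun [set: R] (fun x : R => x^-1).
Proof.
rewrite (_ : (fun x : R => x^-1) = (fun x => x * (x ^+ 2) `^ (-1))).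
  apply: measurable_funM; first exact: measurable_id.
  apply: (@measurableT_comp _ _ _ _ _ _ (fun r => r `^ (-1))).
    exact: measurable_powR.
  by apply: measurable_funX; exact: measurable_id.
apply/funext => x; rewrite powR_inv1 ?sqr_ge0//.
have [->|x0] := eqVneq x 0; first by rewrite invr0 mul0r.
by rewrite expr2 invfM mulrA mulfV// mul1r.
Qed.

(** A fixed integrable weight: domination by a multiple of it gives integrability,
    and translation changes it only by a bounded factor. *)
Definition decayw (x : R) : R := (1 + x ^+ 2)^-1.

Lemma decayw_den (x : R) : 0 < 1 + x ^+ 2.
Proof. by rewrite ltr_wpDr ?sqr_ge0. Qed.

Lemma decayw_gt0 x : 0 < decayw x.
Proof. by rewrite invr_gt0 decayw_den. Qed.

Lemma continuous_decayw : continuous decayw.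
Proof. exact: continuous_oneDsqrV. Qed.

Lemma measurable_decayw : measurable_fun setT decayw.
Proof. exact: continuous_measurable_fun continuous_decayw. Qed.

Lemma integrable_decayw : leb.-integrable setT (EFin \o decayw).
Proof.
apply/integrableP; split; first by apply/measurable_EFinP; exact: measurable_decayw.
under eq_integral do rewrite /= ger0_norm ?ltW ?decayw_gt0//.
rewrite ge0_symfun_integralT; last 3 first.
- by move=> x; exact/ltW/decayw_gt0.
- exact: continuous_decayw.
- by move=> x; rewrite /decayw /= sqrrN.
rewrite -set_itvcy (@ge0_continuous_FTC2y _ decayw atan 0 (pi / 2)).
- by rewrite -EFinB -EFinM ltry.
- by move=> x _; exact/ltW/decayw_gt0.
- by apply: continuous_subspaceT; exact: continuous_decayw.
- exact: cvgy_atan.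
- by move=> x _; exact: is_derive1_derivable (is_derive1_atan x).
- apply: cvg_at_right_filter; exact: continuous_atan.
- by move=> x _; exact: is_derive1E (is_derive1_atan x).
Qed.

Lemma integrable_decayw_bound f (M : R) : measurable_fun setT f ->
  (forall x, `|f x| <= M * decayw x) -> leb.-integrable setT (EFin \o f).
Proof.
move=> mf fM; have Ib := integrable_lincomb M 0 integrable_decayw integrable_decayw.
apply: (le_integrable _ _ _ Ib) => //; first exact/measurable_EFinP.
by move=> x _ /=; rewrite lee_fin mul0r addr0 (le_trans _ (ler_norm _)).
Qed.

Lemma decayw_shift (L la t : R) : `|la| <= L ->
  decayw (la + t) <= 2 * (1 + L ^+ 2) * decayw t.
Proof.
move=> laL; rewrite /decayw; have b1 := decayw_den (la + t); have b2 := decayw_den t.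
rewrite -[leLHS]mul1r ler_pdivrMr// mulrAC ler_pdivlMr// mul1r.
have L2 : la ^+ 2 <= L ^+ 2.
  by rewrite -[la ^+ 2]real_normK ?num_real// ler_sqr ?nnegrE// (le_trans _ laL).
have := sqr_ge0 (L * (la + t)); have := sqr_ge0 (2 * la + t).
by rewrite !exprMn; nra.
Qed.

End LebesgueLine.

(** * Functions with integrable derivatives and the principal value integral *)

Section SmoothDecay.
Local Open Scope ring_scope.
Variable R : realType.
Local Notation leb := (@lebesgue_measure R).
Local Notation mR := (measurableTypeR R).
Implicit Types f g : R -> R.

(** [f] and its first [n] derivatives are continuous and bounded by a multiple of
    the integrable weight. Finitely many derivatives suffice for the transform to
    be continuously differentiable. *)
Fixpoint smooth_decay (n : nat) (f : R -> R) : Prop :=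
  [/\ continuous f, exists M, forall x, `|f x| <= M * decayw x &
   if n is m.+1 then exists2 f' : R -> R, (forall x : R, is_derive x 1 f (f' x)) & smooth_decay m f'
   else True].

Lemma smooth_decayW n f : smooth_decay n.+1 f -> smooth_decay n f.
Proof.
elim: n f => [|n IHn] f; first by case=> cf bf _; split.
by case=> cf bf [f' df /IHn sf']; split=> //; exists f'.
Qed.

Lemma smooth_decay_le m n f : (m <= n)%N -> smooth_decay n f -> smooth_decay m f.
Proof.
move=> mn; rewrite -(subnK mn); elim: (n - m)%N => [//|k IHk] /smooth_decayW.
exact: IHk.
Qed.

Lemma smooth_decay_lincomb n (a b : R) f g : smooth_decay n f -> smooth_decay n g ->
  smooth_decay n (fun x => a * f x + b * g x).
Proof.
elim: n f g => [|n IHn] f g [cf [M fM] df] [cg [N gN] dg].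
all: have c : continuous (fun x => a * f x + b * g x) by
  move=> x; apply: cvgD; (apply: cvgM; [exact: cvg_cst|exact: cf || exact: cg]).
all: have bd : exists M, forall x, `|a * f x + b * g x| <= M * decayw x.
1,3: exists (`|a| * M + `|b| * N) => x; rewrite (le_trans (ler_normD _ _))// !normrM mulrDl;
  by rewrite -!mulrA lerD// ler_wpM2l.
all: split=> //.
move: df dg => [f' df sf] [g' dg sg]; exists (fun x => a * f' x + b * g' x).
  by move=> x; exact: is_derive1_add (is_derive1_scale a (df x)) (is_derive1_scale b (dg x)).
exact: IHn.
Qed.

Lemma decayw_le1 (x : R) : decayw x <= 1.
Proof. by rewrite invf_le1 ?decayw_den// lerDl sqr_ge0. Qed.

Lemma decaywN (x : R) : decayw (- x) = decayw x. Proof. by rewrite /decayw sqrrN. Qed.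

Lemma decayw_ge_half (t : R) : `|t| <= 1 -> 1 <= 2 * decayw t.
Proof.
move=> t1; rewrite /decayw ler_pdivlMr ?decayw_den// mul1r.
have : t ^+ 2 <= 1 by rewrite -[t ^+ 2]real_normK ?num_real// expr_le1.
lra.
Qed.

Lemma decayw_bound_ge0 f M : (forall x, `|f x| <= M * decayw x) -> 0 <= M.
Proof.
by move=> /(_ 0) H; rewrite -(pmulr_lge0 _ (decayw_gt0 0)) (le_trans _ H).
Qed.

Lemma decayw_bound_le f M : (forall x, `|f x| <= M * decayw x) -> forall x, `|f x| <= M.
Proof.
move=> H x; rewrite (le_trans (H x))// ler_piMr ?decayw_le1//.
exact: decayw_bound_ge0 H.
Qed.

Lemma decayw_bound_shift f M L la t : (forall x, `|f x| <= M * decayw x) -> `|la| <= L ->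
  `|f (la + t)| <= M * (2 * (1 + L ^+ 2)) * decayw t.
Proof.
move=> H laL; rewrite (le_trans (H _))// -mulrA ler_wpM2l ?decayw_shift//.
exact: decayw_bound_ge0 H.
Qed.

Definition symm_quotient f (la t : R) : R := (f (la + t) - f (la - t)) / t.

Lemma measurable_symm_quotient f la : continuous f ->
  measurable_fun [set: mR] (symm_quotient f la : mR -> R).
Proof.
move=> cf; apply: measurable_funM; last exact: measurable_inv.
have mf := continuous_measurable_fun cf.
apply: measurable_funB; apply: (measurableT_comp mf).
  by apply: measurable_funD; [exact: measurable_cst|exact: measurable_id].
by apply: measurable_funB; [exact: measurable_cst|exact: measurable_id].
Qed.

(** Uniformity in [la] on bounded sets is what allows differentiation under the
    integral. The mean value theorem bounds the quotient for small [t], and the decay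
    of [f] for large [t]. *)
Lemma symm_quotient_bound f L : smooth_decay 1 f ->
  exists K, forall la t, `|la| <= L -> `|symm_quotient f la t| <= K * decayw t.
Proof.
move=> [cf [M fM] [f' df [_ [M' fM'] _]]].
have M0 := decayw_bound_ge0 fM; have M'0 := decayw_bound_ge0 fM'.
exists (4 * M' + 2 * (M * (2 * (1 + L ^+ 2)))) => la t laL.
have b0 := decayw_gt0 t.
have K0 : 0 <= M * (2 * (1 + L ^+ 2)) by rewrite !mulr_ge0 ?addr_ge0 ?sqr_ge0.
have [t1|t1] := leP `|t| 1.
  have [->|t0] := eqVneq t 0.
    by rewrite /symm_quotient invr0 mulr0 normr0; apply: mulr_ge0; [nra|exact/ltW/decayw_gt0].
  have [c _ E] := @MVT_unordered R f f' (la - t) (la + t) (fun x _ => df x).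
  rewrite /symm_quotient E (_ : la + t - (la - t) = 2 * t); last by ring.
  rewrite mulrA mulfK// normrM (@ger0_norm _ 2)//.
  rewrite (@le_trans _ _ (M' * 2))//.
    by rewrite ler_wpM2r// (decayw_bound_le fM').
  rewrite mulrDl (@le_trans _ _ (4 * M' * decayw t))//; last first.
    by rewrite lerDl; apply: mulr_ge0; [exact: mulr_ge0|exact: ltW].
  by have := decayw_ge_half t1; nra.
rewrite /symm_quotient normrM normfV.
have ti : `|t|^-1 <= 1 by rewrite invf_le1 ?ltW// (lt_trans ltr01).
have h1 := decayw_bound_shift t fM laL.
have h2 := decayw_bound_shift (- t) fM laL; rewrite decaywN in h2.
have h3 := ler_normB (f (la + t)) (f (la - t)).
rewrite (@le_trans _ _ (`|f (la + t) - f (la - t)|))//.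
  by rewrite ler_piMr.
have : 0 <= 4 * M' * decayw t by rewrite !mulr_ge0// ltW.
by nra.
Qed.

Lemma integrable_symm_quotient f la : smooth_decay 1 f ->
  leb.-integrable setT (EFin \o symm_quotient f la).
Proof.
move=> sf; have [K HK] := symm_quotient_bound `|la| sf.
apply: (integrable_decayw_bound (M := K)); last by move=> x; exact: HK.
by apply: measurable_symm_quotient; case: sf.
Qed.

(** The principal value integral of [f x / (x - la)]: substituting [x = la + t] and
    [x = la - t] and averaging cancels the singularity and leaves an absolutely
    convergent integral. *)
Definition hilbert f la : R := 1/2 * \int[leb]_t symm_quotient f la t.

Lemma truncated_pvE f la e : smooth_decay 1 f -> 0 < e ->
  \int[leb]_(x in ~` `]la - e, la + e[) (f x / (x - la)) =
  1/2 * \int[leb]_t (\1_[set t | e <= `|t|] t * symm_quotient f la t).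
Proof.
move=> sf e0; rewrite Rintegral_mkcond.
have [cf [M fM] _] := sf; have M0 := decayw_bound_ge0 fM.
set D := ~` _; set E := [set t : R | e <= `|t|].
have mD : measurable (D : set mR) by apply: measurableC; exact: measurable_itv.
have mE : measurable (E : set mR).
  rewrite (_ : E = ~` `]- e, e[); first by apply: measurableC; exact: measurable_itv.
  apply/seteqP; split=> t; rewrite /E /= in_itv /= -ltr_norml => H.
    by apply/negP; rewrite -leNgt.
  by move/negP: H; rewrite -leNgt.
pose g (x : mR) : R := \1_D x * (f x / (x - la)).
have gE x : ((fun x => f x / (x - la)) \_ D) x = g x.
  by rewrite /g patchE indicE; case: (x \in D); rewrite ?mul1r ?mul0r.
under eq_Rintegral do rewrite gE.
have DE t : \1_D (la + t) = \1_E t :> R /\ \1_D (la - t) = \1_E t :> R.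
  have DP x : (x \in D) = (e <= `|x - la|).
    apply/idP/idP; rewrite inE /D /= in_itv /= -ltr_distlC distrC => H.
      by rewrite leNgt; apply/negP.
    by apply/negP; rewrite -leNgt.
  have EP : (t \in E) = (e <= `|t|) by apply/idP/idP; rewrite inE.
  rewrite !indicE !DP EP (_ : la + t - la = t); last by ring.
  by rewrite (_ : la - t - la = - t) ?normrN//; ring.
have mg : measurable_fun [set: mR] g.
  apply: measurable_funM; first exact: measurable_indic.
  apply: measurable_funM; first exact: continuous_measurable_fun.
  apply: (@measurableT_comp _ _ _ _ _ _ (fun y : R => y^-1)).
    exact: measurable_inv.
  by apply: measurable_funB; [exact: measurable_id|exact: measurable_cst].
have gb t : `|\1_E t * (f (la + t) / t)| <= e^-1 * (M * (2 * (1 + `|la| ^+ 2))) * decayw t.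
  have r0 : 0 <= e^-1 * (M * (2 * (1 + `|la| ^+ 2))) * decayw t.
    apply: mulr_ge0; last exact/ltW/decayw_gt0.
    apply: mulr_ge0; first by rewrite invr_ge0 ltW.
    by apply: mulr_ge0 => //; apply: mulr_ge0 => //; rewrite addr_ge0 ?sqr_ge0.
  rewrite indicE; case: (boolP (t \in E)) => [|_] /=; last by rewrite mul0r normr0.
  rewrite inE mul1r /E /= => et; rewrite normrM normfV mulrC -mulrA.
  apply: ler_pM => //; last exact: decayw_bound_shift.
  by rewrite lef_pV2 ?posrE// (lt_le_trans e0).
have gp t : g (la + t) = \1_E t * (f (la + t) / t).
  by rewrite /g (DE t).1 (_ : la + t - la = t)//; ring.
have gm t : g (la - t) = - (\1_E t * (f (la - t) / t)).
  rewrite /g (DE t).2 (_ : la - t - la = - t); last by ring.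
  by rewrite invrN; ring.
have I1 : leb.-integrable setT (EFin \o (g \o (fun t => la + t))).
  apply: integrable_decayw_bound; last by move=> t /=; rewrite gp; exact: gb.
  by apply: (measurableT_comp mg); exact: (preserves_lebesgue_shift la).1.
have I2 : leb.-integrable setT (EFin \o (g \o (fun t => la - t))).
  apply: integrable_decayw_bound; last first.
    move=> t /=; rewrite gm normrN; have := gb (- t).
    rewrite decaywN invrN mulrN mulrN normrN; apply: le_trans.
    by rewrite !indicE (_ : (- t \in E) = (t \in E))//; apply/idP/idP; rewrite !inE /E /= normrN.
  by apply: (measurableT_comp mg); exact: (preserves_lebesgue_reflect la).1.
have [_ E1] := preserves_lebesgue_integral (preserves_lebesgue_shift la) mg I1.
have [_ E2] := preserves_lebesgue_integral (preserves_lebesgue_reflect la) mg I2.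
have -> : \int[leb]_x g x = 1/2 * \int[leb]_x g x + 1/2 * \int[leb]_x g x by lra.
rewrite -{1}E1 -E2 -mulrDr; congr (_ * _).
rewrite -(RintegralD measurableT I1 I2); apply: eq_Rintegral => t _.
by rewrite /= gp gm /symm_quotient; ring.
Qed.

End SmoothDecay.

(** * The principal value transform *)

Section HilbertTransform.
Local Open Scope ring_scope.
Variable R : realType.
Local Notation leb := (@lebesgue_measure R).
Local Notation mR := (measurableTypeR R).
Implicit Types f g : R -> R.

Lemma Rintegral_abs_le (f g : mR -> R) : leb.-integrable setT (EFin \o f) ->
  leb.-integrable setT (EFin \o g) -> (forall x, `|f x| <= g x) ->
  `|\int[leb]_x f x| <= \int[leb]_x g x.
Proof.
move=> If Ig fg; rewrite (le_trans (le_normr_Rintegral measurableT If))//.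
apply: le_Rintegral => //.
have := integrable_abse If; apply: eq_integrable => //.
Qed.

(** By [truncated_pvE] the truncation error is an integral over [[-e, e]] of a
    bounded function. *)
Lemma principal_valueE f la : smooth_decay 1 f ->
  principal_value f la = hilbert f la.
Proof.
move=> sf; have [K HK] := symm_quotient_bound `|la| sf.
have IQ := integrable_symm_quotient la sf.
have K0 : 0 <= K by apply: (@decayw_bound_ge0 R (symm_quotient f la)) => t; exact: HK.
apply: cvg_lim => //; apply/cvgrPdist_le => eps eps0.
have d0 : 0 < eps / (K + 1) by rewrite divr_gt0// ltr_wpDl.
near=> e.
have e0 : 0 < e by near: e; exact: nbhs_right_gt.
have ed : e <= eps / (K + 1) by near: e; apply: nbhs_right_le.
rewrite truncated_pvE// /hilbert -mulrBr.
pose J : set mR := `]- e, e[%classic.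
have mJ : measurable J by exact: measurable_itv.
have mC : measurable (~` J) by exact: measurableC.
have EJ : [set t : R | e <= `|t|] = ~` J.
  apply/seteqP; split=> t; rewrite /J /= in_itv /= -ltr_norml => H.
    by apply/negP; rewrite -leNgt.
  by move/negP: H; rewrite -leNgt.
have IJ : leb.-integrable setT (EFin \o (fun t : mR => \1_J t * symm_quotient f la t)).
  apply: (le_integrable _ _ _ IQ) => //.
    apply/measurable_EFinP; apply: measurable_funM; first exact: measurable_indic.
    by apply: measurable_symm_quotient; case: sf.
  move=> t _ /=; rewrite lee_fin normrM ler_piMl// indicE.
  by case: (t \in J); rewrite ?normr1 ?normr0.
have IJ' : leb.-integrable setT (EFin \o (fun t : mR => \1_(~` J) t * symm_quotient f la t)).
  apply: (le_integrable _ _ _ IQ) => //.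
    apply/measurable_EFinP; apply: measurable_funM; first exact: measurable_indic.
    by apply: measurable_symm_quotient; case: sf.
  move=> t _ /=; rewrite lee_fin normrM ler_piMl// indicE.
  by case: (t \in ~` J); rewrite ?normr1 ?normr0.
rewrite EJ -RintegralB//.
have -> : \int[leb]_t (symm_quotient f la t - \1_(~` J) t * symm_quotient f la t) =
    \int[leb]_t (\1_J t * symm_quotient f la t).
  apply: eq_Rintegral => t _; rewrite !indicE in_setC.
  by case: (t \in J) => /=; ring.
have I1 : leb.-integrable setT (EFin \o (\1_J : mR -> R)).
  exact: integrable_indic_itv.
have I2 : leb.-integrable setT (EFin \o (fun t : mR => K * \1_J t)).
  exact: (integrableZl measurableT K I1).
rewrite normrM ger0_norm//.
rewrite (@le_trans _ _ (1 / 2 * \int[leb]_t (K * \1_J t)))//.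
  rewrite ler_wpM2l//; apply: Rintegral_abs_le => // t.
  rewrite normrM mulrC (@ger0_norm _ (\1_J t)) ?indicE ?ler0n// ler_wpM2r ?ler0n//.
  by rewrite (decayw_bound_le (f := symm_quotient f la))// => x; exact: HK.
have -> : \int[leb]_t (K * \1_J t) = K * (2 * e).
  rewrite RintegralZl// /Rintegral integral_indic// setIT.
  have JE : leb J = (2 * e)%:E.
    rewrite /J lebesgue_measure_itv /= lte_fin ifT; last by lra.
    by rewrite -EFinB; congr EFin; ring.
  by congr (_ * _); rewrite -[LHS]/(fine (leb J)) JE.
rewrite (_ : 1 / 2 * (K * (2 * e)) = K * e); last by field.
move: ed; rewrite ler_pdivlMr ?ltr_wpDl//; nra.
Unshelve. all: by end_near. Qed.

(** Differentiation under the integral sign: [symm_quotient f] has derivative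
    [symm_quotient f'], dominated locally uniformly by [symm_quotient_bound]. *)
Lemma hilbert_derive f f' (la : R) : (forall x : R, is_derive x 1 f (f' x)) ->
  smooth_decay 1 f -> smooth_decay 1 f' ->
  is_derive la 1 (hilbert f) (hilbert f' la).
Proof.
move=> df sf sf'.
have [K HK] := symm_quotient_bound (`|la| + 1) sf'.
have K0 : 0 <= K.
  by apply: (@decayw_bound_ge0 R (symm_quotient f' 0)) => t; apply: HK; rewrite normr0 addr_ge0.
have dQ (x t : R) : is_derive x 1 (fun y => symm_quotient f y t) (symm_quotient f' x t).
  have h1 : is_derive x 1 (fun y => f (y + t)) (f' (x + t)).
    have := @is_derive1_comp R f (fun y => y + t) x _ _ (df _)
      (is_derive1_add (is_derive_id x 1) (is_derive1_cst t x)).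
    by rewrite addr0 mulr1.
  have h2 : is_derive x 1 (fun y => f (y - t)) (f' (x - t)).
    have := @is_derive1_comp R f (fun y => y - t) x _ _ (df _)
      (is_derive1_sub (is_derive_id x 1) (is_derive1_cst t x)).
    by rewrite subr0 mulr1.
  have := is_derive1_scale t^-1 (is_derive1_sub h1 h2).
  rewrite mulrC; apply: is_derive1_ext => y.
  by rewrite /symm_quotient mulrC.
have laI : (`]la - 1, la + 1[ : set R)%classic la.
  by rewrite /= in_itv /=; apply/andP; split; lra.
have intf x : (`]la - 1, la + 1[ : set R)%classic x ->
    leb.-integrable setT (EFin \o (symm_quotient f x : mR -> R)).
  by move=> _; exact: integrable_symm_quotient.
have der x (y : mR) : (`]la - 1, la + 1[ : set R)%classic x -> setT y ->
    derivable (symm_quotient f ^~ y) x 1.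
  by move=> _ _; exact: is_derive1_derivable (dQ x y).
have G0 (y : mR) : 0 <= K * decayw y by rewrite mulr_ge0// ltW// decayw_gt0.
have IG : leb.-integrable setT (EFin \o (fun y : mR => K * decayw y)).
  exact: (integrableZl measurableT K (integrable_decayw R)).
have bd x (y : mR) : (`]la - 1, la + 1[ : set R)%classic x -> setT y ->
    `|partial1of2 (symm_quotient f : R -> mR -> R) x y| <= K * decayw y.
  rewrite /= in_itv /= => xI _; rewrite /partial1of2 (is_derive1E (dQ x y)).
  apply: HK; rewrite (_ : x = la + (x - la)); last by ring.
  by rewrite (le_trans (ler_normD _ _))// lerD2l ler_norml; lra.
have D := derivable_under_integral measurableT laI intf der G0 IG bd.
have E := differentiation_under_integral measurableT laI intf der G0 IG bd.
have dI : is_derive la 1 (fun x => \int[leb]_t symm_quotient f x t)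
    (\int[leb]_t symm_quotient f' la t).
  have H := derivable_is_derive1 D; apply: (is_derive_eq H).
  rewrite E; apply: eq_Rintegral => t _.
  by rewrite /partial1of2 (is_derive1E (dQ la t)).
exact: is_derive1_scale.
Qed.

Lemma hilbert_lincomb (a b : R) f g la : smooth_decay 1 f -> smooth_decay 1 g ->
  hilbert (fun x => a * f x + b * g x) la = a * hilbert f la + b * hilbert g la.
Proof.
move=> sf sg; rewrite /hilbert.
have -> : \int[leb]_t symm_quotient (fun x => a * f x + b * g x) la t =
   \int[leb]_t (a * symm_quotient f la t + b * symm_quotient g la t).
  by apply: eq_Rintegral => t _; rewrite /symm_quotient; ring.
by rewrite Rintegral_lincomb ?integrable_symm_quotient//; ring.
Qed.

End HilbertTransform.

(** * The transform at a double zero *)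

Section IntegrationByParts.
Local Open Scope ring_scope.
Variable R : realType.
Local Notation leb := (@lebesgue_measure R).
Local Notation mR := (measurableTypeR R).
Implicit Types f g H : R -> R.

Lemma FTC2_interval H h (a b : R) : a < b ->
  (forall t : R, a <= t <= b -> is_derive t 1 H (h t)) ->
  (forall t, a <= t <= b -> {for t, continuous h}) ->
  \int[leb]_(t in `[a, b]) h t = H b - H a.
Proof.
move=> ab dH ch; rewrite /Rintegral (@continuous_FTC2 R h H a b)//.
- apply: continuous_in_subspaceT => t; rewrite inE /= in_itv /=; exact: ch.
- have cH t : a <= t <= b -> {for t, continuous H}.
    by move=> tab; exact: is_derive1_cont (dH t tab).
  split.
  + move=> t; rewrite in_itv /= => /andP[a1 b1]; apply: is_derive1_derivable.
    by apply: dH; rewrite !ltW.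
  + by apply: cvg_at_right_filter; apply: cH; rewrite lexx ltW.
  + by apply: cvg_at_left_filter; apply: cH; rewrite lexx ltW.
- move=> t; rewrite in_itv /= => /andP[a1 b1]; apply: is_derive1E.
  by apply: dH; rewrite !ltW.
Qed.

(** A derivative that is integrable on the line has integral zero when its
    primitive vanishes at the excluded point [0] and at infinity. *)
Lemma integral_derivative_eq0 H h (A : R) : leb.-integrable setT (EFin \o (h : mR -> R)) ->
  h 0 = 0 -> (forall t : R, t != 0 -> is_derive t 1 H (h t)) ->
  (forall t : R, t != 0 -> {for t, continuous h}) ->
  (forall t, `|H t| <= A * `|t|) -> (forall t, `|H t| <= A / `|t|) ->
  \int[leb]_t h t = 0.
Proof.
move=> Ih h0 dH ch H0 Hoo.
pose b n : R := n.+2%:R.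
have b1 n : 1 < b n by rewrite /b ltr1n.
have b0 n : 0 < b n by exact: lt_trans (b1 n).
have bi n : (b n)^-1 < b n by rewrite (lt_trans _ (b1 n))// invf_lt1.
pose P n : set mR := `[(b n)^-1, b n]%classic.
pose N n : set mR := `[- b n, - (b n)^-1]%classic.
have mP n : measurable (P n) by exact: measurable_itv.
have mN n : measurable (N n) by exact: measurable_itv.
have PN n : [disjoint P n & N n].
  apply/disj_setPS => t []; rewrite /P /N /= !in_itv /= => /andP[p1 _] /andP[_ p2].
  have i0 : 0 < (b n)^-1 by rewrite invr_gt0.
  have key (x y : R) : 0 < x -> x <= y -> y <= - x -> False by lra.
  exact: key i0 p1 p2.
have mPN n : measurable (P n `|` N n) by exact: measurableU.
have intE n : \int[leb]_(t in P n `|` N n) h t =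
    (H (b n) - H (b n)^-1) + (H (- (b n)^-1) - H (- b n)).
  rewrite Rintegral_setU//; last exact: integrableS Ih.
  have bi0 : 0 < (b n)^-1 by rewrite invr_gt0.
  congr (_ + _); apply: FTC2_interval => //; rewrite ?ltrN2//.
  - by move=> t /andP[t1 _]; apply: dH; rewrite gt_eqF// (lt_le_trans _ t1).
  - by move=> t /andP[t1 _]; apply: ch; rewrite gt_eqF// (lt_le_trans _ t1).
  - by move=> t /andP[_ t1]; apply: dH; rewrite lt_eqF// (le_lt_trans t1)// oppr_lt0.
  - by move=> t /andP[_ t1]; apply: ch; rewrite lt_eqF// (le_lt_trans t1)// oppr_lt0.
have A0 : 0 <= A by have := H0 1; rewrite normr1 mulr1; exact: le_trans.
have intb n : `|\int[leb]_(t in P n `|` N n) h t| <= 4 * A * (b n)^-1.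
  rewrite intE.
  have e1 := Hoo (b n); have e2 := Hoo (- b n).
  have e3 := H0 (b n)^-1; have e4 := H0 (- (b n)^-1).
  move: e1 e2 e3 e4; rewrite !normrN normfV (ger0_norm (ltW (b0 n))) => e1 e2 e3 e4.
  rewrite (_ : 4 * A / b n = A / b n + A / b n + (A / b n + A / b n)); last by ring.
  by rewrite (le_trans (ler_normD _ _))// lerD// (le_trans (ler_normB _ _))// lerD.
have binv : (b n)^-1 @[n --> \oo] --> (0 : R).
  have := @cvg_harmonic R; rewrite -(cvg_shiftS _).
  by apply: cvg_trans; apply: near_eq_cvg; exact: nearW.
have lim0 : \int[leb]_(t in P n `|` N n) h t @[n --> \oo] --> (0 : R).
  apply: norm_cvg0; apply: (@squeeze_cvgr _ _ _ _ (cst 0) (fun n => 4 * A * (b n)^-1)).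
  - by near=> n; rewrite normr_ge0 intb.
  - exact: cvg_cst.
  - by rewrite -[X in _ --> X](mulr0 (4 * A)); apply: cvgM => //; exact: cvg_cst.
have limh : \int[leb]_(t in P n `|` N n) h t @[n --> \oo] --> \int[leb]_t h t.
  apply: fine_cvg; rewrite fineK; last exact: integrable_fin_num.
  under eq_fun do rewrite integral_mkcond.
  apply: (@dominated_cvg _ _ _ leb setT measurableT _ _ (fun t => `|h t|%:E)) => //.
  - move=> n; apply/(measurable_restrictT _ (mPN n)).
    by apply: (measurable_funS measurableT) => //; exact: measurable_int Ih.
  - move=> t _; have [->|t0] := eqVneq t 0.
      rewrite h0; apply: cvg_near_cst; apply: nearW => n.
      by rewrite patchE; case: ifP; rewrite ?h0.
    have n0 : 0 < `|t| by rewrite normr_gt0.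
    have ni : 0 < `|t|^-1 by rewrite invr_gt0.
    apply: cvg_near_cst; near=> n; rewrite patchE ifT// inE.
    have s1 : (b n)^-1 < `|t| by near: n; exact: (cvgr_lt 0 binv).
    have s2 : (b n)^-1 < `|t|^-1 by near: n; exact: (cvgr_lt 0 binv).
    have {}s2 : `|t| < b n by rewrite -ltf_pV2 ?posrE.
    have [tp|tn] := leP 0 t.
      left; rewrite /P /= in_itv /=; move: s1 s2; rewrite ger0_norm//.
      have key (x y z : R) : x < y -> y < z -> x <= y <= z by move=> *; apply/andP; split; lra.
      exact: key.
    right; rewrite /N /= in_itv /=; move: s1 s2; rewrite ltr0_norm//.
    have key (x y z : R) : x < - y -> - y < z -> - z <= y <= - x.
      by move=> *; apply/andP; split; lra.
    exact: key.
  - exact: integrable_abse Ih.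
  - by move=> n t _; rewrite patchE; case: ifP => //= _; rewrite normr0 lee_fin.
by have := cvg_unique _ limh lim0; apply.
Unshelve. all: by end_near. Qed.

Lemma double_zero_bound f f' f'' (la M : R) : (forall x : R, is_derive x 1 f (f' x)) ->
  (forall x : R, is_derive x 1 f' (f'' x)) -> (forall x, `|f'' x| <= M) ->
  f la = 0 -> f' la = 0 -> forall t, `|f (la + t)| <= M * t ^+ 2.
Proof.
move=> df df' f''M f0 f'0 t.
have lt : la + t - la = t by ring.
have [c ct E] := @MVT_unordered R f f' la (la + t) (fun x _ => df x).
have [d dt E'] := @MVT_unordered R f' f'' la c (fun x _ => df' x).
rewrite lt in ct E; rewrite f0 subr0 in E; rewrite f'0 subr0 in E'.
rewrite E E' !normrM -mulrA -real_normK ?num_real// expr2.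
by apply: ler_pM => //; rewrite ?mulr_ge0// ler_wpM2r.
Qed.

(** The second-order vanishing at [la] controls the quotient for small [t], the
    decay of [f] for large [t]. *)
Lemma double_zero_quotient_bound f f' f'' (la : R) :
  (forall x : R, is_derive x 1 f (f' x)) -> (forall x : R, is_derive x 1 f' (f'' x)) ->
  smooth_decay 0 f -> smooth_decay 0 f'' -> f la = 0 -> f' la = 0 ->
  exists K, forall t, `|f (la + t) / t ^+ 2| <= K * decayw t.
Proof.
move=> df df' [_ [M fM] _] [_ [M2 fM2] _] f0 f'0.
have M0 := decayw_bound_ge0 fM; have M20 := decayw_bound_ge0 fM2.
have K0 : 0 <= M * (2 * (1 + `|la| ^+ 2)) by rewrite !mulr_ge0 ?addr_ge0 ?sqr_ge0.
have fb := double_zero_bound df df' (decayw_bound_le fM2) f0 f'0.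
exists (2 * M2 + M * (2 * (1 + `|la| ^+ 2))) => t.
have w0 := decayw_gt0 t; rewrite mulrDl.
have [->|t0] := eqVneq t 0.
  by rewrite expr0n /= invr0 mulr0 normr0 addr_ge0// mulr_ge0 ?mulr_ge0// ltW// decayw_gt0.
have t2 : 0 < t ^+ 2 by rewrite exprn_even_gt0.
rewrite normrM normfV (ger0_norm (ltW t2)).
have [t1|t1] := leP `|t| 1.
  rewrite (@le_trans _ _ M2)//; first by rewrite ler_pdivrMr.
  have := decayw_ge_half t1; have : 0 <= M * (2 * (1 + `|la| ^+ 2)) * decayw t.
    by rewrite mulr_ge0// ltW.
  by nra.
rewrite (@le_trans _ _ (M * (2 * (1 + `|la| ^+ 2)) * decayw t))//; last first.
  by rewrite lerDr mulr_ge0 ?mulr_ge0// ltW.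
rewrite ler_pdivrMr//; apply: (le_trans (decayw_bound_shift t fM (lexx _))).
apply: ler_peMr; first by rewrite mulr_ge0// ltW.
by rewrite -real_normK ?num_real// exprn_ege1// ltW.
Qed.

Lemma integrable_double_zero_quotient f f' f'' (la : R) :
  (forall x : R, is_derive x 1 f (f' x)) -> (forall x : R, is_derive x 1 f' (f'' x)) ->
  smooth_decay 0 f -> smooth_decay 0 f'' -> f la = 0 -> f' la = 0 ->
  [/\ leb.-integrable setT (EFin \o ((fun t => f (la + t) / t ^+ 2) : mR -> R)),
     leb.-integrable setT (EFin \o ((fun t => f (la - t) / t ^+ 2) : mR -> R)),
     leb.-integrable setT (EFin \o ((fun x => f x / (x - la) ^+ 2) : mR -> R)) &
     \int[leb]_x (f x / (x - la) ^+ 2) =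
       1/2 * \int[leb]_t ((f (la + t) + f (la - t)) / t ^+ 2)].
Proof.
move=> df df' sf sf'' f0 f'0.
have [K HK] := double_zero_quotient_bound df df' sf sf'' f0 f'0.
have [cf _ _] := sf.
pose g (x : mR) : R := f x / (x - la) ^+ 2.
have mg : measurable_fun setT g.
  apply: measurable_funM; first exact: continuous_measurable_fun.
  apply: (@measurableT_comp _ _ _ _ _ _ (fun y : R => y^-1)).
    exact: measurable_inv.
  apply: measurable_funX.
  by apply: measurable_funB; [exact: measurable_id|exact: measurable_cst].
have gp t : g (la + t) = f (la + t) / t ^+ 2.
  by rewrite /g (_ : la + t - la = t)//; ring.
have gm t : g (la - t) = f (la - t) / t ^+ 2.
  by rewrite /g (_ : la - t - la = - t) ?sqrrN//; ring.
have I1 : leb.-integrable setT (EFin \o (g \o (fun t => la + t))).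
  apply: integrable_decayw_bound; last by move=> t /=; rewrite gp; exact: HK.
  by apply: (measurableT_comp mg); exact: (preserves_lebesgue_shift la).1.
have I2 : leb.-integrable setT (EFin \o (g \o (fun t => la - t))).
  apply: integrable_decayw_bound; last first.
    by move=> t /=; rewrite gm; have := HK (- t); rewrite sqrrN decaywN; exact: id.
  by apply: (measurableT_comp mg); exact: (preserves_lebesgue_reflect la).1.
have [Ig E1] := preserves_lebesgue_integral (preserves_lebesgue_shift la) mg I1.
have [_ E2] := preserves_lebesgue_integral (preserves_lebesgue_reflect la) mg I2.
split=> //.
- by apply: eq_integrable I1 => // t _ /=; rewrite gp.
- by apply: eq_integrable I2 => // t _ /=; rewrite gm.
have -> : \int[leb]_x (f x / (x - la) ^+ 2) =
    1/2 * \int[leb]_x g x + 1/2 * \int[leb]_x g x by rewrite /g; lra.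
rewrite -{1}E1 -E2 -mulrDr; congr (_ * _).
rewrite -(RintegralD measurableT I1 I2); apply: eq_Rintegral => t _.
by rewrite /= gp gm; ring.
Qed.

(** Integration by parts. With [F t = f (la + t) + f (la - t)], the difference of
    the two integrands is the derivative of [F t / t], which vanishes at [0] because
    of the double zero, and at infinity. *)
Lemma hilbert_derivative_double_zero f f' f'' (la : R) :
  (forall x : R, is_derive x 1 f (f' x)) -> (forall x : R, is_derive x 1 f' (f'' x)) ->
  smooth_decay 0 f -> smooth_decay 1 f' -> smooth_decay 0 f'' ->
  f la = 0 -> f' la = 0 ->
  hilbert f' la = \int[leb]_x (f x / (x - la) ^+ 2).
Proof.
move=> df df' sf sf' sf'' f0 f'0.
have [I1 I2 _ ->] := integrable_double_zero_quotient df df' sf sf'' f0 f'0.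
have IQ := integrable_symm_quotient la sf'.
have [cf [M fM] _] := sf; have [_ [M2 fM2] _] := sf''.
have M0 := decayw_bound_ge0 fM; have M20 := decayw_bound_ge0 fM2.
have fb := double_zero_bound df df' (decayw_bound_le fM2) f0 f'0.
pose F (t : R) := f (la + t) + f (la - t).
pose H (t : R) := F t / t.
pose h (t : R) := symm_quotient f' la t - F t / t ^+ 2.
have IF : leb.-integrable setT (EFin \o ((fun t => F t / t ^+ 2) : mR -> R)).
  have := integrableD measurableT I1 I2; apply: eq_integrable => // t _ /=.
  by rewrite -EFinD /F mulrDl.
rewrite /hilbert; congr (_ * _); apply/eqP; rewrite -subr_eq0; apply/eqP.
rewrite -(RintegralB measurableT IQ IF).
have dp (t : R) : is_derive t 1 (fun s => la + s) 1.
  have := is_derive1_add (is_derive1_cst la t) (is_derive_id t 1).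
  by rewrite add0r.
have dm (t : R) : is_derive t 1 (fun s => la - s) (- 1).
  have := is_derive1_sub (is_derive1_cst la t) (is_derive_id t 1).
  by rewrite sub0r.
have dF (t : R) : is_derive t 1 F (f' (la + t) - f' (la - t)).
  have h1 := @is_derive1_comp R f (fun s => la + s) t _ _ (df _) (dp t).
  have h2 := @is_derive1_comp R f (fun s => la - s) t _ _ (df _) (dm t).
  have := is_derive1_add h1 h2; rewrite mulr1 mulrN1; exact.
apply: (@integral_derivative_eq0 H h (2 * M2 + 2 * M)).
- have := integrableB measurableT IQ IF; apply: eq_integrable => // t _ /=.
- by rewrite /h /symm_quotient expr0n /= invr0 !mulr0 subr0.
- move=> t t0; have := is_derive1_div t0 (dF t) (is_derive_id t 1).
  move=> D; apply: (is_derive_eq D).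
  by rewrite /h /symm_quotient; field.
- move=> t t0; have cid : {for t, continuous (fun x : R => x)} by exact: cvg_id.
  have cinv : {for t, continuous (fun x : R => x^-1)} by apply: cvgV.
  apply: (@cvgB _ _ _ (nbhs t) _ (symm_quotient f' la) (fun t => F t / t ^+ 2)).
    apply: (@cvgM _ _ (nbhs t) _ (fun t => f' (la + t) - f' (la - t)) (fun x => x^-1)) => //.
    have h1 := @is_derive1_comp R f' (fun s => la + s) t _ _ (df' _) (dp t).
    have h2 := @is_derive1_comp R f' (fun s => la - s) t _ _ (df' _) (dm t).
    exact: is_derive1_cont (is_derive1_sub h1 h2).
  apply: (@cvgM _ _ (nbhs t) _ F (fun x => (x ^+ 2)^-1)) => //.
    exact: is_derive1_cont (dF t).
  by apply: cvgV; [rewrite expf_neq0|exact: (cvgM cid cid)].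
- move=> t; rewrite /H normrM normfV; have [->|t0] := eqVneq t 0.
    by rewrite normr0 invr0 !mulr0.
  rewrite ler_pdivrMr ?normr_gt0// -mulrA -expr2 real_normK ?num_real//.
  have := fb t; have := fb (- t); rewrite sqrrN.
  have := ler_normD (f (la + t)) (f (la - t)); have := sqr_ge0 t.
  rewrite -/(F t); nra.
- move=> t; rewrite /H normrM normfV ler_wpM2r ?invr_ge0//.
  have := decayw_bound_le fM (la + t); have := decayw_bound_le fM (la - t).
  have := ler_normD (f (la + t)) (f (la - t)).
  rewrite -/(F t); nra.
Qed.

(** Differentiation commutes with the transform, and the derivative, being the
    transform of [f'], is itself differentiable. *)
Lemma hilbert_C1 f f' (la : R) : (forall x : R, is_derive x 1 f (f' x)) ->
  smooth_decay 1 f -> smooth_decay 2 f' ->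
  C1_at la (hilbert f) (hilbert f').
Proof.
move=> df sf sf'; split.
  have H (x : R) : is_derive x 1 (hilbert f) (hilbert f' x).
    by apply: hilbert_derive => //; exact: smooth_decayW.
  by near=> x; exact: H.
have [_ _ [f'' df' sf'']] := sf'.
exact: is_derive1_cont (@hilbert_derive R f' f'' la df' (smooth_decayW sf') sf'').
Unshelve. all: by end_near. Qed.

End IntegrationByParts.

(** * Fibres as functions of the spectral parameter *)

Section ComplexDerivative.
Local Open Scope ring_scope.
Variable R : realType.
Local Notation Re := complex.Re.
Local Notation Im := complex.Im.

Lemma is_derive_of_quotient (f : R -> R) (x a : R) :
  (f (x + t) - f x) / t @[t --> (0 : R)^'] --> a -> is_derive x 1 f a.
Proof.
move=> H; have H' : (fun h => h^-1 *: (f (h *: 1 + x) - f x)) @ (0 : R)^' --> a.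
  apply: cvg_trans H; apply: near_eq_cvg; apply: nearW => h.
  by rewrite -[h *: 1]/(h * 1) mulr1 (addrC h) -[_ *: _]/(_ * _) mulrC.
have D : derivable f x 1 by apply/cvg_ex; exists a; exact: H'.
apply: DeriveDef => //; exact: cvg_lim.
Qed.

Lemma real_complexV (t : R) : (t%:C)^-1 = (t^-1)%:C.
Proof. by rewrite fmorphV. Qed.

Lemma is_derive_complex (f : R -> R[i]) (x : R) (a : R[i]) :
  normc ((f (x + t) - f x) / t%:C - a) @[t --> (0 : R)^'] --> (0 : R) ->
  is_derive x 1 (fun y => Re (f y)) (Re a) /\ is_derive x 1 (fun y => Im (f y)) (Im a).
Proof.
move=> H; have sq (P : R[i] -> R) :
    (forall b c, P (b - c) = P b - P c) -> (forall b (t : R), P (b / t%:C) = P b / t) ->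
    (forall b, `|P b| <= normc b) -> is_derive x 1 (fun y => P (f y)) (P a).
  move=> PB PV Pn; apply: is_derive_of_quotient.
  apply/cvgrPdist_le => e e0; move/cvgrPdist_le : H => /(_ e e0).
  apply: filterS => t; rewrite sub0r normrN ger0_norm ?normc_ge0//.
  apply: le_trans; rewrite distrC; apply: le_trans (Pn _).
  by rewrite PB PV PB.
split; apply: sq => [b c|b t|b].
- by rewrite ReD ReN.
- by rewrite real_complexV mulrC ReZ mulrC.
- exact: Re_le_normc.
- by rewrite ImD ImN.
- by rewrite real_complexV mulrC ImZ mulrC.
- exact: Im_le_normc.
Qed.

End ComplexDerivative.

Section L2Fibres.
Local Open Scope ring_scope.
Variable R : realType.
Local Notation fn := (space3 R -> R[i]).
Local Notation sph := (sphere_measure R).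
Variables (c : nat -> R -> fn).
Hypothesis sc : smooth_fibres c.
Local Notation n k la := (L2norm sph (c k la)).

Lemma fibre_L2 k la : 0 <= la -> L2 sph (c k la).
Proof. by have [H _ _ _] := sc k; exact: H. Qed.

Lemma fibre_continuous_within k la : 0 <= la ->
  L2norm sph (fun w => c k (la + t) w - c k la w)
    @[t --> within [set t | 0 <= la + t] (0 : R)^'] --> (0 : R).
Proof.
move=> la0; have [_ /(_ la la0) H _ _] := sc k.
apply/cvgrPdist_le => e e0; move/cvgrPdist_le : H => /(_ 1 ltr01).
have d0 : 0 < e / (1 + n k.+1 la) by rewrite divr_gt0// ltr_wpDr ?L2norm_ge0.
have := dnbhs0_lt (V := R) d0; rewrite !near_withinE; apply: filterS2.
move=> t te H t0 lat; move: te => /(_ t0) te.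
have := H t0 lat; rewrite !sub0r !normrN !ger0_norm ?L2norm_ge0// => {}H.
have lt1 := fibre_L2 k lat; have lt2 := fibre_L2 k la0; have lt3 := fibre_L2 k.+1 la0.
pose q w := (c k (la + t) w - c k la w) / t%:C.
have lq : L2 sph q.
  rewrite /q; under eq_fun do rewrite mulrC.
  by apply: L2_scale; exact: L2_sub.
have qn : L2norm sph q <= 1 + n k.+1 la.
  by rewrite (le_trans (L2norm_sub_le lq lt3))// lerD2r.
have -> : (fun w => c k (la + t) w - c k la w) = (fun w => t%:C * q w).
  apply/funext => w; rewrite /q mulrC divfK//.
  by rewrite eq_complex /= negb_and t0.
rewrite L2norm_scale// normcR.
rewrite (@le_trans _ _ (`|t| * (1 + n k.+1 la)))// ?ler_wpM2l//.
by rewrite -ler_pdivlMr ?ltr_wpDr ?L2norm_ge0// ltW.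
Qed.

Lemma cvg_within_dnbhs (f : R -> R) (la l : R) : 0 < la ->
  f t @[t --> within [set t | 0 <= la + t] (0 : R)^'] --> l ->
  f t @[t --> (0 : R)^'] --> l.
Proof.
move=> la0 H; apply/cvgrPdist_le => e e0; move/cvgrPdist_le : H => /(_ e e0).
have := dnbhs0_lt (V := R) la0; rewrite !near_withinE; apply: filterS2 => t tla H t0.
move: tla => /(_ t0); rewrite ltr_norml => /andP[tla _].
by apply: H => //; rewrite /= ltW//; lra.
Qed.

Lemma cvg_within0_right (f : R -> R) (l : R) :
  f t @[t --> within [set t | 0 <= 0 + t] (0 : R)^'] --> l ->
  f t @[t --> (0 : R)^'+] --> l.
Proof.
move=> H; apply/cvgrPdist_le => e e0; move/cvgrPdist_le : H => /(_ e e0).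
rewrite !near_withinE; apply: filterS => t H t0.
by apply: H; [rewrite gt_eqF|rewrite /= add0r ltW].
Qed.

Lemma fibre_derivative k la : 0 < la ->
  L2norm sph (fun w => (c k (la + t) w - c k la w) / t%:C - c k.+1 la w)
    @[t --> (0 : R)^'] --> (0 : R).
Proof.
by move=> la0; have [_ /(_ la (ltW la0)) H _ _] := sc k; exact: cvg_within_dnbhs H.
Qed.

Lemma fibre_continuous k la : 0 < la ->
  L2norm sph (fun w => c k (la + t) w - c k la w) @[t --> (0 : R)^'] --> (0 : R).
Proof. by move=> la0; apply: (cvg_within_dnbhs la0); exact/fibre_continuous_within/ltW. Qed.

Lemma fibre_norm_continuous k la : 0 < la -> n k (la + t) @[t --> (0 : R)^'] --> n k la.
Proof.
move=> la0; apply/cvgrPdist_le => e e0.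
move/cvgrPdist_le : (fibre_continuous k la0) => /(_ e e0).
have := dnbhs0_lt (V := R) la0; apply: filterS2 => t.
rewrite ltr_norml => /andP[tla _]; rewrite sub0r normrN ger0_norm ?L2norm_ge0//.
apply: le_trans; rewrite distrC; apply: L2norm_dist; apply: fibre_L2; last exact: ltW.
by rewrite ltW//; lra.
Qed.

Lemma fibre_norm_right0 k : n k t @[t --> (0 : R)^'+] --> (0 : R).
Proof.
have [_ _ /(_ 0%N) H _] := sc k; apply: cvg_trans H; apply: near_eq_cvg.
by apply: nearW => t; rewrite expr0 invr1 mul1r.
Qed.

(** The fibres are continuous at [0] from the right and tend to zero there. *)
Lemma fibre_norm0 k : n k 0 = 0.
Proof.
have H := cvg_within0_right (fibre_continuous_within k (lexx 0)).
apply: (cvg_unique _ _ (fibre_norm_right0 k)) => //.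
apply/cvgrPdist_le => e e0; move/cvgrPdist_le : H => /(_ e e0).
have := nbhs_right_gt (0 : R); apply: filterS2 => t t0.
rewrite sub0r normrN ger0_norm ?L2norm_ge0// add0r.
by apply: le_trans; rewrite distrC; apply: L2norm_dist; apply: fibre_L2 => //; exact: ltW.
Qed.

(** Near [0] and at infinity by the prescribed decay, in between by continuity on
    a compact interval. *)
Lemma fibre_bound k : exists M, forall la, 0 <= la -> n k la <= M * decayw la.
Proof.
have [a a0 na] : exists2 a : R, 0 < a & forall x, 0 < x -> x < a -> n k x <= 1.
  move/cvgrPdist_le : (fibre_norm_right0 k) => /(_ 1 ltr01).
  rewrite near_withinE => /nbhs_ballP [a /= a0 H]; exists a => // x x0 xa.
  have := H x; rewrite /ball /= !sub0r !normrN (gtr0_norm x0) => /(_ xa x0).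
  by rewrite ger0_norm ?L2norm_ge0.
have [A nA] : exists A : R, forall x, A < x -> n k x * (1 + x ^+ 2) <= 1.
  have [_ _ _ H] := sc k; have := H 0%N; have := H 2%N.
  have h2 : 0 < 1 / 2 :> R by rewrite divr_gt0.
  move=> /cvgrPdist_le /(_ _ h2) [A1 [_ H1]] /cvgrPdist_le /(_ _ h2) [A2 [_ H2]].
  exists (Num.max A1 A2) => x; rewrite gt_max => /andP[/H1 B1 /H2 B2].
  have n0 : 0 <= n k x := L2norm_ge0 _ _.
  have n2 : 0 <= x ^+ 2 * n k x by rewrite mulr_ge0 ?sqr_ge0.
  move: B1 B2; rewrite !sub0r !normrN expr0 !mul1r (ger0_norm n0) (ger0_norm n2).
  lra.
pose b := a + `|A|.
have ab : a <= b by rewrite lerDl.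
have cn : {within `[a, b], continuous (fun x => n k x)}.
  apply: continuous_in_subspaceT => x; rewrite inE /= in_itv /= => /andP[ax _].
  apply/continuous_withinNshiftx; rewrite /comp /=.
  have := @fibre_norm_continuous k x (lt_le_trans a0 ax).
  by under eq_fun do rewrite addrC.
have [y _ ny] := EVT_max ab cn.
have m1 : 1 <= Num.max 1 (n k y) by rewrite le_max lexx.
have nb x : 0 <= x -> x <= b -> n k x <= Num.max 1 (n k y).
  rewrite le_eqVlt => /orP[/eqP<- _|x0 xb].
    by rewrite fibre_norm0 (le_trans ler01).
  have [xa|ax] := ltP x a; first by rewrite le_max (na x x0 xa).
  by rewrite le_max ny ?orbT// in_itv /= ax xb.
exists (Num.max 1 (n k y) * (1 + b ^+ 2)) => x x0.
rewrite /decayw ler_pdivlMr ?decayw_den//.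
have [xb|bx] := leP x b.
  apply: ler_pM => //; rewrite ?L2norm_ge0 ?addr_ge0 ?sqr_ge0 ?nb//.
  by rewrite lerD2l ler_sqr// nnegrE// (le_trans x0).
rewrite (le_trans (nA _ _))//.
  by rewrite (le_lt_trans (ler_norm A))// (le_lt_trans _ bx)// lerDr ltW.
by rewrite mulr_ege1// lerDl sqr_ge0.
Qed.

End L2Fibres.

(** * Smoothness and decay of spectral densities *)

Section SpectralDensity.
Local Open Scope ring_scope.
Variable R : realType.
Local Notation fn := (space3 R -> R[i]).
Local Notation sph := (sphere_measure R).
Local Notation Re := complex.Re.
Local Notation Im := complex.Im.
Variables (v w : nat -> R -> fn).
Hypothesis (sv : smooth_fibres v) (sw : smooth_fibres w).
Local Notation nv k la := (L2norm sph (v k la)).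
Local Notation nw k la := (L2norm sph (w k la)).
Local Notation rho k m := (spectral_density (v k) (w m)).

Lemma density_le k m la : 0 <= la -> normc (rho k m la) <= nv k la * nw m la.
Proof.
by move=> la0; rewrite /spectral_density la0; apply: cauchy_schwarz; exact: fibre_L2.
Qed.

Lemma density_le0 k m la : la <= 0 -> rho k m la = 0.
Proof.
rewrite le_eqVlt => /orP[/eqP->|la0]; last by rewrite /spectral_density leNgt la0.
apply/eq0_normc/le_anti; rewrite normc_ge0 andbT (le_trans (density_le _ _ (lexx 0)))//.
by rewrite fibre_norm0// mul0r.
Qed.

Lemma density_bound k m : exists M, forall la, normc (rho k m la) <= M * decayw la.
Proof.
have [M HM] := fibre_bound sv k; have [N HN] := fibre_bound sw m.
have N0 : 0 <= N.
  rewrite -(pmulr_lge0 _ (decayw_gt0 (0 : R))) (le_trans _ (HN 0 (lexx _)))//.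
  exact: L2norm_ge0.
have M0 : 0 <= M.
  rewrite -(pmulr_lge0 _ (decayw_gt0 (0 : R))) (le_trans _ (HM 0 (lexx _)))//.
  exact: L2norm_ge0.
exists (M * N) => la; have w0 := decayw_gt0 la; have [la0|la0] := leP 0 la; last first.
  rewrite (density_le0 _ _ (ltW la0)) normc_zero.
  by apply: mulr_ge0; [exact: mulr_ge0|exact: ltW].
rewrite (le_trans (density_le _ _ la0))//.
rewrite (@le_trans _ _ (M * decayw la * (N * 1)))//.
  apply: ler_pM; rewrite ?L2norm_ge0 ?HM// (le_trans (HN _ la0))//.
  by rewrite ler_wpM2l// decayw_le1.
by rewrite mulr1 mulrAC.
Qed.

(** The product rule for the inner product, in the form of an explicit bound on
    the error. *)
Lemma density_difference_pos k m la : 0 < la ->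
  normc ((rho k m (la + t) - rho k m la) / t%:C - (rho k.+1 m la + rho k m.+1 la))
    @[t --> (0 : R)^'] --> (0 : R).
Proof.
move=> la0; have la0' := ltW la0.
pose A t := L2norm sph (fun x => (v k (la + t) x - v k la x) / t%:C - v k.+1 la x).
pose B t := L2norm sph (fun x => (w m (la + t) x - w m la x) / t%:C - w m.+1 la x).
pose C t := L2norm sph (fun x => w m (la + t) x - w m la x).
have bnd : A t * nw m (la + t) + nv k.+1 la * C t + nv k la * B t @[t --> (0 : R)^']
    --> 0 * nw m la + nv k.+1 la * 0 + nv k la * 0.
  apply: cvgD; first apply: cvgD; apply: cvgM => //.
  - exact: fibre_derivative.
  - exact: fibre_norm_continuous.
  - exact: cvg_cst.
  - exact: fibre_continuous.
  - exact: cvg_cst.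
  - exact: fibre_derivative.
rewrite mul0r !mulr0 !addr0 in bnd.
apply: (squeeze_cvgr _ (cvg_cst _) bnd).
near=> t; rewrite normc_ge0 /=.
have t0 : t != 0 by near: t; exact: nbhs_dnbhs_neq.
have tla : `|t| < la by near: t; exact: dnbhs0_lt.
have lat : 0 <= la + t by move: tla; rewrite ltr_norml => /andP[? _]; rewrite ltW//; lra.
have tC : t%:C != 0 :> R[i] by rewrite eq_complex /= negb_and t0.
have l1 := fibre_L2 sv k lat; have l2 := fibre_L2 sv k la0'.
have l3 := fibre_L2 sv k.+1 la0'.
have l4 := fibre_L2 sw m lat; have l5 := fibre_L2 sw m la0'.
have l6 := fibre_L2 sw m.+1 la0'.
have lA : L2 sph (fun x => (v k (la + t) x - v k la x) / t%:C - v k.+1 la x).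
  apply: L2_sub => //; under eq_fun do rewrite mulrC.
  by apply: L2_scale; exact: L2_sub.
have lB : L2 sph (fun x => (w m (la + t) x - w m la x) / t%:C - w m.+1 la x).
  apply: L2_sub => //; under eq_fun do rewrite mulrC.
  by apply: L2_scale; exact: L2_sub.
rewrite /spectral_density lat la0'.
have iA : inner sph (fun x => (v k (la + t) x - v k la x) / t%:C - v k.+1 la x) (w m (la + t)) =
    (inner sph (v k (la + t)) (w m (la + t)) - inner sph (v k la) (w m (la + t))) / t%:C
    - inner sph (v k.+1 la) (w m (la + t)).
  under eq_fun do rewrite mulrC.
  rewrite inner_sub//; last by apply: L2_scale; exact: L2_sub.
  by rewrite inner_scale ?inner_sub//; [rewrite mulrC|exact: L2_sub].
have iB : inner sph (v k la) (fun x => (w m (la + t) x - w m la x) / t%:C - w m.+1 la x) =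
    (inner sph (v k la) (w m (la + t)) - inner sph (v k la) (w m la)) / t%:C
    - inner sph (v k la) (w m.+1 la).
  under eq_fun do rewrite mulrC.
  rewrite inner_subr//; last by apply: L2_scale; exact: L2_sub.
  rewrite inner_scaler ?inner_subr//; last exact: L2_sub.
  rewrite mulrC; congr (_ * _ - _).
  by rewrite real_complexV; apply: complex_ext; rewrite !ReImE /= ?oppr0.
rewrite (_ : _ - _ =
  inner sph (fun x => (v k (la + t) x - v k la x) / t%:C - v k.+1 la x) (w m (la + t)) +
  inner sph (v k.+1 la) (fun x => w m (la + t) x - w m la x) +
  inner sph (v k la) (fun x => (w m (la + t) x - w m la x) / t%:C - w m.+1 la x)); last first.
  by rewrite iA iB inner_subr//; field.
rewrite (le_trans (le_normcD _ _))// lerD//; last exact: cauchy_schwarz.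
rewrite (le_trans (le_normcD _ _))// lerD//; first exact: cauchy_schwarz.
by apply: cauchy_schwarz => //; exact: L2_sub.
Unshelve. all: by end_near. Qed.

(** The density vanishes on the negative half-line; at [0] rapid decay of the
    fibres makes the quotient tend to zero from the right as well. *)
Lemma density_difference k m la :
  normc ((rho k m (la + t) - rho k m la) / t%:C - (rho k.+1 m la + rho k m.+1 la))
    @[t --> (0 : R)^'] --> (0 : R).
Proof.
have [la0|la0|<-] := ltgtP 0 la; first exact: density_difference_pos.
  apply: cvg_near_cst; near=> t.
  have tla : `|t| < - la by near: t; apply: dnbhs0_lt; rewrite oppr_gt0.
  rewrite !density_le0 ?(ltW la0)//; last first.
    by move: tla; rewrite ltr_norml => /andP[_ ?]; rewrite ltW//; lra.
  by rewrite subrr mul0r addr0 subrr normc_zero.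
rewrite !(density_le0 _ _ (lexx 0)) addr0.
have [_ _ /(_ 1%N) Hv _] := sv k.
have Hw := fibre_norm_right0 sw m.
have Hvw : t ^- 1 * nv k t * nw m t @[t --> (0 : R)^'+] --> (0 : R).
  by rewrite -[X in _ --> X](mulr0 0); apply: cvgM.
apply/cvgrPdist_le => e e0; move/cvgrPdist_le : Hvw => /(_ e e0).
rewrite !near_withinE; apply: filterS => t H t0.
rewrite sub0r normrN subr0 subr0 add0r (ger0_norm (normc_ge0 _)).
have [tp|tn] := ltP 0 t; last first.
  by rewrite density_le0// mul0r normc_zero ltW.
have := H tp; rewrite sub0r normrN expr1 => {}H.
rewrite normcM real_complexV normcR; apply: le_trans (le_trans (ler_norm _) H).
rewrite mulrC (gtr0_norm (_ : 0 < t^-1)) ?invr_gt0// -mulrA.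
apply: ler_wpM2l; first by rewrite invr_ge0 ltW.
exact/density_le/ltW.
Unshelve. all: by end_near. Qed.

Lemma density_derive k m (la : R) :
  is_derive la 1 (fun y => Re (rho k m y)) (Re (rho k.+1 m la) + Re (rho k m.+1 la)) /\
  is_derive la 1 (fun y => Im (rho k m y)) (Im (rho k.+1 m la) + Im (rho k m.+1 la)).
Proof. by rewrite -ReD -ImD; exact: is_derive_complex (density_difference k m la). Qed.

Lemma smooth_decay_density n k m :
  smooth_decay n (fun la => Re (rho k m la)) /\ smooth_decay n (fun la => Im (rho k m la)).
Proof.
elim: n k m => [|n IHn] k m; have [M HM] := density_bound k m.
  split; split=> //.
  - by move=> x; exact: is_derive1_cont (density_derive k m x).1.
  - by exists M => x; exact: le_trans (Re_le_normc _) (HM x).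
  - by move=> x; exact: is_derive1_cont (density_derive k m x).2.
  - by exists M => x; exact: le_trans (Im_le_normc _) (HM x).
have [Re1 Im1] := IHn k.+1 m; have [Re2 Im2] := IHn k m.+1.
have smD f g : smooth_decay n f -> smooth_decay n g -> smooth_decay n (fun x => f x + g x :> R).
  by move=> sf sg; have := smooth_decay_lincomb 1 1 sf sg;
    under [X in smooth_decay _ X]eq_fun do rewrite !mul1r.
split; split=> //.
- by move=> x; exact: is_derive1_cont (density_derive k m x).1.
- by exists M => x; exact: le_trans (Re_le_normc _) (HM x).
- by eexists; [exact: (fun x => (density_derive k m x).1)|exact: smD].
- by move=> x; exact: is_derive1_cont (density_derive k m x).2.
- by exists M => x; exact: le_trans (Im_le_normc _) (HM x).
- by eexists; [exact: (fun x => (density_derive k m x).2)|exact: smD].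
Qed.

End SpectralDensity.

(** * Inner products as integrals of spectral densities *)

Section HalfLine.
Local Open Scope ring_scope.
Variable R : realType.
Local Notation mR := (measurableTypeR R).
Local Notation leb := (@lebesgue_measure R).
Local Notation half := (half_line R).

Lemma half_lineE (A : set mR) : half A = leb (A `&` `[0, +oo[).
Proof. by []. Qed.

Lemma half_line_sigma_finite : sigma_finite setT (half : set mR -> \bar R).
Proof.
have [F UF FE] := sigma_finiteT (leb : {sigma_finite_measure set mR -> \bar R}).
exists F => // n; have [mF Ff] := FE n; split=> //.
rewrite half_lineE (le_lt_trans _ Ff)// le_measure ?inE//.
by apply: measurableI => //; exact: measurable_itv.
Qed.

(** The half-line measure with its sigma-finiteness, which Fubini's theorem
    requires. *)
Definition half_line_sf : {sigma_finite_measure set mR -> \bar R} :=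
  HB.pack_for {sigma_finite_measure set mR -> \bar R} (Measure.sort half)
   (Measure_isSigmaFinite.Build _ _ _ half half_line_sigma_finite).

(** Spectral integrals live on the half-line, principal value integrals on the
    whole line; they meet because densities vanish on the negative axis. *)
Lemma half_line_integral (g : mR -> R) : leb.-integrable setT (EFin \o g) ->
  (forall x, x < 0 -> g x = 0) ->
  (\int[half]_x (g x)%:E = \int[leb]_x (g x)%:E)%E.
Proof.
move=> Ig g0.
have mN : measurable (`]-oo, 0[%classic : set mR) by exact: measurable_itv.
pose other : {measure set mR -> \bar R} := mrestr leb mN.
have addE (A : set mR) : measurable A -> measure_add half other A = leb A.
  move=> mA; rewrite measure_addE half_lineE -[other A]/(leb (A `&` `]-oo, 0[)).
  rewrite -measureU//; last 3 first.
  - by apply: measurableI => //; exact: measurable_itv.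
  - exact: measurableI.
  - apply/seteqP; split=> // x [[_] /=]; rewrite in_itv /= andbT => x0 [_] /=.
    by rewrite in_itv /= ltNge x0.
  rewrite -setIUr; congr (leb _); rewrite -[RHS]setIT; congr (_ `&` _).
  apply/seteqP; split=> // x _; rewrite /= !in_itv /= andbT.
  by have [?|?] := leP 0 x; [left|right].
have addI (f : mR -> \bar R) : (\int[measure_add half other]_x f x = \int[leb]_x f x)%E.
  by apply: (eq_measure_integral leb) => A mA _; exact: addE.
have mg : measurable_fun setT (EFin \o g) := measurable_int _ Ig.
have mag : measurable_fun setT (fun x : mR => `|(g x)%:E|%E) by exact: measurableT_comp mg.
have absE := @ge0_integral_measure_add _ _ _ half other setT measurableT
  (fun x => `|(g x)%:E|%E) (fun x _ => abse_ge0 _) mag.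
rewrite addI in absE.
have fin : (\int[half]_x `|(g x)%:E| + \int[other]_x `|(g x)%:E| < +oo)%E.
  by rewrite -absE; have /integrableP[] := Ig.
have I1 : half.-integrable setT (EFin \o g).
  apply/integrableP; split=> //; apply: le_lt_trans fin.
  by rewrite leeDl// integral_ge0.
have I2 : other.-integrable setT (EFin \o g).
  apply/integrableP; split=> //; apply: le_lt_trans fin.
  by rewrite leeDr// integral_ge0.
rewrite -[RHS]addI integral_measure_add// [X in (_ + X)%E](_ : _ = 0%E) ?adde0//.
rewrite (@ae_eq_integral _ _ _ other setT (cst 0%E))//; first exact: integral0.
exists `[0, +oo[%classic; split.
- exact: measurable_itv.
- rewrite -[LHS]/(leb (`[0, +oo[ `&` `]-oo, 0[)) (_ : _ `&` _ = set0) ?measure0//.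
  apply/seteqP; split=> // x [] /=; rewrite !in_itv /= andbT => x0.
  by rewrite ltNge x0.
- move=> x /= H; rewrite in_itv /= andbT leNgt; apply/negP => x0; apply: H => _.
  by rewrite /= g0.
Qed.

End HalfLine.

Section GramFormula.
Local Open Scope ring_scope.
Variable R : realType.
Local Notation fn := (space3 R -> R[i]).
Local Notation mR := (measurableTypeR R).
Local Notation leb := (@lebesgue_measure R).
Local Notation sph := (sphere_measure R).
Local Notation half := (half_line R).
Variables (T : fn -> mR * space3 R -> R[i]).
Hypothesis hT : spectral_representation T.
Variables (cv cw : nat -> R -> fn) (a : R) (p q : fn).
Hypothesis (sv : smooth_fibres cv) (sw : smooth_fibres cw).
Hypothesis (hp : is_Phi T cv a p) (hq : is_Phi T cw a q).

Let rho := spectral_density (cv 0%N) (cw 0%N).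

Definition gram_density (x : mR) : R[i] := rho x / ((x - a) ^+ 2)%:C.

Lemma gram_fibre : \forall x \ae half, \forall y \ae sph,
  T p (x, y) * (T q (x, y))^* =
    (cv 0%N x y * (cw 0%N x y)^*) * ((x - a) ^- 2)%:C.
Proof.
have [_ Hp] := hp; have [_ Hq] := hq.
have Ha : \forall x \ae half, x != a.
  exists [set a]; split; first exact: measurable_set1.
    apply/eqP; rewrite -measure_le0 -[leLHS]/(leb ([set a] `&` `[0, +oo[)).
    pose H : set mR := `[0, +oo[%classic.
    have sub : (leb ([set a] `&` H) <= leb [set a])%E.
      apply: le_measure; rewrite ?inE//; apply: measurableI => //.
      exact: measurable_itv.
    by rewrite lebesgue_measure_set1 in sub.
  by move=> x /= /negP; rewrite negbK => /eqP.
apply: filterS3 Hp Hq Ha => x Hp Hq xa; apply: filterS2 Hp Hq => y -> ->.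
rewrite (negbTE xa) real_complexV conjcM.
rewrite (_ : ((x - a)^-1)%:C^* = ((x - a)^-1)%:C); last first.
  by apply: complex_ext; rewrite !ReImE /= ?oppr0.
rewrite (_ : (x - a) ^- 2 = (x - a)^-1 * (x - a)^-1); last by rewrite -expr2 exprVn.
by rewrite rmorphM /=; ring.
Qed.

Variable (P : R[i] -> R).
Hypothesis PZ : forall (r : R) z, P (z * r%:C) = P z * r.
Hypothesis P0 : P 0 = 0.
Hypothesis Pint : forall d (X : measurableType d) (mu : {measure set X -> \bar R})
  (f : X -> R[i]), cintegrable mu f -> mu.-integrable setT (EFin \o (fun x => P (f x))).
Hypothesis Pinner : forall f g : fn, L2 sph f -> L2 sph g ->
  P (inner sph f g) = \int[sph]_y P (f y * (g y)^*).
Hypothesis int_density : leb.-integrable setT (EFin \o (fun x : mR => P (gram_density x))).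

(** Fubini's theorem is applied to real functions: [P] is the real or the imaginary
    part. *)
Lemma gram_formula_part :
  \int[spectral_measure R]_z P (T p z * (T q z)^*) =
  \int[leb]_x P (gram_density x).
Proof.
have [T2 _ _ _ _] := hT.
have lF := L2_cintegrable (T2 _ hp.1) (T2 _ hq.1).
pose F z := (P (T p z * (T q z)^*))%:E.
have IF : (half_line_sf R \x (sph : {finite_measure set _ -> \bar R}))%E.-integrable setT F.
  exact: (Pint lF).
have E1 := integral12_prod_meas1 IF.
have mF := measurable_fubini_F IF.
have aeI := ae_integrable1 IF.
have dE x : 0 <= x -> P (gram_density x) = P (rho x) * (x - a) ^- 2.
  by move=> x0; rewrite /gram_density real_complexV PZ.
have fibE : \forall x \ae half, fubini_F (sph : {finite_measure set _ -> \bar R}) F x =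
    (P (gram_density x))%:E.
  have pos : \forall x \ae half, 0 <= x.
    exists `]-oo, 0[%classic; split; first exact: measurable_itv.
      rewrite -[LHS]/(leb (`]-oo, 0[ `&` `[0, +oo[)) (_ : _ `&` _ = set0) ?measure0//.
      apply/seteqP; split=> // x [] /=; rewrite !in_itv /= andbT => x0.
      by rewrite leNgt x0.
    by move=> x /= /negP; rewrite -ltNge in_itv.
  apply: filterS3 gram_fibre pos aeI => x fx x0 Ix.
  have lv := fibre_L2 sv 0 x0; have lw := fibre_L2 sw 0 x0.
  have Iv := Pint (L2_cintegrable lv lw).
  have Ivs : sph.-integrable setT
      (EFin \o (fun y => P (cv 0%N x y * (cw 0%N x y)^*) * (x - a) ^- 2)).
    exact: (integrableZr measurableT ((x - a) ^- 2) Iv).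
  rewrite dE// /rho /spectral_density x0 Pinner//.
  rewrite -(RintegralZr _ _ Iv)// /Rintegral fineK; last exact: integrable_fin_num.
  rewrite /fubini_F; apply: ae_eq_integral => //.
  - exact: measurable_int Ix.
  - exact: measurable_int Ivs.
  - by apply: filterS fx => y fy _; rewrite /F fy PZ.
rewrite /Rintegral; congr fine.
transitivity (\int[half]_x fubini_F (sph : {finite_measure set _ -> \bar R}) F x)%E.
  by rewrite [RHS]E1.
transitivity (\int[half]_x (P (gram_density x))%:E)%E.
  apply: ae_eq_integral => //; first exact: measurable_int int_density.
  by apply: filterS fibE => x -> _.
apply: half_line_integral => // x x0.
by rewrite /gram_density /rho /spectral_density leNgt x0 mul0r P0.
Qed.

End GramFormula.

(** * Densities of fibres that vanish at a spectral parameter *)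

Section VanishingFibres.
Local Open Scope ring_scope.
Variable R : realType.
Local Notation fn := (space3 R -> R[i]).
Local Notation mR := (measurableTypeR R).
Local Notation leb := (@lebesgue_measure R).
Local Notation leb3 := (lebesgue3 R).
Local Notation sph := (sphere_measure R).
Local Notation Re := complex.Re.
Local Notation Im := complex.Im.

Lemma pv_transformE (f : R -> R[i]) la :
  smooth_decay 1 (fun x => Re (f x)) -> smooth_decay 1 (fun x => Im (f x)) ->
  pv_transform f la = hilbert (fun x => Re (f x)) la +i* hilbert (fun x => Im (f x)) la.
Proof. by move=> s1 s2; rewrite /pv_transform !principal_valueE. Qed.

Variables (cv cw : nat -> R -> fn) (a : R).
Hypothesis (sv : smooth_fibres cv) (sw : smooth_fibres cw) (a0 : 0 <= a).
Hypothesis (zv : \forall y \ae sph, cv 0%N a y = 0).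
Hypothesis (zw : \forall y \ae sph, cw 0%N a y = 0).
Local Notation rho k m := (spectral_density (cv k) (cw m)).

Lemma density_zero_left m : rho 0%N m a = 0.
Proof.
have lv := fibre_L2 sv 0 a0; have lw := fibre_L2 sw m a0.
rewrite /spectral_density a0 (ae_eq_inner lv (L2_0 sph) lw lw) ?inner0l//.
exact: nearW.
Qed.

Lemma density_zero_right k : rho k 0%N a = 0.
Proof.
have lv := fibre_L2 sv k a0; have lw := fibre_L2 sw 0 a0.
rewrite /spectral_density a0 (ae_eq_inner lv lv lw (L2_0 sph))//; last exact: nearW.
by rewrite (innerJ (L2_0 sph) lv) inner0l rmorph0.
Qed.

(** [f] is a real component of a spectral density whose two factors vanish at
    [a], and [g] the corresponding component of a Gram matrix entry. *)
Definition double_zero_at (f : R -> R) (g : R) := exists f' : R -> R,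
  [/\ C1_at a f f', f a = 0 /\ f' a = 0, C1_at a (hilbert f) (hilbert f') &
      hilbert f' a = g].

Lemma double_zero_density (P : R[i] -> R) :
  (forall z w, P (z + w) = P z + P w) -> P 0 = 0 ->
  (forall k m, smooth_decay 3 (fun x => P (rho k m x))) ->
  (forall k m la, is_derive (la : R) 1 (fun x => P (rho k m x))
     (P (rho k.+1 m la) + P (rho k m.+1 la))) ->
  leb.-integrable setT (EFin \o (fun x : mR => P (rho 0%N 0%N x) / (x - a) ^+ 2)) /\
  double_zero_at (fun x => P (rho 0%N 0%N x))
    (\int[leb]_x (P (rho 0%N 0%N x) / (x - a) ^+ 2)).
Proof.
move=> PD P0 sP dP.
pose f x := P (rho 0%N 0%N x).
pose f' x := P (rho 1%N 0%N x) + P (rho 0%N 1%N x).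
pose f'' x := P (rho 2%N 0%N x) + P (rho 1%N 1%N x) + (P (rho 1%N 1%N x) + P (rho 0%N 2%N x)).
have smD n g h : smooth_decay n g -> smooth_decay n h -> smooth_decay n (fun x => g x + h x :> R).
  by move=> sg sh; have := smooth_decay_lincomb 1 1 sg sh;
    under [X in smooth_decay _ X]eq_fun do rewrite !mul1r.
have df x : is_derive (x : R) 1 f (f' x) by exact: dP.
have df' x : is_derive (x : R) 1 f' (f'' x) by apply: is_derive1_add; exact: dP.
have sf : smooth_decay 3 f by exact: sP.
have sf' : smooth_decay 3 f' by apply: smD; exact: sP.
have sf'' : smooth_decay 3 f'' by apply: (smD); apply: (smD); exact: sP.
have f0 : f a = 0 by rewrite /f density_zero_left.
have f'0 : f' a = 0 by rewrite /f' density_zero_left density_zero_right P0 addr0.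
have le03 : (0 <= 3)%N by [].
have [_ _ I _] := integrable_double_zero_quotient df df' (smooth_decay_le le03 sf)
  (smooth_decay_le le03 sf'') f0 f'0.
split=> //; exists f'; split.
- split; first by near=> x; exact: df.
  exact: is_derive1_cont (df' a).
- by [].
- by apply: hilbert_C1 => //; [exact: (@smooth_decay_le R 1 3)|exact: (@smooth_decay_le R 2 3)].
- apply: hilbert_derivative_double_zero df df' _ _ _ f0 f'0.
  + exact: (smooth_decay_le le03 sf).
  + exact: (@smooth_decay_le R 1 3).
  + exact: (smooth_decay_le le03 sf'').
Unshelve. all: by end_near. Qed.

Lemma Re_double_zero :
  leb.-integrable setT (EFin \o (fun x : mR => Re (rho 0%N 0%N x) / (x - a) ^+ 2)) /\
  double_zero_at (fun x => Re (rho 0%N 0%N x))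
    (\int[leb]_x (Re (rho 0%N 0%N x) / (x - a) ^+ 2)).
Proof.
apply: double_zero_density => //; first exact: ReD.
- by move=> k m; exact: (smooth_decay_density sv sw 3 k m).1.
- by move=> k m la; exact: (density_derive sv sw k m la).1.
Qed.

Lemma Im_double_zero :
  leb.-integrable setT (EFin \o (fun x : mR => Im (rho 0%N 0%N x) / (x - a) ^+ 2)) /\
  double_zero_at (fun x => Im (rho 0%N 0%N x))
    (\int[leb]_x (Im (rho 0%N 0%N x) / (x - a) ^+ 2)).
Proof.
apply: double_zero_density => //; first exact: ImD.
- by move=> k m; exact: (smooth_decay_density sv sw 3 k m).2.
- by move=> k m la; exact: (density_derive sv sw k m la).2.
Qed.

Variables (T : fn -> mR * space3 R -> R[i]) (p q : fn).
Hypothesis hT : spectral_representation T.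
Hypothesis (hp : is_Phi T cv a p) (hq : is_Phi T cw a q).

Lemma Re_gram_density x : Re (gram_density cv cw a x) = Re (rho 0%N 0%N x) / (x - a) ^+ 2.
Proof. by rewrite /gram_density real_complexV mulrC ReZ mulrC. Qed.

Lemma Im_gram_density x : Im (gram_density cv cw a x) = Im (rho 0%N 0%N x) / (x - a) ^+ 2.
Proof. by rewrite /gram_density real_complexV mulrC ImZ mulrC. Qed.

Lemma cintegrable_gram_density : cintegrable leb (gram_density cv cw a).
Proof.
split; [have := Re_double_zero.1|have := Im_double_zero.1];
  by apply: eq_integrable => // x _ /=; rewrite ?Re_gram_density ?Im_gram_density.
Qed.

(** Unitarity of the spectral representation turns [<p, q>] into an integral
    over the half-line times the sphere, to which Fubini's theorem applies. *)
Lemma gram_formula : inner leb3 p q = cintegral leb setT (gram_density cv cw a).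
Proof.
have [_ _ unitary _ _] := hT; rewrite -(unitary _ _ hp.1 hq.1).
have [i1 i2] := cintegrable_gram_density.
rewrite /inner /cintegral; congr (_ +i* _).
- apply: (gram_formula_part hT sv sw hp hq _ _ _ _ i1) => //.
  + by move=> r z; rewrite mulrC ReZ mulrC.
  + by move=> d X mu f [].
- apply: (gram_formula_part hT sv sw hp hq _ _ _ _ i2) => //.
  + by move=> r z; rewrite mulrC ImZ mulrC.
  + by move=> d X mu f [].
Qed.

Lemma Re_double_zero_gram :
  double_zero_at (fun x => Re (rho 0%N 0%N x)) (Re (inner leb3 p q)).
Proof.
rewrite gram_formula /cintegral /=.
under eq_Rintegral do rewrite Re_gram_density.
exact: Re_double_zero.2.
Qed.

Lemma Im_double_zero_gram :
  double_zero_at (fun x => Im (rho 0%N 0%N x)) (Im (inner leb3 p q)).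
Proof.
rewrite gram_formula /cintegral /=.
under eq_Rintegral do rewrite Im_gram_density.
exact: Im_double_zero.2.
Qed.

End VanishingFibres.

(** * Definiteness of the Gram matrix *)

Section ComplexIntegralSums.
Local Open Scope ring_scope.
Context d (X : measurableType d) (R : realType).
Variable mu : {measure set X -> \bar R}.
Implicit Types f : X -> R[i].

Lemma cintegrable_lincomb (a : R[i]) f g : cintegrable mu f -> cintegrable mu g ->
  cintegrable mu (fun x => a * f x + g x).
Proof.
move=> [f1 f2] [g1 g2].
have i1 := integrable_lincomb (complex.Re a) (- complex.Im a) f1 f2.
have i2 := integrable_lincomb (complex.Re a) (complex.Im a) f2 f1.
split.
  apply: eq_integrable (integrable_lincomb 1 1 i1 g1) => // x _ /=.
  by rewrite ReD ReM !mul1r mulNr.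
apply: eq_integrable (integrable_lincomb 1 1 i2 g2) => // x _ /=.
by rewrite ImD ImM !mul1r.
Qed.

Lemma cintegral0 : cintegral mu setT (fun=> 0 : R[i]) = 0.
Proof. by rewrite /cintegral /= /Rintegral integral0. Qed.

Lemma cintegral_sum n (c : 'I_n -> R[i]) (F : 'I_n -> X -> R[i]) :
  (forall i, cintegrable mu (F i)) ->
  cintegrable mu (fun x => \sum_i c i * F i x) /\
  cintegral mu setT (fun x => \sum_i c i * F i x) = \sum_i c i * cintegral mu setT (F i).
Proof.
elim: n c F => [|n IHn] c F iF.
  rewrite big_ord0; under [X in cintegral _ _ X]eq_fun do rewrite big_ord0.
  rewrite cintegral0; split=> //.
  by split; apply: eq_integrable (integrable0 mu setT) => // x _ /=; rewrite big_ord0.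
have [I E] := IHn (fun i => c (lift ord0 i)) (fun i => F (lift ord0 i)) (fun i => iF _).
have eF : (fun x => \sum_(i < n.+1) c i * F i x) =
    (fun x => c ord0 * F ord0 x + \sum_(i < n) c (lift ord0 i) * F (lift ord0 i) x).
  by apply/funext => x; rewrite big_ord_recl.
rewrite eF; split; first exact: cintegrable_lincomb.
by rewrite cintegralE_lincomb// E big_ord_recl.
Qed.

End ComplexIntegralSums.

Section Positivity.
Local Open Scope ring_scope.
Variable R : realType.
Local Notation mR := (measurableTypeR R).
Local Notation leb := (@lebesgue_measure R).

Lemma continuous_ae0 (f : R -> R) : continuous f ->
  (\forall x \ae leb, f x = 0) -> forall x, f x = 0.
Proof.
move=> cf [N [mN N0 fN]] x; apply/eqP/negPn/negP => fx0.
have fx1 : 0 < `|f x| by rewrite normr_gt0.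
have /nbhs_ballP [r /= r0 H] : \forall y \near x, f y != 0.
  move/cvgrPdist_lt : (cf x) => /(_ _ fx1); apply: filterS => y.
  by apply: contraTneq => ->; rewrite subr0 ltxx.
pose J : set mR := `]x - r, x + r[%classic.
have JN : J `<=` N.
  move=> y; rewrite /J /= in_itv /= => yJ; apply: fN => /= fy0.
  have : f y != 0 by apply: H; rewrite /ball /= distrC ltr_distl.
  by rewrite fy0 eqxx.
have : (leb J <= leb N)%E by apply: le_measure; rewrite ?inE//; exact: measurable_itv.
rewrite N0 /J lebesgue_measure_itv /= lte_fin ifT; last by lra.
by rewrite -EFinB lee_fin; lra.
Qed.

(** The integrand is nonnegative, hence zero almost everywhere; its numerator
    is then zero almost everywhere, and everywhere by continuity. *)
Lemma integral_quotient_eq0 (f : R -> R) (a : R) : continuous f -> (forall x, 0 <= f x) ->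
  leb.-integrable setT (EFin \o (fun x : mR => f x / (x - a) ^+ 2)) ->
  \int[leb]_x (f x / (x - a) ^+ 2) = 0 -> f a = 0 -> forall x, f x = 0.
Proof.
move=> cf f0 If int0 fa; apply: (continuous_ae0 cf).
have q0 (x : mR) : 0 <= f x / (x - a) ^+ 2 by rewrite mulr_ge0 ?invr_ge0 ?sqr_ge0.
have : (\int[leb]_x `|(f x / (x - a) ^+ 2)%:E| = 0)%E.
  transitivity (\int[leb]_x (f x / (x - a) ^+ 2)%:E)%E.
    by apply: eq_integral => x _; rewrite gee0_abs// lee_fin.
  move: int0; rewrite /Rintegral => /(congr1 (@EFin R)).
  by rewrite fineK//; exact: integrable_fin_num.
have mq := measurable_int _ If.
move=> /(ae_eq_integral_abs leb measurableT mq).1 [N [mN N0 HN]].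
exists N; split=> // x /= fx; apply: HN => /= /(_ I) [] /eqP.
rewrite mulf_eq0 invr_eq0 expf_eq0 /= subr_eq0 => /orP[/eqP //|/eqP xa].
by apply: fx; rewrite xa.
Qed.

End Positivity.

Section GramPositivity.
Local Open Scope ring_scope.
Variable R : realType.
Local Notation fn := (space3 R -> R[i]).
Local Notation mR := (measurableTypeR R).
Local Notation leb := (@lebesgue_measure R).
Local Notation leb3 := (lebesgue3 R).
Local Notation sph := (sphere_measure R).
Local Notation Re := complex.Re.
Local Notation Im := complex.Im.

Lemma pv_transform_lincomb (a : R[i]) (f g : R -> R[i]) la :
  smooth_decay 1 (fun x => Re (f x)) -> smooth_decay 1 (fun x => Im (f x)) ->
  smooth_decay 1 (fun x => Re (g x)) -> smooth_decay 1 (fun x => Im (g x)) ->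
  [/\ smooth_decay 1 (fun x => Re (a * f x + g x)),
     smooth_decay 1 (fun x => Im (a * f x + g x)) &
     pv_transform (fun x => a * f x + g x) la =
     a * pv_transform f la + pv_transform g la].
Proof.
move=> f1 f2 g1 g2.
have s1 := smooth_decay_lincomb (Re a) (- Im a) f1 f2.
have s2 := smooth_decay_lincomb (Re a) (Im a) f2 f1.
have eR : (fun x => Re (a * f x + g x)) =
    (fun x => 1 * (Re a * Re (f x) + - Im a * Im (f x)) + 1 * Re (g x)).
  by apply/funext => x; rewrite ReD ReM !mul1r mulNr.
have eI : (fun x => Im (a * f x + g x)) =
    (fun x => 1 * (Re a * Im (f x) + Im a * Re (f x)) + 1 * Im (g x)).
  by apply/funext => x; rewrite ImD ImM !mul1r.
have t1 := smooth_decay_lincomb 1 1 s1 g1.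
have t2 := smooth_decay_lincomb 1 1 s2 g2.
have t1' : smooth_decay 1 (fun x => Re (a * f x + g x)) by rewrite eR.
have t2' : smooth_decay 1 (fun x => Im (a * f x + g x)) by rewrite eI.
split=> //.
rewrite !pv_transformE// eR eI !(hilbert_lincomb _ _ _ s1 g1) !(hilbert_lincomb _ _ _ s2 g2).
rewrite !(hilbert_lincomb _ _ _ f1 f2) !(hilbert_lincomb _ _ _ f2 f1).
by apply: complex_ext; rewrite !ReImE /=; ring.
Qed.

Lemma smooth_decay0 k : smooth_decay k (fun=> 0 : R).
Proof.
have c0 : continuous (fun _ : R => 0 : R) by move=> x; exact: cvg_cst.
have b0 : exists M, forall x : R, `|0 : R| <= M * decayw x.
  by exists 0 => x; rewrite normr0 mul0r.
elim: k => [|k IHk]; split=> //.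
by exists (fun=> 0) => // x; exact: is_derive1_cst.
Qed.

Lemma pv_transform0 la : pv_transform (fun=> 0 : R[i]) la = 0 :> R[i].
Proof.
have sd0 := smooth_decay0 1.
rewrite pv_transformE//; have h0 : hilbert (fun _ : R => 0) la = 0.
  have e0 : (fun _ : R => 0 : R) = (fun x => 0 * (fun=> 0) x + 0 * (fun=> 0) x).
    by apply/funext => x; rewrite !mul0r addr0.
  by rewrite e0 (hilbert_lincomb 0 0 la sd0 sd0) !mul0r addr0.
by rewrite /= h0.
Qed.

Lemma pv_transform_sum n (c : 'I_n -> R[i]) (F : 'I_n -> R -> R[i]) la :
  (forall i, smooth_decay 1 (fun x => Re (F i x)) /\ smooth_decay 1 (fun x => Im (F i x))) ->
  [/\ smooth_decay 1 (fun x => Re (\sum_i c i * F i x)),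
     smooth_decay 1 (fun x => Im (\sum_i c i * F i x)) &
     pv_transform (fun x => \sum_i c i * F i x) la = \sum_i c i * pv_transform (F i) la].
Proof.
elim: n c F => [|n IHn] c F sF.
  have -> : (fun x : R => \sum_(i < 0) c i * F i x) = (fun=> 0).
    by apply/funext => x; rewrite big_ord0.
  under [fun x => Re _]eq_fun do rewrite big_ord0.
  under [fun x => Im _]eq_fun do rewrite big_ord0.
  rewrite pv_transform0 big_ord0.
  by split=> //; exact: smooth_decay0.
have [I1 I2 E] := IHn (fun i => c (lift ord0 i)) (fun i => F (lift ord0 i)) (fun i => sF _).
have eF : (fun x => \sum_(i < n.+1) c i * F i x) =
    (fun x => c ord0 * F ord0 x + \sum_(i < n) c (lift ord0 i) * F (lift ord0 i) x).
  by apply/funext => x; rewrite big_ord_recl.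
have [s1 s2] := sF ord0.
have [J1 J2 J3] := pv_transform_lincomb (c ord0) la s1 s2 I1 I2.
rewrite big_ord_recl -E -J3 -eF; split=> //.
- by under eq_fun do rewrite big_ord_recl.
- by under eq_fun do rewrite big_ord_recl.
Qed.

Variables (T : fn -> mR * space3 R -> R[i]) (n : nat).
Variables (uf : 'I_n -> nat -> R -> fn) (phi : 'I_n -> fn) (al0 la0 : R).
Hypothesis hT : spectral_representation T.
Hypothesis suf : forall j, smooth_fibres (uf j).
Hypothesis la0_ge0 : 0 <= la0.
Hypothesis zuf : forall j, \forall y \ae sph, uf j 0%N la0 y = 0.
Hypothesis hphi : forall j, is_Phi T (uf j) la0 (phi j).
Hypothesis hb : forall j k, (j == k)%:R + al0%:C *
  pv_transform (spectral_density (uf j 0%N) (uf k 0%N)) la0 = 0.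

(** If [\sum_j a j phi j] has norm [0], then so have the combinations
    [\sum_j a j u_j] of fibres, which are continuous in the spectral parameter;
    pairing with [u_k] and applying the principal value transform, the
    condition [hb] turns [\sum_j a j delta_jk] into [0]. *)
Lemma gram_definite (a : 'I_n -> R[i]) :
  \sum_j a j * \sum_k (a k)^* * inner leb3 (phi j) (phi k) = 0 -> forall k, a k = 0.
Proof.
pose rho j k := spectral_density (uf j 0%N) (uf k 0%N).
pose E j k := gram_density (uf j) (uf k) la0.
pose q x := \sum_j a j * \sum_k (a k)^* * rho j k x.
pose P x := Re (q x).
have iE j k : cintegrable leb (E j k).
  exact: cintegrable_gram_density (suf j) (suf k) la0_ge0 (zuf j) (zuf k).
have iS j := cintegral_sum (fun k => (a k)^*) (iE j).
have [iQ qE] := cintegral_sum a (fun j => (iS j).1).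
have -> : \sum_j a j * (\sum_k (a k)^* * inner leb3 (phi j) (phi k)) =
    cintegral leb setT (fun x => \sum_j a j * \sum_k (a k)^* * E j k x).
  rewrite qE; apply: eq_bigr => j _; rewrite (iS j).2; congr (_ * _).
  apply: eq_bigr => k _; congr (_ * _).
  by rewrite (gram_formula (suf j) (suf k) la0_ge0 (zuf j) (zuf k) hT (hphi j) (hphi k)).
have QE x : Re (\sum_j a j * \sum_k (a k)^* * E j k x) = P x / (x - la0) ^+ 2.
  rewrite /P /q mulrC -ReZ mulr_sumr; congr complex.Re; apply: eq_bigr => j _.
  rewrite mulrCA; congr (_ * _); rewrite mulr_sumr; apply: eq_bigr => k _.
  by rewrite /E /gram_density real_complexV mulrA mulrC.
have psiE x : 0 <= x -> q x =
    (L2norm sph (fun y => \sum_j a j * uf j 0%N x y) ^+ 2)%:C.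
  move=> x0; have lu j := fibre_L2 (suf j) 0 x0.
  have lpsi := L2_sum a lu.
  rewrite -inner_self inner_sum//; apply: eq_bigr => j _; congr (_ * _).
  by rewrite inner_sumr//; apply: eq_bigr => k _; rewrite /rho /spectral_density x0.
have qneg x : x < 0 -> q x = 0.
  move=> x0; rewrite /q big1// => j _; rewrite big1 ?mulr0// => k _.
  by rewrite /rho /spectral_density leNgt x0 mulr0.
have srho j k : smooth_decay 1 (fun x => Re (rho j k x)) /\
    smooth_decay 1 (fun x => Im (rho j k x)).
  exact: smooth_decay_density (suf j) (suf k) 1 0 0.
have cP : continuous P.
  have sj j : smooth_decay 1 (fun x => Re (\sum_k (a k)^* * rho j k x)) /\
      smooth_decay 1 (fun x => Im (\sum_k (a k)^* * rho j k x)).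
    by have [s1 s2 _] := pv_transform_sum (fun k => (a k)^*) la0 (srho j).
  by have [[]] := pv_transform_sum a la0 sj.
have P0 x : 0 <= P x.
  rewrite /P; have [x0|x0] := leP 0 x; last by rewrite qneg.
  by rewrite psiE//= sqr_ge0.
have Pla : P la0 = 0.
  rewrite /P /q big1// => j _; rewrite big1 ?mulr0// => k _.
  by rewrite /rho (density_zero_left (suf j) (suf k) la0_ge0 (zuf j) 0) mulr0.
move=> Q0; have PE x : P x = 0.
  apply: (integral_quotient_eq0 cP P0 _ _ Pla).
    by apply: eq_integrable iQ.1 => // y _ /=; rewrite QE.
  under eq_Rintegral do rewrite -QE.
  exact: (congr1 (@complex.Re R) Q0).
have ak0 k x : \sum_j a j * rho j k x = 0.
  have [x0|x0] := leP 0 x; last first.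
    by rewrite big1// => j _; rewrite /rho /spectral_density leNgt x0 mulr0.
  have lu j := fibre_L2 (suf j) 0 x0; have lpsi := L2_sum a lu.
  have n0 : L2norm sph (fun y => \sum_j a j * uf j 0%N x y) = 0.
    by apply/eqP; rewrite -sqrf_eq0; have := PE x; rewrite /P psiE//= => ->.
  transitivity (inner sph (fun y => \sum_j a j * uf j 0%N x y) (uf k 0%N x)).
    by rewrite inner_sum//; apply: eq_bigr => j _; rewrite /rho /spectral_density x0.
  apply/eq0_normc/le_anti; rewrite normc_ge0 andbT.
  by rewrite (le_trans (cauchy_schwarz lpsi (lu k)))// n0 mul0r.
move=> k; have [_ _ pvE] := pv_transform_sum a la0 (fun j => srho j k).
have pv0 : \sum_j a j * pv_transform (rho j k) la0 = 0.
  have q0 : (fun x => \sum_j a j * rho j k x) = (fun=> 0) by apply/funext => x; exact: ak0.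
  by rewrite -pvE q0 pv_transform0.
have : \sum_j a j * ((j == k)%:R + al0%:C * pv_transform (rho j k) la0) = 0.
  by rewrite big1// => j _; rewrite hb mulr0.
under eq_bigr do rewrite mulrDr mulrCA.
rewrite big_split /= -mulr_sumr pv0 mulr0 addr0 (bigD1 k)//= eqxx mulr1.
by rewrite big1 ?addr0// => j /negbTE ->; rewrite mulr0.
Qed.

End GramPositivity.

(** * Entries of the two by two matrices *)

Section TwoByTwo.
Local Open Scope ring_scope.

Lemma ord2P (j : 'I_2) : j = ord0 \/ j = ord_max.
Proof. by case: j => [[|[|//]] i]; [left|right]; exact: val_inj. Qed.

Lemma sum_ord2 (V : zmodType) (F : 'I_2 -> V) : \sum_j F j = F ord0 + F ord_max.
Proof.
by rewrite !big_ord_recl big_ord0 addr0; congr (_ + F _); exact: val_inj.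
Qed.

Variable K : comNzRingType.
Implicit Type A : 'M[K]_2.

Lemma cofactor_ord0 A : cofactor A ord0 ord0 = A ord_max ord_max.
Proof.
rewrite /cofactor expr0 mul1r [row' _ _]mx11_scalar det_scalar1 !mxE.
by congr (A _ _); exact: val_inj.
Qed.

Lemma cofactor_ord_max A : cofactor A ord_max ord_max = A ord0 ord0.
Proof.
rewrite /cofactor /= -signr_odd expr0 mul1r [row' _ _]mx11_scalar det_scalar1 !mxE.
by congr (A _ _); exact: val_inj.
Qed.

Lemma det2 A : \det A = A ord0 ord0 * A ord_max ord_max - A ord0 ord_max * A ord_max ord0.
Proof.
rewrite (expand_det_row _ ord0) sum_ord2 cofactor_ord0 -mulrN; congr (_ + _ * _).
rewrite /cofactor /= expr1 mulN1r [row' _ _]mx11_scalar det_scalar1 !mxE.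
by congr (- A _ _); exact: val_inj.
Qed.

End TwoByTwo.

Section HermitianEntries.
Local Open Scope ring_scope.
Variable R : realType.
Local Notation fn := (space3 R -> R[i]).
Local Notation Re := complex.Re.
Local Notation Im := complex.Im.

Lemma pv_transform_conj (f : R -> R[i]) la :
  smooth_decay 1 (fun x => Re (f x)) -> smooth_decay 1 (fun x => Im (f x)) ->
  pv_transform (fun x => (f x)^*) la = (pv_transform f la)^*.
Proof.
move=> s1 s2.
have eR : (fun x => Re ((f x)^*)) = (fun x => Re (f x)).
  by apply/funext => x; rewrite ReJ.
have eI : (fun x => Im ((f x)^*)) = (fun x => (-1) * Im (f x) + 0 * Im (f x)).
  by apply/funext => x; rewrite ImJ mul0r addr0 mulN1r.
rewrite /pv_transform eR eI !principal_valueE//; last exact: smooth_decay_lincomb.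
rewrite hilbert_lincomb// mul0r addr0 mulN1r.
by apply: complex_ext; rewrite !ReImE.
Qed.

Variable (uf : 'I_2 -> nat -> R -> fn).
Hypothesis suf : forall j, smooth_fibres (uf j).
Local Notation u := (fun k => uf k 0%N).
Local Notation eta j k := (spectral_density (uf j 0%N) (uf k 0%N)).

Lemma density_conj j k x : eta k j x = (eta j k x)^*.
Proof.
rewrite /spectral_density; case: ifP => x0; last by rewrite rmorph0.
by rewrite -innerJ//; exact: fibre_L2.
Qed.

Lemma density_diag_real j x : Im (eta j j x) = 0.
Proof. by have := congr1 (@complex.Im R) (density_conj j j x); rewrite ImJ; lra. Qed.

(** The densities [eta_jk] and [eta_kj] are conjugate, and the
    kernel of the transform is real. *)
Lemma pv_density_conj j k la : pv_transform (eta k j) la = (pv_transform (eta j k) la)^*.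
Proof.
have [s1 s2] := smooth_decay_density (suf j) (suf k) 1 0 0.
have eC : eta k j = (fun x => (eta j k x)^*) by apply/funext => x; exact: density_conj.
by rewrite eC pv_transform_conj.
Qed.

Lemma C_matrix_hermitian al la j k : C_matrix u al la j k = (C_matrix u al la k j)^*.
Proof.
rewrite !mxE pv_density_conj eq_sym rmorphD rmorphM /= rmorph_nat; congr (_ + _ * _).
by apply: complex_ext; rewrite !ReImE /= ?oppr0.
Qed.

Local Notation g1 := (hilbert (fun x => Re (eta ord0 ord0 x))).
Local Notation g2 := (hilbert (fun x => Re (eta ord_max ord_max x))).
Local Notation gr := (hilbert (fun x => Re (eta ord_max ord0 x))).
Local Notation gi := (hilbert (fun x => Im (eta ord_max ord0 x))).

Lemma pv_densityE j k la : pv_transform (eta j k) la =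
  hilbert (fun x => Re (eta j k x)) la +i* hilbert (fun x => Im (eta j k x)) la.
Proof.
by apply: pv_transformE; have [] := smooth_decay_density (suf j) (suf k) 1 0 0.
Qed.

Lemma pv_density_diag j la :
  pv_transform (eta j j) la = (hilbert (fun x => Re (eta j j x)) la)%:C.
Proof.
have := congr1 (@complex.Im R) (pv_density_conj j j la); rewrite ImJ pv_densityE /= => H.
by congr (_ +i* _); lra.
Qed.

Lemma C_entries al la :
  [/\ C_matrix u al la ord0 ord0 = (1 + al * g1 la)%:C,
      C_matrix u al la ord_max ord_max = (1 + al * g2 la)%:C,
      C_matrix u al la ord0 ord_max = (0 + al * gr la) +i* (0 + al * gi la) &
      C_matrix u al la ord_max ord0 = (0 + al * gr la) -i* (0 + al * gi la)].
Proof.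
have off : C_matrix u al la ord0 ord_max = (0 + al * gr la) +i* (0 + al * gi la).
  rewrite !mxE pv_densityE /=.
  by apply: complex_ext; rewrite !ReImE /=; ring.
split=> //.
- rewrite !mxE pv_density_diag eqxx.
  by apply: complex_ext; rewrite !ReImE /=; ring.
- rewrite !mxE pv_density_diag eqxx.
  by apply: complex_ext; rewrite !ReImE /=; ring.
- by rewrite C_matrix_hermitian off; apply: complex_ext; rewrite !ReImE.
Qed.

Local Notation e1 := (fun x => pi * Re (eta ord0 ord0 x)).
Local Notation e2 := (fun x => pi * Re (eta ord_max ord_max x)).
Local Notation er := (fun x => pi * Re (eta ord_max ord0 x)).
Local Notation ei := (fun x => pi * Im (eta ord_max ord0 x)).

Lemma D_entries al la :
  [/\ D_matrix u al la ord0 ord0 = (0 + al * e1 la)%:C,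
      D_matrix u al la ord_max ord_max = (0 + al * e2 la)%:C,
      D_matrix u al la ord0 ord_max = (0 + al * er la) +i* (0 + al * ei la) &
      D_matrix u al la ord_max ord0 = (0 + al * er la) -i* (0 + al * ei la)].
Proof.
have d1 := density_diag_real ord0 la; have d2 := density_diag_real ord_max la.
have d3 := density_conj ord_max ord0 la.
split; rewrite !mxE ?d3; apply: complex_ext; rewrite !ReImE /= ?d1 ?d2; ring.
Qed.

End HermitianEntries.

(** * The time delay and the slopes of the paths *)

Lemma hermitian_pencil_det (R : realType) (x1 x2 xr xi y1 y2 yr yi : R) :
  (x1%:C + 'i%C * y1%:C) * (x2%:C + 'i%C * y2%:C) -
  (xr +i* xi + 'i%C * (yr +i* yi)) * (xr -i* xi + 'i%C * (yr -i* yi)) =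
  (x1 * x2 - (xr * xr + xi * xi) - (y1 * y2 - (yr * yr + yi * yi))) +i*
  (x1 * y2 + x2 * y1 - 2 * (xr * yr + xi * yi)).
Proof. by apply: complex_ext; rewrite !ReImE /=; ring. Qed.

Section DeterminantParts.
Local Open Scope ring_scope.
Variable R : realType.
Local Notation fn := (space3 R -> R[i]).
Local Notation sph := (sphere_measure R).
Local Notation Re := complex.Re.
Local Notation Im := complex.Im.
Variable (uf : 'I_2 -> nat -> R -> fn).
Hypothesis suf : forall j, smooth_fibres (uf j).
Local Notation u := (fun k => uf k 0%N).
Local Notation eta j k := (spectral_density (uf j 0%N) (uf k 0%N)).
Local Notation g1 := (hilbert (fun x => Re (eta ord0 ord0 x))).
Local Notation g2 := (hilbert (fun x => Re (eta ord_max ord_max x))).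
Local Notation gr := (hilbert (fun x => Re (eta ord_max ord0 x))).
Local Notation gi := (hilbert (fun x => Im (eta ord_max ord0 x))).
Local Notation e1 := (fun x => pi * Re (eta ord0 ord0 x)).
Local Notation e2 := (fun x => pi * Re (eta ord_max ord_max x)).
Local Notation er := (fun x => pi * Re (eta ord_max ord0 x)).
Local Notation ei := (fun x => pi * Im (eta ord_max ord0 x)).

Lemma detB_parts al la : detB u al la =
  reF g1 g2 gr gi e1 e2 er ei al la +i* imF g1 g2 gr gi e1 e2 er ei al la.
Proof.
have [c1 c2 c3 c4] := C_entries suf al la.
have [d1 d2 d3 d4] := D_entries suf al la.
have BE j k : B_matrix u al la j k = C_matrix u al la j k + 'i%C * D_matrix u al la j k.
  by rewrite [LHS]mxE [X in _ + X]mxE.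
rewrite /detB det2 !BE c1 c2 c3 c4 d1 d2 d3 d4; exact: hermitian_pencil_det.
Qed.

(** Near [la] the determinant of the scattering matrix is [conj F / F] with
    [F = f1 + i f2], and every branch of its argument has the derivative found by
    [arg_derivative_conj_div]. *)
Lemma time_delayE (f1 f2 df1 df2 : R -> R) (S : R -> fn -> fn) (al la : R) :
  (forall mu, detB u al mu = f1 mu +i* f2 mu) ->
  (\forall mu \near la, is_derive (mu : R) 1 f1 (df1 mu) /\ is_derive mu 1 f2 (df2 mu)) ->
  (\forall mu \near la, [/\ 0 <= mu, detB u al mu != 0 &
     forall f, L2 sph f -> \forall x \ae sph,
       S mu f x = stationary_smatrix u al mu f x]) ->
  time_delay S la =
    -2 * (f1 la * df2 la - f2 la * df1 la) / (f1 la ^+ 2 + f2 la ^+ 2).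
Proof.
move=> FE dF hS; have [d1 d2] := nbhs_singleton dF.
have [_ F0 _] := nbhs_singleton hS.
apply: xget_subset1; last by move=> z1 z2; exact: is_arg_derivative_unique.
apply: arg_derivative_conj_div => //.
- by apply: filterS dF => mu [/is_derive1_derivable].
- by apply: filterS dF => mu [_ /is_derive1_derivable].
- apply: contra F0; rewrite FE paddr_eq0 ?sqr_ge0// !sqrf_eq0 => /andP[/eqP-> /eqP->].
  by [].
- apply: filterS hS => mu [mu0 Fmu Smu].
  rewrite -FE; apply: determinant_smatrix => //.
  + by move=> j; exact: fibre_L2.
  + by move=> j k; exact: C_matrix_hermitian.
Qed.

End DeterminantParts.

Section Rates.
Local Open Scope ring_scope.
Variable R : realType.
Variables (al0 n1 n2 m d : R).
Hypotheses (al0_neq0 : al0 != 0) (n1_ge0 : 0 <= n1) (n12 : n1 <= n2) (m_ge0 : 0 <= m).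
Hypothesis D_gt0 : 0 < n1 * n2 - m.
Hypothesis d_gt0 : 0 < d.
Hypothesis dE : d ^+ 2 = (n1 - n2) ^+ 2 + 4 * m.

(** [s] is the slope of the first path. The inequality makes the radicand of
    its coefficient positive, since [n2] is the larger of the two norms; the identity
    evaluates the limit [tau] of [F1' / (alpha - alpha0)] along the path. *)
Lemma rate_first : let s := (n1 + n2 + d) / (2 * al0 ^+ 2 * (n1 * n2 - m)) in
  0 < - 1 + al0 ^+ 2 * n2 * s /\ - (n1 + n2) + 2 * al0 ^+ 2 * s * (n1 * n2 - m) = d.
Proof.
have D0 := lt0r_neq0 D_gt0; split; last by field; rewrite D0 al0_neq0.
rewrite (_ : al0 ^+ 2 * n2 * _ = n2 * (n1 + n2 + d) / (2 * (n1 * n2 - m))); last first.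
  by field; rewrite D0 al0_neq0.
rewrite addrC subr_gt0 ltr_pdivlMr ?mulr_gt0// mul1r.
have n2_gt0 : 0 < n2.
  rewrite lt0r (le_trans n1_ge0 n12) andbT; apply: contraTneq D_gt0 => ->.
  by rewrite mulr0 sub0r oppr_gt0 -leNgt.
have : 0 < n2 * d by rewrite mulr_gt0.
have : 0 <= n2 * (n2 - n1) by apply: mulr_ge0; [exact: ltW|rewrite subr_ge0].
move=> h1 h2; rewrite -subr_gt0 (_ : _ - _ = n2 * (n2 - n1) + n2 * d + 2 * m); last by ring.
by rewrite ltr_wpDr ?mulr_ge0// ltr_wpDl.
Qed.

(** The same for the second path, where the radicand is positive because
    [d < n1 + n2], that is, because the Gram determinant is positive. *)
Lemma rate_second : let s := (n1 + n2 - d) / (2 * al0 ^+ 2 * (n1 * n2 - m)) in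
  0 < 1 - al0 ^+ 2 * n1 * s /\ - (n1 + n2) + 2 * al0 ^+ 2 * s * (n1 * n2 - m) = - d.
Proof.
have D0 := lt0r_neq0 D_gt0; split; last by field; rewrite D0 al0_neq0.
rewrite (_ : al0 ^+ 2 * n1 * _ = n1 * (n1 + n2 - d) / (2 * (n1 * n2 - m))); last first.
  by field; rewrite D0 al0_neq0.
rewrite subr_gt0 ltr_pdivrMr ?mulr_gt0// mul1r.
have nn : 0 <= n1 + n2 by rewrite addr_ge0// (le_trans n1_ge0).
have dn : d < n1 + n2.
  rewrite ltNge; apply/negP => h.
  have : (n1 + n2) ^+ 2 <= d ^+ 2 by rewrite ler_sqr ?nnegrE// ltW.
  rewrite dE -subr_ge0 (_ : _ - _ = - (4 * (n1 * n2 - m))); last by ring.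
  by rewrite oppr_ge0 leNgt mulr_gt0.
have K : (d + (n2 - n1)) * (n1 + n2 - d) =
    2 * (2 * (n1 * n2 - m) - n1 * (n1 + n2 - d)).
  transitivity (2 * d * n1 - d ^+ 2 + n2 ^+ 2 - n1 ^+ 2); first by ring.
  by rewrite dE; ring.
have : 0 < (d + (n2 - n1)) * (n1 + n2 - d).
  have n21 : 0 <= n2 - n1 by rewrite subr_ge0.
  have nd : 0 < n1 + n2 - d by rewrite subr_gt0.
  by apply: mulr_gt0 => //; exact: ltr_wpDr n21 d_gt0.
by rewrite K pmulr_rgt0// subr_gt0.
Qed.

End Rates.

(** * The limit *)

(** The left-hand side is evaluated by [rate_first] and [rate_second], the
    right-hand side is the limit in [dreF_lim]. *)
Lemma split_slope_eq (R : realType) (al n1 n2 g1 g2 x y s : R) :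
  al * g1 = -1 -> al * g2 = -1 ->
  - (n1 + n2) + 2 * al ^+ 2 * s * (n1 * n2 - (x ^+ 2 + y ^+ 2)) =
  al * n1 * (g2 + al * (n2 * s)) + (g1 + al * (n1 * s)) * (al * n2) -
    2 * al ^+ 2 * s * (x ^+ 2 + (- y) ^+ 2).
Proof.
move=> h1 h2.
have -> : - (n1 + n2) = n1 * (al * g2) + n2 * (al * g1) by rewrite h1 h2; ring.
by ring.
Qed.

Lemma entry_slope_eq (R : realType) (al n g s : R) : al * g = -1 ->
  al * (g + al * (n * s)) = -1 + al ^+ 2 * n * s.
Proof. by rewrite mulrDr => ->; ring. Qed.

(** The Gram form of [[n1, z; conj z, n2]] at the vector [(n2, - z)] is [n2] times
    the determinant. *)
Lemma gram_test_vector (R : realType) (n1 n2 : R) (z : R[i]) :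
  n2%:C * ((n2%:C^*)%R * n1%:C + ((- z)^*)%R * z) +
    - z * ((n2%:C^*)%R * (z^*)%R + ((- z)^*)%R * n2%:C) =
  (n2 * (n1 * n2 - (complex.Re z ^+ 2 + complex.Im z ^+ 2)))%:C.
Proof. by case: z => x y; apply: complex_ext; rewrite !ReImE /=; ring. Qed.

Theorem theorem8p6 (R : realType)
  (T : (space3 R -> R[i]) -> measurableTypeR R * space3 R -> R[i])
  (hT : spectral_representation T)
  (u : 'I_2 -> space3 R -> R[i])
  (uf : 'I_2 -> nat -> R -> space3 R -> R[i])
  (hu : forall j, in_E T (u j) (uf j))
  (u_orth : inner (lebesgue3 R) (u ord0) (u ord_max) = 0)
  (alpha0 lambda0 : R) (lambda0_gt0 : 0 < lambda0)
  (hb0 : forall j, \forall w \ae sphere_measure R, uf j 0%N lambda0 w = 0)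
  (hb : forall j k : 'I_2,
    (j == k)%:R + alpha0%:C * pv_transform (spectral_density (uf j 0%N) (uf k 0%N)) lambda0 = 0)
  (phi : 'I_2 -> space3 R -> R[i])
  (hphi : forall j, is_Phi T (uf j) lambda0 (phi j))
  (hc : inner (lebesgue3 R) (phi ord0) (phi ord_max) != 0 \/
        L2norm (lebesgue3 R) (phi ord0) != L2norm (lebesgue3 R) (phi ord_max))
  (hc_label :
    L2norm (lebesgue3 R) (phi ord0) <= L2norm (lebesgue3 R) (phi ord_max))
  (i0 i1 j0 j1 : R)
  (hI : alpha0 \in `]i0, i1[) (hJ : lambda0 \in `]j0, j1[) (hJpos : 0 < j0)
  (lambda : 'I_2 -> R -> R)
  (lambda_J : forall j alpha, alpha \in `]i0, i1[ -> lambda j alpha \in `]j0, j1[)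
  (lambda_neq : exists2 alpha, alpha \in `]i0, i1[ &
    lambda ord0 alpha != lambda ord_max alpha)
  (lambda_smooth : forall j (n : nat) alpha, alpha \in `]i0, i1[ ->
    derivable (derive1n n (lambda j)) alpha 1)
  (lambda_alpha0 : forall j, lambda j alpha0 = lambda0)
  (lambda_zero : forall j alpha, alpha \in `]i0, i1[ ->
    F1 (fun k => uf k 0%N) alpha (lambda j alpha) = 0)
  (lambda_deriv : forall j : 'I_2, derive1 (lambda j) alpha0 =
    (L2norm (lebesgue3 R) (phi ord0) ^+ 2 +
     L2norm (lebesgue3 R) (phi ord_max) ^+ 2 + (- 1) ^+ j * discriminant phi) /
    (2 * alpha0 ^+ 2 *
     (L2norm (lebesgue3 R) (phi ord0) ^+ 2 *
      L2norm (lebesgue3 R) (phi ord_max) ^+ 2 -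
      normc (inner (lebesgue3 R) (phi ord0) (phi ord_max)) ^+ 2)))
  (lambda_only : forall alpha lam, alpha \in `]i0, i1[ -> lam \in `[j0, j1] ->
    F1 (fun k => uf k 0%N) alpha lam = 0 ->
    lam = lambda ord0 alpha \/ lam = lambda ord_max alpha)
  (hd : forall j alpha, alpha \in `]i0, i1[ -> alpha != alpha0 ->
    F2 (fun k => uf k 0%N) alpha (lambda j alpha) != 0)
  (S : R -> R -> (space3 R -> R[i]) -> space3 R -> R[i])
  (hS : forall alpha, alpha \in `]i0, i1[ -> alpha != alpha0 ->
    scattering_matrix T u alpha (S alpha))
  (hSformula : forall alpha lam, alpha \in `]i0, i1[ -> alpha != alpha0 ->
    lam \in `]j0, j1[ -> forall f, L2 (sphere_measure R) f ->
    \forall w \ae sphere_measure R,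
      S alpha lam f w = stationary_smatrix (fun k => uf k 0%N) alpha lam f w)
  (l : 'I_2) (h : R) :
  let kap := kappa (fun k => uf k 0%N) lambda phi l in
  let N := L2norm (lebesgue3 R)
    (fun x => diag_coef alpha0 lambda phi l * phi l x) in
  kap alpha * time_delay (S alpha) (lambda l alpha + h * kap alpha)
    @[alpha --> alpha0^'] --> 2 * (N ^+ 2 / (h ^+ 2 + N ^+ 4)).
Proof.
move=> kap N.
have suf j : smooth_fibres (uf j) by have [] := hu j.
have la0 : 0 <= lambda0 := ltW lambda0_gt0.
have RZ j k := Re_double_zero_gram (suf j) (suf k) la0 (hb0 j) (hb0 k) hT (hphi j) (hphi k).
have IZ j k := Im_double_zero_gram (suf j) (suf k) la0 (hb0 j) (hb0 k) hT (hphi j) (hphi k).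
have [f1 [ce1 [e1z de1z] cg1 dg1]] := RZ ord0 ord0.
have [f2 [ce2 [e2z de2z] cg2 dg2]] := RZ ord_max ord_max.
have [fr [cer [erz derz] cgr dgr]] := RZ ord_max ord0.
have [fi [cei [eiz deiz] cgi dgi]] := IZ ord_max ord0.
have lphi j : L2 (lebesgue3 R) (phi j) := (hphi j).1.
pose G := inner (lebesgue3 R) (phi ord0) (phi ord_max).
have G10 : inner (lebesgue3 R) (phi ord_max) (phi ord0) = (G^*)%R by exact: innerJ.
have G00 := inner_self (lebesgue3 R) (phi ord0).
have G11 := inner_self (lebesgue3 R) (phi ord_max).
rewrite G00 /= in dg1; rewrite G11 /= in dg2; rewrite G10 ReJ in dgr; rewrite G10 ImJ in dgi.
pose n1 := L2norm (lebesgue3 R) (phi ord0) ^+ 2.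
pose n2 := L2norm (lebesgue3 R) (phi ord_max) ^+ 2.
pose m := normc G ^+ 2.
have mE : m = complex.Re G ^+ 2 + complex.Im G ^+ 2 := normc_sqrE G.
have m_ge0 : 0 <= m := sqr_ge0 _.
have n1_ge0 : 0 <= n1 := sqr_ge0 _.
have n12 : n1 <= n2 by rewrite ler_sqr ?nnegrE ?L2norm_ge0.
rewrite -/n1 in dg1 G00; rewrite -/n2 in dg2 G11.
have hb00 := congr1 (@complex.Re R) (hb ord0 ord0).
have hb11 := congr1 (@complex.Re R) (hb ord_max ord_max).
rewrite pv_density_diag// eqxx !ReImE /= mul0r subr0 in hb00.
rewrite pv_density_diag// eqxx !ReImE /= mul0r subr0 in hb11.
have al0_neq0 : alpha0 != 0.
  by apply/eqP => al00; move: hb00; rewrite al00 mul0r addr0 => /eqP; rewrite oner_eq0.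
have hbr := congr1 (@complex.Re R) (hb ord_max ord0).
have hbi := congr1 (@complex.Im R) (hb ord_max ord0).
rewrite pv_densityE// !ReImE /= mul0r subr0 add0r in hbr.
rewrite pv_densityE// !ReImE /= mul0r addr0 add0r in hbi.
have {}hbr := mulfI al0_neq0 (etrans hbr (esym (mulr0 alpha0))).
have {}hbi := mulfI al0_neq0 (etrans hbi (esym (mulr0 alpha0))).
have GD a := @gram_definite R T 2 uf phi alpha0 lambda0 hT suf la0 hb0 hphi hb a.
have n2_neq0 : n2 != 0.
  apply/eqP => n20; have := GD (fun j => (j == ord_max)%:R).
  rewrite !sum_ord2 /= !mul0r add0r rmorph0 mul0r add0r rmorph1 !mul1r G11 n20.
  by move=> /(_ (mulr0 _) ord_max) /eqP; rewrite eqxx oner_eq0.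
(* Weak positivity is the Cauchy-Schwarz inequality; a zero determinant would give
   the Gram form the nontrivial zero [(n2, - G)]. *)
have D_gt0 : 0 < n1 * n2 - m.
  rewrite lt0r subr_ge0; apply/andP; split; last first.
    rewrite /m /n1 /n2 -exprMn ler_sqr ?nnegrE ?normc_ge0 ?mulr_ge0 ?L2norm_ge0//.
    exact: cauchy_schwarz.
  apply/eqP => D0; have := GD (fun j => if j == ord0 then n2%:C else - G).
  rewrite !sum_ord2 /= G00 G11 G10 -/G.
  have -> : n2%:C * ((n2%:C^*)%R * n1%:C + ((- G)^*)%R * G) +
      - G * ((n2%:C^*)%R * (G^*)%R + ((- G)^*)%R * n2%:C) = (n2 * (n1 * n2 - m))%:C.
    by rewrite mE; exact: gram_test_vector.
  rewrite D0 mulr0 => /(_ erefl ord0) /= /eqP.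
  by rewrite eq_complex /= eqxx andbT (negbTE n2_neq0).
have n1_neq0 : n1 != 0.
  by apply: contraTneq D_gt0 => ->; rewrite mul0r sub0r oppr_gt0 -leNgt.
pose d := discriminant phi.
have dE : d ^+ 2 = (n1 - n2) ^+ 2 + 4 * m.
  by rewrite sqr_sqrtr// addr_ge0 ?sqr_ge0// mulr_ge0.
have d_gt0 : 0 < d.
  rewrite sqrtr_gt0; case: hc => [Gn0|nn].
    apply: ltr_wpDl; first exact: sqr_ge0.
    rewrite mulr_gt0// exprn_gt0// lt0r normc_ge0 andbT.
    by apply: contra Gn0 => /eqP/eq0_normc G0; apply/eqP.
  apply: ltr_wpDr; first by rewrite mulr_ge0.
  by rewrite lt0r sqr_ge0 andbT sqrf_eq0 subr_eq0 eqrXn2 ?L2norm_ge0.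
have d_neq0 := lt0r_neq0 d_gt0.
have dlam j : is_derive alpha0 1 (lambda j) (derive1 (lambda j) alpha0).
  exact: derivable_is_derive1 (lambda_smooth j 0%N alpha0 hI).
have s0 : derive1 (lambda ord0) alpha0 = (n1 + n2 + d) / (2 * alpha0 ^+ 2 * (n1 * n2 - m)).
  by rewrite lambda_deriv /= expr0 mul1r.
have s1 : derive1 (lambda ord_max) alpha0 = (n1 + n2 - d) / (2 * alpha0 ^+ 2 * (n1 * n2 - m)).
  by rewrite lambda_deriv /= expr1 mulN1r.
have [r0 t0] := rate_first al0_neq0 n1_ge0 n12 m_ge0 D_gt0 d_gt0.
have [r1 t1] := rate_second al0_neq0 n1_ge0 n12 D_gt0 d_gt0 dE.
rewrite -s0 in r0 t0; rewrite -s1 in r1 t1.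
have Inear : \forall al \near alpha0^', (al \in `]i0, i1[) /\ (al != alpha0).
  near=> al; split; last by near: al; exact: nbhs_dnbhs_neq.
  by near: al; apply: nbhs_dnbhs; exact: near_in_itvoo.
have scal c (f f' : R -> R) : C1_at lambda0 f f' ->
    C1_at lambda0 (fun x => c * f x) (fun x => c * f' x).
  move=> [df cf]; split; first by apply: filterS df => x; exact: is_derive1_scale.
  by apply: cvgM => //; exact: cvg_cst.
have {}ce1 := scal pi _ _ ce1; have {}ce2 := scal pi _ _ ce2.
have {}cer := scal pi _ _ cer; have {}cei := scal pi _ _ cei.
have pi0 (x : R) : x = 0 -> pi * x = 0 by move=> ->; rewrite mulr0.
pose g1 := hilbert (fun x => complex.Re (spectral_density (uf ord0 0%N) (uf ord0 0%N) x)).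
pose g2 := hilbert (fun x => complex.Re (spectral_density (uf ord_max 0%N) (uf ord_max 0%N) x)).
pose gr := hilbert (fun x => complex.Re (spectral_density (uf ord_max 0%N) (uf ord0 0%N) x)).
pose gi := hilbert (fun x => complex.Im (spectral_density (uf ord_max 0%N) (uf ord0 0%N) x)).
set e1 := (fun x => pi * complex.Re (spectral_density (uf ord0 0%N) (uf ord0 0%N) x)) in ce1.
set e2 := (fun x => pi * complex.Re (spectral_density (uf ord_max 0%N) (uf ord_max 0%N) x)) in ce2.
set er := (fun x => pi * complex.Re (spectral_density (uf ord_max 0%N) (uf ord0 0%N) x)) in cer.
set ei := (fun x => pi * complex.Im (spectral_density (uf ord_max 0%N) (uf ord0 0%N) x)) in cei.
pose v k := uf k 0%N.
pose rF := reF g1 g2 gr gi e1 e2 er ei; pose iF := imF g1 g2 gr gi e1 e2 er ei.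
have FE al la : detB v al la = rF al la +i* iF al la := detB_parts suf al la.
have F1E al la : F1 v al la = rF al la by rewrite /F1 FE.
have F2E al la : F2 v al la = iF al la by rewrite /F2 FE.
have zl j : \forall al \near alpha0^', rF al (lambda j al) = 0.
  by apply: filterS Inear => al [alI _]; rewrite -F1E; exact: lambda_zero.
have nz j : \forall al \near alpha0^', iF al (lambda j al) != 0.
  by apply: filterS Inear => al [alI aln]; rewrite -F2E; exact: hd.
have sl j := lam_slope (lambda_alpha0 j) (dlam j).
have [G1 G2] := (affine_entry_lim cg1 (sl ord_max) hb00, affine_entry_lim cg2 (sl ord0) hb11).
have CE al la := C_entries suf al la.
have near_path (cl : R -> R) (gam n : R) :
    cl al / (al - alpha0) @[al --> alpha0^'] --> gam -> gam != 0 -> n != 0 ->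
    (lambda l al + h * width g1 g2 gr gi e1 e2 er ei (lambda l) cl n al)
      @[al --> alpha0^'] --> lambda0.
  move=> clim gam0 n0.
  exact: (width_target_cvg al0_neq0 cg1 cg2 cgr cgi ce1 ce2 cer cei hb00 hb11 hbr hbi
    (pi0 _ e1z) (pi0 _ e2z) (pi0 _ erz) (pi0 _ eiz) (pi0 _ de1z) (pi0 _ de2z)
    (pi0 _ derz) (pi0 _ deiz) h (lambda_alpha0 l) (dlam l) (nz l) clim gam0 n0).
have oppE (x : R) : 1 + x = 0 -> x = -1 by move=> /eqP; rewrite addrC addr_eq0 => /eqP.
have gE1 : alpha0 * g1 lambda0 = -1 := oppE _ hb00.
have gE2 : alpha0 * g2 lambda0 = -1 := oppE _ hb11.
(* [tau] as it appears in [rate_first] and [rate_second], and as the limit of the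
   derivative of [F1] along a path. *)
have tauE s : - (n1 + n2) + 2 * alpha0 ^+ 2 * s * (n1 * n2 - m) =
    alpha0 * hilbert f1 lambda0 * (g2 lambda0 + alpha0 * (hilbert f2 lambda0 * s)) +
    (g1 lambda0 + alpha0 * (hilbert f1 lambda0 * s)) * (alpha0 * hilbert f2 lambda0) -
    2 * alpha0 ^+ 2 * s * (hilbert fr lambda0 ^+ 2 + hilbert fi lambda0 ^+ 2).
  by rewrite dg1 dg2 dgr dgi mE; exact: split_slope_eq.
pose drF := dreF g1 g2 gr gi e1 e2 er ei (hilbert f1) (hilbert f2) (hilbert fr) (hilbert fi)
  (fun x => pi * f1 x) (fun x => pi * f2 x) (fun x => pi * fr x) (fun x => pi * fi x).
pose diF := dimF g1 g2 gr gi e1 e2 er ei (hilbert f1) (hilbert f2) (hilbert fr) (hilbert fi)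
  (fun x => pi * f1 x) (fun x => pi * f2 x) (fun x => pi * fr x) (fun x => pi * fi x).
have dF : \forall mu \near lambda0, forall al,
    is_derive (mu : R) 1 (rF al) (drF al mu) /\ is_derive mu 1 (iF al) (diF al mu).
  exact: is_derive_F.
have delay_near (x : R -> R) : x al @[al --> alpha0^'] --> lambda0 ->
   \forall al \near alpha0^', time_delay (S al) (x al) =
     -2 * (rF al (x al) * diF al (x al) - iF al (x al) * drF al (x al)) /
       (rF al (x al) ^+ 2 + iF al (x al) ^+ 2).
  move=> xl.
  have Jnear : \forall mu \near lambda0, (mu : R) \in `]j0, j1[ by exact: near_in_itvoo.
  have good : \forall al \near alpha0^', \forall mu \near x al,
      (forall al, is_derive (mu : R) 1 (rF al) (drF al mu) /\
        is_derive mu 1 (iF al) (diF al mu)) /\ ((mu : R) \in `]j0, j1[).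
    exact: (xl _ (nbhs_interior (filterI dF Jnear))).
  apply: filterS2 Inear good => al [alI aln] good_al.
  apply: (time_delayE suf).
  - by move=> mu; exact: FE.
  - by apply: filterS good_al => mu [+ _] => /(_ al).
  - apply: filterS good_al => mu [_ muJ]; split.
    + by move: muJ; rewrite in_itv /= => /andP[/ltW + _]; apply: le_trans; exact: ltW.
    (* A zero of [F] is a zero of [F1], hence lies on a path, where [F2] does not
       vanish. *)
    + apply/eqP => F0.
      have F10 : F1 v al mu = 0 by rewrite /F1 F0.
      have F20 : F2 v al mu = 0 by rewrite /F2 F0.
      have [muE|muE] := lambda_only al mu alI (subset_itv_oo_cc muJ) F10.
        by have := hd ord0 al alI aln; rewrite -muE F20 eqxx.
      by have := hd ord_max al alI aln; rewrite -muE F20 eqxx.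
    + by move=> f lf; exact: hSformula.
(* Both cases of [l] are instances of [peak_limit], with the cofactor [cl], the
   limit [gam] of its quotient by [alpha - alpha0], and [tau] left open. *)
have core (cl : R -> R) (gam n tau s : R) :
    cl al / (al - alpha0) @[al --> alpha0^'] --> gam -> gam != 0 -> n != 0 ->
    derive1 (lambda l) alpha0 = s ->
    - (n1 + n2) + 2 * alpha0 ^+ 2 * s * (n1 * n2 - m) = tau -> tau != 0 ->
    (forall al, kap al = width g1 g2 gr gi e1 e2 er ei (lambda l) cl n al) ->
    N ^+ 2 = alpha0 * gam * n / tau ->
    kap alpha * time_delay (S alpha) (lambda l alpha + h * kap alpha)
    @[alpha --> alpha0^'] --> 2 * (N ^+ 2 / (h ^+ 2 + N ^+ 4)).
  move=> clim gam0 n0 sE tE tau0 kE NE.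
  rewrite -sE tauE in tE.
  have := peak_limit al0_neq0 cg1 cg2 cgr cgi ce1 ce2 cer cei hb00 hb11 hbr hbi
    (pi0 _ e1z) (pi0 _ e2z) (pi0 _ erz) (pi0 _ eiz) (pi0 _ de1z) (pi0 _ de2z)
    (pi0 _ derz) (pi0 _ deiz) (h := h) (lambda_alpha0 l) (dlam l) (zl l) (nz l)
    clim gam0 n0 (esym tE) tau0.
  rewrite -NE -exprM; apply: eq_cvgl.
  have := delay_near _ (near_path cl gam n clim gam0 n0).
  by apply: filterS => al delay; rewrite kE delay.
have NE : N ^+ 2 = normc (diag_coef alpha0 lambda phi l) ^+ 2 * L2norm (lebesgue3 R) (phi l) ^+ 2.
  by rewrite /N L2norm_scale// exprMn.
have [lE|lE] := ord2P l.
- have gamE : alpha0 * (g2 lambda0 + alpha0 * (hilbert f2 lambda0 * derive1 (lambda ord0) alpha0)) =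
      - 1 + alpha0 ^+ 2 * n2 * derive1 (lambda ord0) alpha0.
    by rewrite dg2; exact: entry_slope_eq.
  apply: (core _ _ n1 d _ G2 _ n1_neq0 _ t0) => //; last 2 first.
  + move=> al; rewrite /kap /kappa F2E lE cofactor_ord0.
    by have [_ -> _ _] := CE al (lambda ord0 al).
  + rewrite NE gamE /diag_coef lE eqxx normcR ger0_norm ?sqrtr_ge0//.
    rewrite sqr_sqrtr ?divr_ge0 ?(ltW r0) ?(ltW d_gt0)//.
    by rewrite -/n1 -/n2 -/d mulrAC.
  + by move: (lt0r_neq0 r0); rewrite -gamE mulf_eq0 (negbTE al0_neq0).
  + by rewrite lE.
- have gamE : alpha0 * (g1 lambda0 +
        alpha0 * (hilbert f1 lambda0 * derive1 (lambda ord_max) alpha0)) =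
      - (1 - alpha0 ^+ 2 * n1 * derive1 (lambda ord_max) alpha0).
    by rewrite dg1 opprB [RHS]addrC; exact: entry_slope_eq.
  have phase1 : normc (phase G) = 1.
    rewrite /phase; case: eqVneq => [_|G0]; first by rewrite normc1.
    have nG : normc G != 0 by apply: contra G0 => /eqP/eq0_normc ->.
    by rewrite normcM normcV normcR ger0_norm ?normc_ge0// divff.
  apply: (core _ _ n2 (- d) _ G1 _ n2_neq0 _ t1) => //; last 2 first.
  + move=> al; rewrite /kap /kappa F2E lE cofactor_ord_max.
    by have [-> _ _ _] := CE al (lambda ord_max al).
  + rewrite NE gamE /diag_coef lE /= normcM -/G phase1 mul1r normcR ger0_norm ?sqrtr_ge0//.
    rewrite sqr_sqrtr ?divr_ge0 ?(ltW r1) ?(ltW d_gt0)//.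
    by rewrite -/n1 -/n2 -/d invrN mulrN !mulNr opprK mulrAC.
  + by move: (lt0r_neq0 r1); rewrite -oppr_eq0 -gamE mulf_eq0 (negbTE al0_neq0).
  + by rewrite lE.
  + by rewrite oppr_eq0.
Unshelve. all: by end_near.
Qed.
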